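(* Let $\mu_0$ be the probability measure on $\mathbb{R}$ with moments $\int_{\mathbb{R}}x^k\,d\mu_0(x)=\frac{k^k}{(k+1)!}$ for all $k\in\mathbb{N}$. Then: 1. $\mu_0$ has a density $f_0$ (with respect to Lebesgue measure) that is continuous on $\mathbb{R}\setminus\{0\}$, and its support is $[0,e]$. 2. The Stieltjes transform $S$ of $\mu_0$ satisfies $$S(z)=-1-\frac{1}{zW(-z^{-1})}=-1+e^{W(-z^{-1})}$$ for all $z\in\mathbb{C}$ with $\operatorname{Im}(z)>0$. 3. The $R$-transform of $\mu_0$ is $$R(z)=-\frac{1}{(1-z)\log(1-z)}-\frac1z$$ for all $z\in\mathbb{C}$ with $|z|<1$.
   Context: $\mathbb{N}=\{0,1,2,\dots\}$ and $0^0=1$. The measure $\mu_0$ is uniquely determined by these moments; it is the almost sure weak limit of the empirical eigenvalue distributions of $\frac1nX(n)X(n)^*$, where $X(n)$ is the $n\times n$ lower triangular matrix with i.i.d. complex entries of variance $1$ on and below the diagonal. $W$ is the principal branch of the Lambert function, i.e. of the inverse of $w\mapsto we^w$; it is analytic on $\mathbb{C}\setminus(-\infty,-e^{-1}]$, with $W(0)=0$. The Stieltjes transform is $S(z)=\int_{\mathbb{R}}\frac{1}{x-z}\,d\mu_0(x)$. The $R$-transform is $R(z)=K(z)-z^{-1}$, where $K$ satisfies $S(K(z))=-z$: for $z\neq0$ near $0$, $K(z)$ is the solution with $|K(z)|\to\infty$ as $z\to0$. $R$ extends analytically to $z=0$, and for other $z$ with $|z|<1$, $R(z)$ is understood as the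 analytic continuation of this function. The formula in item 3 is understood at $z=0$ through its removable singularity. $\log$ is the principal logarithm. *)

(* Defs.v *)
From HB Require Import structures.
From mathcomp Require Import all_boot all_order all_algebra.
From mathcomp Require Import complex.
From mathcomp Require Import all_classical all_reals all_analysis.

Set Implicit Arguments.
Unset Strict Implicit.
Unset Printing Implicit Defensive.

Import Order.TTheory GRing.Theory Num.Theory.
Import numFieldNormedType.Exports.

Local Open Scope classical_set_scope.
Local Open Scope ring_scope.
Local Open Scope complex_scope.

(* [R[i]] carries its norm topology only through the alias [R[i]^o]. *)
Notation C R := (R[i]^o)%type.

Section ComplexFunctions.
Context {R : realType}.

(* The norm [`|z|] of [R[i]] is valued in [R[i]]; this is its real value. *)
Definition cmod (z : C R) : R := complex.Re `|z|.

Definition cexp (z : C R) : C R :=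
  (expR (complex.Re z) * cos (complex.Im z)) +i*
  (expR (complex.Re z) * sin (complex.Im z)).

(* Principal argument, in ]-pi, pi]; no meaning at 0. *)
Definition carg (z : C R) : R :=
  if 0 <= complex.Im z then acos (complex.Re z / cmod z)
  else - acos (complex.Re z / cmod z).

Definition clog (z : C R) : C R := ln (cmod z) +i* carg z.

(* Analytic: locally the sum of a convergent power series at each point. *)
Definition analytic_on (U : set (C R)) (f : C R -> C R) : Prop :=
  forall z0, U z0 -> exists a : nat -> C R,
    \forall z \near z0, series (fun n => a n * (z - z0) ^+ n) @ \oo --> f z.

(* The complement of the half-line ]-oo, -1/e]. *)
Definition slit_plane : set (C R) :=
  [set z | ~ (complex.Im z = 0 /\ complex.Re z <= - expR (- 1))].

(* Principal branch of the Lambert W function. These conditions determine [W]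
   on [slit_plane], which is connected: near 0 the equation has only one
   solution close to [W 0 = 0]. *)
Definition is_lambertW0 (W : C R -> C R) : Prop :=
  [/\ analytic_on slit_plane W, W 0 = 0 &
      forall z, slit_plane z -> W z * cexp (W z) = z].

Definition unit_disc : set (C R) := [set z | cmod z < 1].

End ComplexFunctions.

Section Transforms.
Context {R : realType}.
Implicit Type mu : probability (measurableTypeR R) R.

Definition has_moments mu (m : nat -> R) : Prop :=
  forall k, mu.-integrable setT (fun x => (x ^+ k)%:E) /\
            (\int[mu]_x (x ^+ k)%:E = (m k)%:E)%E.

Definition is_density mu (f : R -> R) : Prop :=
  [/\ forall x, 0 <= f x,
      measurable_fun [set: measurableTypeR R] (f : measurableTypeR R -> R) &
      forall A : set (measurableTypeR R), measurable A ->
        (mu A = \int[lebesgue_measure]_(x in A) (f x)%:E)%E].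

Definition msupport mu : set R :=
  [set x | forall U : set R, open U -> U x -> (0 < mu U)%E].

(* Stieltjes transform; the complex integral is taken componentwise. *)
Definition stieltjes mu (z : C R) : C R :=
  (\int[mu]_x complex.Re ((x%:C - z)^-1)) +i*
  (\int[mu]_x complex.Im ((x%:C - z)^-1)).

(* [Rt] is the R-transform of [mu] on [U], an open connected neighbourhood of
   0: the analytic continuation to [U] (including 0) of [K z - z^-1], where
   near 0 [K z] is the solution of [stieltjes mu (K z) = - z] that tends to
   infinity as [z] tends to 0. *)
Definition is_Rtransform mu (U : set (C R)) (Rt : C R -> C R) : Prop :=
  analytic_on U Rt /\
  exists K : C R -> C R,
    [/\ forall M : R, \forall z \near 0^', M < cmod (K z),
        \forall z \near 0^', stieltjes mu (K z) = - z &
        \forall z \near 0^', Rt z = K z - z^-1].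

End Transforms.

(* Main.v *)
(* By Abel's binomial identity the moments m_k = k^k / (k+1)! satisfy
   sum_(i <= n) (i+1) m_i m_(n-i) = (n+2) m_(n+1) - n m_n, which says that
   T = 1 + S solves z (z T - 1) T' = T near infinity, and then on the upper
   half-plane because the measure has bounded support. Along rays the equation
   integrates to T exp(1 / (z T)) = 1, so that w = - 1 / (z T) satisfies
   exp w = T and w exp w = - 1 / z. An intermediate value argument puts w in
   the strip 0 < Im w < pi, where w |-> w exp w takes each value of the closed
   upper half-plane at most once; this identifies w with W(- 1 / z).

   The same injectivity, applied to cluster points, shows that w and hence T
   extend continuously from the upper half-plane to every real x != 0, with
   Im T > 0 exactly on ]0, e[. Stieltjes inversion then produces the density
   Im T / pi on both sides of 0, and 0 is not an atom since y T(i y) -> 0.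

   For the R-transform, S(K) = - z means T(K) = 1 - z, hence w = log(1 - z)
   and K = - 1 / (w exp w) = - 1 / ((1 - z) log(1 - z)). *)
From HB Require Import structures.
Require Import Defs.
From mathcomp Require Import all_boot all_order all_algebra.
From mathcomp Require Import complex.
From mathcomp Require Import all_classical all_reals all_analysis.
From mathcomp Require Import measurable_realfun.
From mathcomp Require Import ring lra zify.
Set Implicit Arguments.
Unset Strict Implicit.
Unset Printing Implicit Defensive.
Import Order.TTheory GRing.Theory Num.Theory.
Import numFieldNormedType.Exports.
Local Open Scope classical_set_scope.
Local Open Scope ring_scope.
Local Open Scope complex_scope.

(** * The moment recurrence *)

(** The differential equation is exact: the derivative of log T + 1 / (z T) is [ode_defect] divided
    by (z T)^2, which is where the first integral T exp(1 / (z T)) comes from. The exponential form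
    avoids choosing a branch of log T, and the constant is 1 because T tends to 1 at infinity. The
    equation w e^w = y has infinitely many complex solutions, and W is known only through
    [is_lambertW0]. What singles out one solution is a path: both candidates start from 0, one at z
    = infinity and the other at the origin, and neither can leave the strip on the way. Complex
    analysis is confined to two tools: power series with their identity theorem, and derivatives
    along real paths taken componentwise, to which real mean value arguments apply. The bounds on T
    degenerate at 0, so inversion runs on intervals that avoid 0; the absence of an atom glues the
    two sides. *)

Lemma sum_alt_bin_horner (R : numFieldType) n (p : {poly R}) : (size p <= n)%N ->
  \sum_(k < n.+1) (-1) ^+ k * 'C(n, k)%:R * p.[k%:R] = 0.
Proof.
elim: n p => [p|n IHn p sp].
  by rewrite leqn0 size_poly_eq0 => /eqP ->; rewrite big1// => i _; rewrite horner0 mulr0.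
(* The sum is, up to sign, the n-th finite difference of p at 0. A single difference cancels the
   leading term, and Pascal's rule turns order n + 1 for p into order n for q. *)
pose q := p - (p \Po ('X + 1%:P)).
have sq : (size q <= n)%N.
  have [p0|p0] := eqVneq p 0; first by rewrite /q p0 comp_poly0 subrr size_poly0.
  have sX : size ('X + 1%:P : {poly R}) = 2 by rewrite size_XaddC.
  have sc : size (p \Po ('X + 1%:P)) = size p by rewrite size_comp_poly2.
  apply/leq_sizeP => j nj; rewrite coefB.
  have [jp|jp] := ltnP j (size p).
    have -> : j = (size p).-1.
      by apply/eqP; rewrite eqn_leq -ltnS prednK ?jp ?size_poly_gt0//=
        -ltnS prednK ?size_poly_gt0// (leq_trans sp).
    rewrite -{2}sc -!/(lead_coef _) lead_coef_comp ?sX//.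
    by rewrite lead_coefXaddC expr1n mulr1 subrr.
  by rewrite !nth_default ?subrr// sc.
rewrite -[RHS](IHn _ sq) /q.
under [RHS]eq_bigr do rewrite hornerD hornerN horner_comp hornerD hornerX hornerC mulrBr.
rewrite sumrB.
rewrite big_ord_recl /= bin0 expr0 mul1r mul1r.
under eq_bigr do rewrite /bump /= add1n binS natrD mulrDr mulrDl.
rewrite big_split /= addrA; congr (_ + _).
  rewrite big_ord_recr /= bin_small// mulr0 mul0r addr0.
  by rewrite [RHS]big_ord_recl /= bin0 expr0 !mul1r.
by rewrite -sumrN; apply: eq_bigr => i _; rewrite exprS mulN1r !mulNr -natr1.
Qed.

Lemma eq_deriv_horner (R : numFieldType) (p q : {poly R}) (a : R) :
  p^`() = q^`() -> p.[a] = q.[a] -> p = q.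
Proof.
move=> dpq pq; apply/eqP; rewrite -subr_eq0; apply/eqP; set r := p - q.
have r' : r^`() = 0 by rewrite derivB dpq subrr.
have ra : r.[a] = 0 by rewrite hornerD hornerN pq subrr.
have rC : r = (r`_0)%:P.
  apply/polyP => -[|i]; rewrite coefC//=.
  have := coef_deriv r i; rewrite r' coef0 => /esym/eqP.
  by rewrite mulrn_eq0 /= => /eqP.
have r0 : r`_0 = 0 by have := congr1 (horner^~ a) rC; rewrite /= ra hornerC.
by rewrite rC r0.
Qed.

(* Abel's binomial identity
   [\sum_k 'C(n, k) x (x + k)^(k-1) (y + n - k)^(n-k) = (x + y + n)^n] at
   [x = -1], with the term [k = 0] isolated and [k] shifted by one. *)
Lemma abel_poly (R : numFieldType) n :
  ('X + n%:R%:P) ^+ n - \sum_(k < n) ('C(n, k.+1) * k ^ k)%N%:R *: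
     ('X + (n.-1 - k)%N%:R%:P) ^+ (n.-1 - k)
  = ('X + (n%:R - 1)%:P) ^+ n :> {poly R}.
Proof.
elim: n => [|n IHn]; first by rewrite big_ord0 subr0 !expr0.
(* At X = - n the base of the k-th summand becomes - k, so the sum turns into an alternating
   binomial sum of values of (X - 1)^n, to which [sum_alt_bin_horner] applies. *)
apply: (@eq_deriv_horner _ _ _ (- n%:R)).
  have dX (c : R) m : (('X + c%:P) ^+ m)^`() = m%:R *: ('X + c%:P) ^+ m.-1.
    by rewrite deriv_exp derivD derivX derivC addr0 mul1r scaler_nat.
  rewrite derivB raddf_sum /= !dX /=.
  under eq_bigr do rewrite linearZ /= dX.
  rewrite big_ord_recr /= subnn scale0r scaler0 addr0.
  (* The derivative of the identity of order n + 1 is n + 1 times the identity of order n with X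
     replaced by X + 1. *)
  have IH' : ('X + (n%:R + 1)%:P) ^+ n - \sum_(k < n) ('C(n, k.+1) * k ^ k)%N%:R *:
       ('X + ((n.-1 - k)%N%:R + 1)%:P) ^+ (n.-1 - k) = ('X + n%:R%:P) ^+ n :> {poly R}.
    have cX (c : R) m : ('X + c%:P) ^+ m \Po ('X + 1%:P) = ('X + (c + 1)%:P) ^+ m.
      by rewrite rmorphXn /= comp_polyD comp_polyX comp_polyC -addrA -polyCD (addrC 1).
    have := congr1 (fun p : {poly R} => p \Po ('X + 1%:P)) IHn.
    rewrite comp_polyB raddf_sum /= !cX subrK => <-; congr (_ - _).
    by apply: eq_bigr => i _; rewrite comp_polyZ cX.
  have -> : n.+1%:R - 1 = n%:R :> R by rewrite -natr1 addrK.
  rewrite -[in RHS]IH' scalerBr natr1; congr (_ - _).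
  rewrite scaler_sumr; apply: eq_bigr => i _.
  have -> : (n - i)%N%:R = (n.-1 - i)%N%:R + 1 :> R.
    by rewrite natr1; congr _%:R; have := ltn_ord i; lia.
  rewrite !scalerA.
  have -> : (n - i).-1 = (n.-1 - i)%N by lia.
  congr (_ *: _); rewrite natr1 -!natrM; congr _%:R.
  have -> : (n.-1 - i).+1 = (n - i)%N by have := ltn_ord i; lia.
  rewrite mulnAC mulnA; congr (_ * _)%N.
  by rewrite mulnC (mul_bin_down n.+1 i.+1).
have hX (c x : R) : ('X + c%:P).[x] = x + c by rewrite !hornerE.
rewrite hornerD hornerN horner_sum !horner_exp !hX.
have -> : - n%:R + n.+1%:R = 1 :> R by rewrite -natr1; ring.
have -> : - n%:R + (n.+1%:R - 1) = 0 :> R by rewrite -natr1; ring.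
rewrite expr1n expr0n /=.
have := @sum_alt_bin_horner R n.+1 (('X - 1%:P) ^+ n).
rewrite size_exp_XsubC => /(_ (leqnn _)).
under [X in X = 0 -> _]eq_bigr do rewrite horner_exp hornerXsubC.
rewrite big_ord_recl /= bin0 sub0r mulr1 expr0 mul1r => h.
apply/eqP; rewrite subr_eq0 eq_sym; apply/eqP.
transitivity ((-1) ^+ n * (-1) ^+ n : R); last by rewrite -expr2 sqrr_sign.
rewrite -[X in _ = _ * X]opprK (addr0_eq h) mulrN mulr_sumr -sumrN; apply: eq_bigr => i _.
rewrite hornerZ horner_exp hX /= /bump /= add1n -natr1 addrK.
have lin : (i <= n)%N by rewrite -ltnS ltn_ord.
have -> : - n%:R + (n - i)%N%:R = - i%:R :> R by rewrite natrB//; ring.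
have eD (x : R) : x ^+ n = x ^+ (n - i) * x ^+ i by rewrite -exprD subnK.
rewrite !eD exprS [(- i%:R) ^+ _]exprNn natrM natrX.
have e1 : (-1) ^+ i * (-1) ^+ i = 1 :> R by rewrite -expr2 sqrr_sign.
by ring: e1.
Qed.

(** [abel_poly] of order n + 1 at X = 0, divided by (n + 1)!: its k-th summand splits as m_k times
    (n - k + 1) m_(n-k), and reversing the sum puts the linear factor on the first moment. *)
Lemma moment_convolution (R : numFieldType) (n : nat)
    (m := fun k => (k ^ k)%N%:R / (k.+1)`!%N%:R : R) :
  \sum_(i < n.+1) i.+1%:R * m i * m (n - i)%N = n.+2%:R * m n.+1 - n%:R * m n.
Proof.
have /(congr1 (horner^~ 0)) := abel_poly R n.+1.
have hX (c : R) : ('X + c%:P).[0] = c by rewrite !hornerE.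
rewrite hornerD hornerN horner_sum !horner_exp !hX -natr1 addrK => h.
have F k : k`!%:R != 0 :> R by rewrite pnatr_eq0 -lt0n fact_gt0.
apply: (mulIf (F n.+1)).
transitivity (n.+1%:R ^+ n.+1 - n%:R ^+ n.+1 : R); last first.
  rewrite /m factS natrM !natrX; have := F n.+1; rewrite factS natrM.
  move=> f1; rewrite [n%:R ^+ n.+1]exprS; set a := n.+1%:R ^+ n.+1.
  have [] : n.+2%:R != 0 :> R /\ n.+1%:R != 0 :> R by rewrite !pnatr_eq0.
  move: (F n) {f1 h}; move: a (n.+2%:R : R) (n.+1%:R : R) (n`!%:R : R) (n%:R ^+ n : R) (n%:R : R).
  by move=> a b c d e f d0 b0 c0; field; rewrite ?b0 ?c0 ?d0.
rewrite natr1 in h; rewrite -h opprB addrC subrK.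
rewrite mulr_suml (reindex_inj rev_ord_inj) /=; apply: eq_bigr => i _.
rewrite hornerZ horner_exp hX subSS /m.
have lin : (i <= n)%N by rewrite -ltnS ltn_ord.
rewrite subKn// -(bin_fact (_ : i.+1 <= n.+1)%N)// subSS !factS !natrM !natrX.
have [] : (n - i).+1%:R != 0 :> R /\ i.+1%:R != 0 :> R by rewrite !pnatr_eq0.
move: (F i) (F (n - i)%N); move: (i`!%:R : R) ((n - i)`!%:R : R) (i.+1%:R : R)
  ((n - i).+1%:R : R) (i%:R ^+ i : R) ((n - i)%:R ^+ (n - i) : R) => a b c d e f.
by move=> a0 b0 d0 c0; field; rewrite ?a0 ?b0 ?c0 ?d0.
Qed.

(** * Complex power series *)

Section Complex.
Context {R : realType}.
Implicit Types (x y z w : C R).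

Lemma normE z : `|z| = (cmod z)%:C.
Proof. by case: z. Qed.

Lemma cmodE z : cmod z = Num.sqrt (complex.Re z ^+ 2 + complex.Im z ^+ 2).
Proof. by case: z. Qed.

Lemma cmod_ge0 z : 0 <= cmod z. Proof. by rewrite cmodE sqrtr_ge0. Qed.

Lemma cmod_eq0 z : (cmod z == 0) = (z == 0).
Proof. by rewrite -[RHS]normr_eq0 normE eq_complex /= eqxx andbT. Qed.

Lemma cmod_gt0 z : (0 < cmod z) = (z != 0).
Proof. by rewrite lt0r cmod_ge0 andbT cmod_eq0. Qed.

Lemma cmod0 : cmod (0 : C R) = 0.
Proof. by apply/eqP; rewrite cmod_eq0. Qed.

Lemma cmod1 : cmod (1 : C R) = 1.
Proof. by rewrite /cmod normr1. Qed.

Lemma cmodM z w : cmod (z * w) = cmod z * cmod w.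
Proof. by apply: complexI; rewrite rmorphM /= -!normE normrM. Qed.

Lemma cmodV z : cmod (z^-1) = (cmod z)^-1.
Proof. by apply: complexI; rewrite fmorphV /= -!normE normfV. Qed.

Lemma cmodX z n : cmod (z ^+ n) = cmod z ^+ n.
Proof. by apply: complexI; rewrite rmorphXn /= -!normE normrX. Qed.

Lemma cmodN z : cmod (- z) = cmod z.
Proof. by rewrite /cmod normrN. Qed.

Lemma cmodBC z w : cmod (z - w) = cmod (w - z).
Proof. by rewrite /cmod distrC. Qed.

Lemma cmodD z w : cmod (z + w) <= cmod z + cmod w.
Proof. by rewrite -lecR rmorphD /= -!normE ler_normD. Qed.

Lemma cmodB z w : cmod (z - w) <= cmod z + cmod w.
Proof. by rewrite (le_trans (cmodD _ _))// cmodN. Qed.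

Lemma cmodB_ge z w : cmod z - cmod w <= cmod (z - w).
Proof. by rewrite lerBlDr (le_trans _ (cmodD _ _))// subrK. Qed.

Lemma cmod_real (t : R) : cmod (t%:C : C R) = `|t|.
Proof. by rewrite cmodE /= expr0n /= addr0 sqrtr_sqr. Qed.

Lemma cmod_nat n : cmod (n%:R : C R) = n%:R.
Proof. by rewrite -[in LHS](rmorph_nat (real_complex R)) cmod_real ger0_norm. Qed.

Lemma normRe_le z : `|complex.Re z| <= cmod z.
Proof.
by rewrite cmodE -sqrtr_sqr ler_sqrt ?addr_ge0 ?sqr_ge0// lerDl sqr_ge0.
Qed.

Lemma normIm_le z : `|complex.Im z| <= cmod z.
Proof.
by rewrite cmodE -sqrtr_sqr ler_sqrt ?addr_ge0 ?sqr_ge0// lerDr sqr_ge0.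
Qed.

Lemma cmod_le_ReIm z : cmod z <= `|complex.Re z| + `|complex.Im z|.
Proof.
rewrite [z in cmod z]complexE (le_trans (cmodD _ _))// cmod_real cmodM cmod_real.
by rewrite cmodE /= expr0n expr1n add0r sqrtr1 mul1r.
Qed.

Lemma cmod_sum n (F : nat -> C R) : cmod (\sum_(k < n) F k) <= \sum_(k < n) cmod (F k).
Proof.
elim: n => [|n IH]; first by rewrite !big_ord0 cmod0.
by rewrite !big_ord_recr /= (le_trans (cmodD _ _))// lerD2r.
Qed.

Lemma ReD z w : complex.Re (z + w) = complex.Re z + complex.Re w. Proof. by case: z; case: w. Qed.
Lemma ImD z w : complex.Im (z + w) = complex.Im z + complex.Im w. Proof. by case: z; case: w. Qed.
Lemma ReN z : complex.Re (- z) = - complex.Re z. Proof. by case: z. Qed.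
Lemma ImN z : complex.Im (- z) = - complex.Im z. Proof. by case: z. Qed.
Lemma ReM z w : complex.Re (z * w) = complex.Re z * complex.Re w - complex.Im z * complex.Im w.
Proof. by case: z; case: w. Qed.
Lemma ImM z w : complex.Im (z * w) = complex.Re z * complex.Im w + complex.Im z * complex.Re w.
Proof. by case: z; case: w. Qed.
Lemma ReV z : complex.Re (z^-1) = complex.Re z / cmod z ^+ 2.
Proof. by rewrite cmodE sqr_sqrtr ?addr_ge0 ?sqr_ge0//; case: z. Qed.
Lemma ImV z : complex.Im (z^-1) = - complex.Im z / cmod z ^+ 2.
Proof. by rewrite cmodE sqr_sqrtr ?addr_ge0 ?sqr_ge0//; case: z => a b /=; rewrite mulNr. Qed.

Lemma complexP z w : complex.Re z = complex.Re w -> complex.Im z = complex.Im w -> z = w.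
Proof. by case: z => a b; case: w => c d /= -> ->. Qed.

(** The radii of balls in [C R] are themselves complex numbers; positivity forces their imaginary
    part to be 0, so convergence can be tested with [cmod]. *)
Lemma cvgCP (T : Type) (F : set_system T) {FF : Filter F} (f : T -> C R) (l : C R) :
  f @ F --> l <-> cmod (f t - l) @[t --> F] --> (0 : R).
Proof.
split.
  move=> /cvgrPdist_lt h; apply/cvgrPdist_lt => e e0.
  have /h : 0 < e%:C by rewrite ltcR.
  by apply: filterS => t; rewrite normE ltcR sub0r normrN ger0_norm ?cmod_ge0// cmodBC.
move=> /cvgrPdist_lt h; apply/cvgrPdist_lt => e; rewrite ltcE /= => /andP[/eqP e1 e0].
apply: filterS (h _ e0) => t; rewrite sub0r normrN ger0_norm ?cmod_ge0// => he.
by rewrite normE ltcE /= e1 eqxx/= cmodBC.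
Qed.

Lemma nearC (z0 : C R) (P : C R -> Prop) :
  (\forall z \near z0, P z) <-> exists2 e : R, 0 < e & forall z, cmod (z - z0) < e -> P z.
Proof.
split.
  move=> /nbhs_ballP[e]; rewrite /= ltcE /= => /andP[/eqP e1 e0] h.
  exists (complex.Re e) => // z hz; apply: h.
  by rewrite -ball_normE /= normE ltcE /= e1 eqxx /= cmodBC.
move=> [e e0 h]; apply/nbhs_ballP; exists e%:C => /=; first by rewrite ltcR.
by move=> z; rewrite -ball_normE /= normE ltcR cmodBC => /h.
Qed.

Lemma dnearC (z0 : C R) (P : C R -> Prop) :
  (\forall z \near z0^', P z) <->
  exists2 e : R, 0 < e & forall z, z != z0 -> cmod (z - z0) < e -> P z.
Proof.
have := nearC z0 (fun z => z != z0 -> P z).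
move=> [h1 h2]; split => [/h1[e e0 h]|[e e0 h]]; first by exists e => // z zz0 /h; apply.
by apply: h2; exists e => // z /[swap]; exact: h.
Qed.

End Complex.

Section PowerSeries.
Context {R : realType}.
Implicit Types (a b : nat -> C R) (f g : C R -> C R) (r : R).

Lemma cvgC_squeeze (T : Type) (F : set_system T) {FF : Filter F}
    (f : T -> C R) (l : C R) (g : T -> R) :
  (\forall t \near F, cmod (f t - l) <= g t) -> g @ F --> (0 : R) -> f @ F --> l.
Proof.
move=> fg g0; apply/cvgCP; apply: squeeze_cvgr (cvg_cst 0) g0.
by apply: filterS fg => t ->; rewrite cmod_ge0.
Qed.

Definition psum a (u : C R) n : C R := \sum_(k < n) a k * u ^+ k.

(** Expansion of f at 0, asked only pointwise in the open disc; geometric domination of the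
    coefficients is recovered by [hasps_bound]. *)
Definition hasps r a f := forall u, cmod u < r -> psum a u @ \oo --> f u.

Lemma psumE a u : psum a u = series (fun n => a n * u ^+ n).
Proof. by rewrite seriesEord. Qed.

Lemma hasps_le r r' a f : r' <= r -> hasps r a f -> hasps r' a f.
Proof. by move=> rr h u ur; apply: h; apply: lt_le_trans rr. Qed.

Lemma hasps_ext r a f g : (forall u, cmod u < r -> f u = g u) ->
  hasps r a f -> hasps r a g.
Proof. by move=> fg h u ur; rewrite -fg//; exact: h. Qed.

(** The terms of the series at the point rho tend to 0, hence are bounded. *)
Lemma hasps_bound r a f (rho : R) : hasps r a f -> 0 < rho -> rho < r ->
  exists2 M : R, 0 < M & forall n, cmod (a n) <= M / rho ^+ n.
Proof.
move=> h rho0 rhor.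
have crho : cmod (rho%:C : C R) = rho by rewrite cmod_real gtr0_norm.
have /h : cmod (rho%:C : C R) < r by rewrite crho.
rewrite psumE => /cvgP/cvg_series_cvg_0/cvgCP.
under eq_fun do rewrite subr0 cmodM cmodX crho.
move=> /cvgP/cvg_seq_bounded/pinfty_ex_gt0[M M0 hM].
exists M => // n; rewrite ler_pdivlMr ?exprn_gt0//.
by apply: le_trans (hM n I); rewrite ler_norm.
Qed.

Lemma cvg_expr0 (q : R) : 0 <= q -> q < 1 -> q ^+ n @[n --> \oo] --> (0 : R).
Proof. by move=> q0 q1; apply: cvg_expr; rewrite ger0_norm. Qed.

Lemma geo_sum_le (q : R) n : 0 <= q -> q < 1 -> \sum_(i < n) q ^+ i <= (1 - q)^-1.
Proof.
move=> q0 q1; have q1' : 0 < 1 - q by rewrite subr_gt0.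
rewrite -[leRHS]mul1r ler_pdivlMr// mulrC -opprB mulNr -subrX1 opprB.
by rewrite lerBlDr lerDl exprn_ge0.
Qed.

Lemma psum_tail_le a (M rho : R) u (m n : nat) :
  0 < rho -> 0 <= M -> (forall k, cmod (a k) <= M / rho ^+ k) ->
  cmod u < rho -> (m <= n)%N ->
  cmod (psum a u n - psum a u m)
    <= M * (cmod u / rho) ^+ m / (1 - cmod u / rho).
Proof.
move=> rho0 M0 aM urho mn; set q := cmod u / rho.
have q0 : 0 <= q by rewrite divr_ge0 ?cmod_ge0// ltW.
have q1 : q < 1 by rewrite ltr_pdivrMr// mul1r.
have -> : psum a u n - psum a u m = \sum_(k < n - m) a (m + k)%N * u ^+ (m + k).
  rewrite /psum -(big_mkord xpredT (fun k => a k * u ^+ k)).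
  rewrite -(big_mkord xpredT (fun k => a k * u ^+ k)) (big_cat_nat _ mn)//=.
  rewrite addrAC subrr add0r -{1}[m]add0n big_addn big_mkord.
  by apply: eq_bigr => i _; rewrite addnC.
rewrite (le_trans (cmod_sum _ (fun k => a (m + k)%N * u ^+ (m + k))))//.
rewrite -mulrA; apply: (@le_trans _ _ (M * (q ^+ m * \sum_(k < n - m) q ^+ k))); last first.
  by rewrite !ler_wpM2l ?exprn_ge0// geo_sum_le.
rewrite !mulr_sumr; apply: ler_sum => i _.
rewrite cmodM cmodX -exprD expr_div_n mulrA mulrAC.
by rewrite ler_wpM2r ?exprn_ge0 ?cmod_ge0.
Qed.

(** Limit of [psum_tail_le]; keeping |u| <= rho / 2 replaces the factor 1 / (1 - |u| / rho) by 2. *)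
Lemma hasps_rem r a f (rho M : R) : hasps r a f -> 0 < rho -> 0 <= M -> rho <= r ->
  (forall n, cmod (a n) <= M / rho ^+ n) ->
  forall u n, cmod u <= rho / 2 ->
    cmod (f u - psum a u n) <= 2 * M * (cmod u / rho) ^+ n.
Proof.
move=> h rho0 M0 rhor aM u n u2.
have urho : cmod u < rho by rewrite (le_lt_trans u2)// ltr_pdivrMr// ltr_pMr// ltr1n.
have /h/cvgCP/cvgrPdist_lt hc : cmod u < r by apply: lt_le_trans rhor.
apply/ler_addgt0Pr => e /hc[N _ hN].
pose k := maxn N n.
have /= := hN k (leq_maxl _ _); rewrite sub0r normrN ger0_norm ?cmod_ge0// => hk.
have -> : f u - psum a u n = (psum a u k - psum a u n) - (psum a u k - f u) by ring.
rewrite (le_trans (cmodB _ _))// lerD ?(ltW hk)//.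
rewrite (le_trans (psum_tail_le rho0 M0 aM urho (leq_maxr _ _)))//.
set q := cmod u / rho.
have q0 : 0 <= q by rewrite divr_ge0 ?cmod_ge0// ltW.
have q2 : q <= 2^-1 by rewrite ler_pdivrMr// mulrC.
have -> : 2 * M * q ^+ n = M * q ^+ n * 2 by ring.
rewrite ler_wpM2l ?mulr_ge0 ?exprn_ge0//.
rewrite invf_ple ?posrE//; first by lra.
by rewrite subr_gt0 (le_lt_trans q2)// invf_lt1 ?ltr1n.
Qed.

Lemma hasps_cvg0 r a f : 0 < r -> hasps r a f -> f u @[u --> (0 : C R)] --> a 0.
Proof.
move=> r0 h; have r20 : 0 < r / 2 by rewrite divr_gt0.
have r2r : r / 2 < r by rewrite ltr_pdivrMr// ltr_pMr// ltr1n.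
have [M M0 aM] := hasps_bound h r20 r2r.
have hr := hasps_rem h r20 (ltW M0) (ltW r2r) aM.
have K0 : 0 < 2 * M / (r / 2) by rewrite divr_gt0// mulr_gt0.
have FN := @nbhs_filter (C R) 0.
apply/(@cvgCP _ _ _ FN); apply/cvgrPdist_lt => e e0; apply/nearC.
exists (Num.min (r / 2 / 2) (e / (2 * M / (r / 2)))).
  by rewrite lt_min (divr_gt0 e0 K0) divr_gt0.
move=> u; rewrite subr0 lt_min => /andP[u1 u2].
rewrite sub0r normrN ger0_norm ?cmod_ge0//.
have := hr u 1%N (ltW u1); rewrite /psum big_ord1 expr0 mulr1 expr1 => hu.
apply: le_lt_trans hu _.
by move: u2; rewrite ltr_pdivlMr// mulrC mulrA mulrAC.
Qed.

(** Once the coefficients below n vanish, the remainder estimate of order n + 1 at a zero u gives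
    |a_n| <= K |u|, with u as small as wanted. *)
Lemma hasps_coef0 r a f : 0 < r -> hasps r a f ->
  (forall e : R, 0 < e -> exists u, [/\ u != 0, cmod u < e & f u = 0]) ->
  forall n, a n = 0.
Proof.
move=> r0 h hz; have r20 : 0 < r / 2 by rewrite divr_gt0.
have r2r : r / 2 < r by rewrite ltr_pdivrMr// ltr_pMr// ltr1n.
have [M M0 aM] := hasps_bound h r20 r2r.
have hr := hasps_rem h r20 (ltW M0) (ltW r2r) aM.
move=> n; have [m] := ubnP n; elim: m n => // m IH n; rewrite ltnS => nm.
apply/eqP; rewrite -cmod_eq0 eq_le cmod_ge0 andbT.
apply/ler_addgt0Pr => e e0; rewrite add0r.
pose K := 2 * M / (r / 2) ^+ n.+1.
have K0 : 0 < K by rewrite divr_gt0 ?mulr_gt0// exprn_gt0.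
have [u [u0 ue fu]] := hz (Num.min (r / 2 / 2) (e / K)) ltac:(by rewrite lt_min (divr_gt0 e0 K0) divr_gt0).
move: ue; rewrite lt_min => /andP[u1 u2].
have u0' : 0 < cmod u by rewrite cmod_gt0.
have := hr u n.+1 (ltW u1); rewrite /psum big_ord_recr /= big1 ?add0r; last first.
  by move=> i _; rewrite IH ?mul0r// (leq_trans (ltn_ord i)).
rewrite fu sub0r cmodN cmodM cmodX expr_div_n exprS mulrCA mulrAC -mulrA -/K.
rewrite mulrA ler_pM2r ?exprn_gt0// => /le_trans; apply.
by rewrite -ler_pdivlMr// ltW.
Qed.

Lemma hasps_identity r a f : 0 < r -> hasps r a f ->
  (forall e : R, 0 < e -> exists u, [/\ u != 0, cmod u < e & f u = 0]) ->
  forall u, cmod u < r -> f u = 0.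
Proof.
move=> r0 h hz u ur; have a0 := hasps_coef0 r0 h hz.
have -> : f u = lim (psum a u @ \oo) by apply/esym/cvg_lim => //; exact: h.
rewrite (_ : psum a u = cst 0) ?lim_cst//.
by apply/funext => n; rewrite /psum big1// => i _; rewrite a0 mul0r.
Qed.

End PowerSeries.

Section PSAlgebra.
Context {R : realType}.
Implicit Types (a b : nat -> C R) (f g : C R -> C R) (r : R).

Lemma hasps_cst r (c : C R) : hasps r (fun n => if n is 0 then c else 0) (fun=> c).
Proof.
move=> u ur; apply: (cvgC_squeeze _ (cvg_cst 0)).
exists 1%N => // n /= n1; rewrite /psum; case: n n1 => // n _.
rewrite big_ord_recl /= big1 ?addr0 ?expr0 ?mulr1 ?subrr ?cmod0// => i _.
by rewrite mul0r.
Qed.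

Lemma hasps_id r : hasps r (fun n => (n == 1)%:R) id.
Proof.
move=> u ur; apply: (cvgC_squeeze _ (cvg_cst 0)).
exists 2%N => // n /= n1; rewrite /psum; case: n n1 => [|[|n]]// _.
rewrite !big_ord_recl /= big1 ?addr0 ?mul0r ?mul1r ?add0r ?expr1 ?subrr ?cmod0// => i _.
by rewrite mul0r.
Qed.

Lemma hasps_add r a b f g : hasps r a f -> hasps r b g ->
  hasps r (fun n => a n + b n) (fun u => f u + g u).
Proof.
move=> h1 h2 u ur; rewrite (_ : psum _ _ = psum a u \+ psum b u).
  by apply: cvgD; [exact: h1|exact: h2].
by apply/funext => n; rewrite /psum /= -big_split; apply: eq_bigr => i _; rewrite mulrDl.
Qed.

Lemma hasps_opp r a f : hasps r a f -> hasps r (fun n => - a n) (fun u => - f u).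
Proof.
move=> h u ur; rewrite (_ : psum _ _ = -%R \o psum a u).
  by apply: cvgN; exact: h.
by apply/funext => n; rewrite /psum /= -sumrN; apply: eq_bigr => i _; rewrite mulNr.
Qed.

Lemma hasps_shift r a f : hasps r a f ->
  hasps r (fun n => if n is m.+1 then a m else 0) (fun u => u * f u).
Proof.
move=> h u ur; rewrite -(@cvg_shiftS (C R)).
rewrite (_ : [sequence _]_n = cst u \* psum a u).
  by apply: cvgM; [exact: cvg_cst|exact: h].
apply/funext => n; rewrite /psum /= big_ord_recl mul0r add0r mulr_sumr.
by apply: eq_bigr => i _; rewrite /= /bump /= add1n exprS mulrCA.
Qed.

Lemma hasps_unshift r a f : 0 < r -> a 0%N = 0 -> hasps r a f ->
  hasps r (fun n => a n.+1) (fun u => if u == 0 then a 1%N else f u / u).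
Proof.
move=> r0 a0 h u ur; case: eqP => [->|/eqP u0].
  apply: (cvgC_squeeze _ (cvg_cst 0)).
  exists 1%N => // n /= n1; rewrite /psum; case: n n1 => // n _.
  rewrite big_ord_recl /= big1 ?addr0 ?expr0 ?mulr1 ?subrr ?cmod0// => i _.
  by rewrite expr0n mulr0.
have := h _ ur; rewrite -(@cvg_shiftS (C R)) => hu.
rewrite (_ : psum _ _ = [sequence psum a u n.+1]_n \* cst u^-1).
  by apply: cvgM; [exact: hu|exact: cvg_cst].
apply/funext => n; rewrite /psum /= big_ord_recl a0 mul0r add0r mulr_suml.
by apply: eq_bigr => i _; rewrite /= /bump /= add1n exprSr -!mulrA mulfV ?mulr1.
Qed.

Definition cauchy a b n : C R := \sum_(i < n.+1) a i * b (n - i)%N.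

Lemma sum_cauchy a b (u : C R) n :
  psum (cauchy a b) u n = \sum_(i < n) a i * u ^+ i * psum b u (n - i).
Proof.
rewrite /psum /cauchy; elim: n => [|n IH]; first by rewrite !big_ord0.
rewrite big_ord_recr /= IH [RHS]big_ord_recr /= subSnn big_ord1 expr0 mulr1.
rewrite mulr_suml big_ord_recr /= subnn addrA; congr (_ + _); last by rewrite mulrAC.
rewrite -big_split; apply: eq_bigr => i _ /=.
rewrite subSn; last exact: ltnW.
rewrite big_ord_recr /= mulrDr; congr (_ + _).
have -> : u ^+ n = u ^+ (n - i) * u ^+ i by rewrite -exprD subnK// ltnW.
by rewrite [u ^+ (n - i) * _]mulrC mulrACA.
Qed.

Lemma cauchy_cvg a b (M N rho : R) (u : C R) : 0 < rho -> 0 <= M -> 0 <= N ->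
  (forall n, cmod (a n) <= M / rho ^+ n) -> (forall n, cmod (b n) <= N / rho ^+ n) ->
  cmod u < rho ->
  cmod (psum a u n * psum b u n - psum (cauchy a b) u n) @[n --> \oo] --> (0 : R).
Proof.
move=> rho0 M0 N0 aM bN urho.
(* Each of the n error terms is of order q^n. With q = s^2, one factor s^n is spent on making the
   sum over i geometric and the other still tends to 0. *)
pose q := cmod u / rho; pose s := Num.sqrt q.
have q0 : 0 <= q by rewrite divr_ge0 ?cmod_ge0// ltW.
have q1 : q < 1 by rewrite ltr_pdivrMr// mul1r.
have s0 : 0 <= s by rewrite sqrtr_ge0.
have s1 : s < 1 by rewrite -sqrtr1 ltr_sqrt.
have sq n : q ^+ n = s ^+ n * s ^+ n by rewrite -exprMn -expr2 sqr_sqrtr.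
have sn1 n : s ^+ n <= 1 by rewrite exprn_ile1// ltW.
have q1' : 0 < 1 - q by rewrite subr_gt0.
pose K := M * N / (1 - q) / (1 - s).
apply: (@squeeze_cvgr _ _ _ _ (cst 0) (fun n => K * s ^+ n)); last 2 first.
- exact: cvg_cst.
- by rewrite -[X in _ --> X](mulr0 K); apply: cvgMl_tmp; exact: cvg_expr0.
near=> n; rewrite cmod_ge0 /= sum_cauchy {1}/psum mulr_suml -sumrB.
rewrite (le_trans (cmod_sum _ (fun i => a i * u ^+ i * psum b u n - a i * u ^+ i * psum b u (n - i))))//.
apply: (@le_trans _ _ (\sum_(i < n) M * N / (1 - q) * s ^+ n * s ^+ i)); last first.
  rewrite -mulr_sumr /K -[leRHS]mulrA [_^-1 * s ^+ n]mulrC mulrA ler_wpM2l ?geo_sum_le//.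
  by rewrite !mulr_ge0 ?exprn_ge0// invr_ge0 ltW.
apply: ler_sum => i _; rewrite -mulrBr cmodM.
have h1 : cmod (a i * u ^+ i) <= M * q ^+ i.
  by rewrite cmodM cmodX expr_div_n mulrA mulrAC ler_wpM2r ?exprn_ge0 ?cmod_ge0.
have h2 := psum_tail_le rho0 N0 bN urho (leq_subr i n).
apply: (le_trans (ler_pM _ _ h1 h2)); rewrite ?cmod_ge0//.
rewrite -/q !sq.
have -> : M * (s ^+ i * s ^+ i) * (N * (s ^+ (n - i) * s ^+ (n - i)) / (1 - q)) =
   M * N / (1 - q) * (s ^+ (n - i) * s ^+ i) * s ^+ i * s ^+ (n - i) by ring.
rewrite -exprD subnK; last exact: ltnW.
by rewrite ler_piMr// !mulr_ge0 ?exprn_ge0// invr_ge0 ltW.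
Unshelve. all: by end_near. Qed.

Lemma hasps_mul r a b f g : hasps r a f -> hasps r b g ->
  hasps r (cauchy a b) (fun u => f u * g u).
Proof.
move=> ha hb u ur; pose rho := (cmod u + r) / 2.
have [u0 r0] : 0 <= cmod u /\ 0 < r by rewrite cmod_ge0 (le_lt_trans _ ur)// cmod_ge0.
have rho0 : 0 < rho by rewrite /rho; lra.
have rhor : rho < r by rewrite /rho; lra.
have urho : cmod u < rho by rewrite /rho; lra.
have [M M0 aM] := hasps_bound ha rho0 rhor.
have [N N0 bN] := hasps_bound hb rho0 rhor.
have c0 := cauchy_cvg rho0 (ltW M0) (ltW N0) aM bN urho.
have h1 : psum a u n * psum b u n @[n --> \oo] --> f u * g u.
  by apply: cvgM; [exact: ha|exact: hb].
have h2 : (psum a u n * psum b u n - psum (cauchy a b) u n : C R) @[n --> \oo] --> (0 : C R).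
  by apply/cvgCP; under eq_fun do rewrite subr0.
rewrite -[X in _ --> X]subr0.
rewrite (_ : psum _ _ = (fun n => psum a u n * psum b u n -
  (psum a u n * psum b u n - psum (cauchy a b) u n) : C R)).
  exact: (@cvgB _ _ _ _ _ _ _ _ _ h1 h2).
by apply/funext => n /=; ring.
Qed.

(** Each coefficient of the reciprocal series depends on all the previous ones, so the recursion
    builds the list of the first n. *)
Fixpoint inv_coefs a (n : nat) : seq (C R) :=
  if n is m.+1 then
    let s := inv_coefs a m in
    rcons s (if m is 0 then (a 0%N)^-1
             else - (a 0%N)^-1 * \sum_(i < m) nth 0 s i * a (m - i)%N)
  else [::].

Definition inv_coef a n := nth 0 (inv_coefs a n.+1) n.

Lemma size_inv_coefs a n : size (inv_coefs a n) = n.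
Proof. by elim: n => //= n IH; rewrite size_rcons IH. Qed.

Lemma nth_inv_coefs a n i : (i < n)%N -> nth 0 (inv_coefs a n) i = inv_coef a i.
Proof.
rewrite /inv_coef; elim: n => // n IH; rewrite ltnS leq_eqVlt => /orP[/eqP->//|lin].
by rewrite [in LHS]/= nth_rcons size_inv_coefs lin IH.
Qed.

Lemma inv_coef0 a : inv_coef a 0 = (a 0%N)^-1. Proof. by []. Qed.

Lemma inv_coefS a n :
  inv_coef a n.+1 = - (a 0%N)^-1 * \sum_(i < n.+1) inv_coef a i * a (n.+1 - i)%N.
Proof.
rewrite {1}/inv_coef [inv_coefs a n.+2]/= -/(inv_coefs a n.+1).
rewrite nth_rcons size_inv_coefs ltnn eqxx.
by congr (_ * _); apply: eq_bigr => i _; rewrite (@nth_inv_coefs a n.+1).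
Qed.

Lemma cauchy_inv_coef a n : a 0%N != 0 -> cauchy (inv_coef a) a n = (n == 0%N)%:R.
Proof.
move=> a0; case: n => [|n]; first by rewrite /cauchy big_ord1 inv_coef0 mulVf.
rewrite /cauchy big_ord_recr /= subnn inv_coefS mulrAC mulNr mulVf// mulN1r.
by rewrite subrr.
Qed.

(** The induction closes because 1 + 2 + ... + 2^n <= 2^(n+1). *)
Lemma inv_coef_le a (A : R) : 0 <= A -> a 0%N != 0 ->
  (forall n, cmod (a n.+1 / a 0%N) <= A ^+ n.+1) ->
  forall n, cmod (inv_coef a n * a 0%N) <= (2 * A) ^+ n.
Proof.
move=> A0 a0 aA n; have [m] := ubnP n; elim: m n => // m IH [|n] nm.
  by rewrite inv_coef0 mulVf// expr0 cmod1.
rewrite inv_coefS !mulNr cmodN mulrAC mulVf// mul1r.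
rewrite (le_trans (cmod_sum _ (fun i => inv_coef a i * a (n.+1 - i)%N)))//.
apply: (@le_trans _ _ (\sum_(i < n.+1) 2 ^+ i * A ^+ n.+1)).
  apply: ler_sum => i _; have lin := ltn_ord i.
  have -> : inv_coef a i * a (n.+1 - i)%N = inv_coef a i * a 0%N * (a (n.+1 - i)%N / a 0%N).
    by rewrite mulrACA mulfV// mulr1.
  rewrite cmodM; have := IH i (leq_trans lin nm).
  have := aA (n - i)%N; rewrite -subSn// => h1 h2.
  apply: (le_trans (ler_pM _ _ h2 h1)); rewrite ?cmod_ge0//.
  by rewrite exprMn -mulrA -exprD subnKC// ltnW.
rewrite -mulr_suml exprMn ler_wpM2r ?exprn_ge0//.
have := subrX1 (2 : R) n.+1; rewrite (_ : 2 - 1 = 1 :> R); last by ring.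
by rewrite mul1r => <-; rewrite gerBl.
Qed.

(** The Cauchy product of the two coefficient sequences is 1, so f u times the partial sums of the
    reciprocal series tends to 1. This shows that f u is nonzero and identifies the limit of these
    sums. *)
Lemma hasps_inv r a f : 0 < r -> a 0%N != 0 -> hasps r a f ->
  exists2 r' : R, 0 < r' & exists b, hasps r' b (fun u => (f u)^-1).
Proof.
move=> r0 a0 ha.
have r20 : 0 < r / 2 by lra.
have r2r : r / 2 < r by lra.
have [M M0 aM] := hasps_bound ha r20 r2r.
have ca0 : 0 < cmod (a 0%N) by rewrite cmod_gt0.
(* K >= 1 gives K <= K^(n+1), so the constant M / |a 0| is absorbed into the geometric ratio. *)
pose K := Num.max 1 (M / cmod (a 0%N)).
have K1 : 1 <= K by rewrite /K le_max lexx.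
pose A := K / (r / 2).
have A0 : 0 < A by rewrite divr_gt0// (lt_le_trans ltr01).
have aA n : cmod (a n.+1 / a 0%N) <= A ^+ n.+1.
  rewrite cmodM cmodV /A expr_div_n ler_pdivrMr//.
  apply: (le_trans (aM _)).
  rewrite -mulrA [_^-1 * _]mulrC mulrA ler_wpM2r ?invr_ge0 ?exprn_ge0 ?(ltW r20)//.
  rewrite -ler_pdivrMr// (@le_trans _ _ K)//; first by rewrite /K le_max lexx orbT.
  by rewrite exprS ler_peMr ?exprn_ege1// (le_trans ler01).
have bA := inv_coef_le (ltW A0) a0 aA.
pose rho := Num.min (r / 2) (2 * A)^-1.
have rho0 : 0 < rho by rewrite lt_min r20 invr_gt0 mulr_gt0.
have rhor : rho <= r / 2 by rewrite ge_min lexx.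
have rhoA : rho <= (2 * A)^-1 by rewrite ge_min lexx orbT.
exists (rho / 2); first by lra.
exists (inv_coef a) => u ur.
have urho : cmod u < rho by lra.
have aM' n : cmod (a n) <= M / rho ^+ n.
  apply: (le_trans (aM n)); rewrite ler_pM2l// lef_pV2 ?posrE ?exprn_gt0//.
  by rewrite lerXn2r ?nnegrE ?(ltW rho0) ?(ltW r20).
pose N := (cmod (a 0%N))^-1.
have N0 : 0 < N by rewrite invr_gt0.
have bN n : cmod (inv_coef a n) <= N / rho ^+ n.
  rewrite mulrC ler_pdivlMr//; apply: (@le_trans _ _ ((2 * A) ^+ n)).
    by rewrite -cmodM; exact: bA.
  have A20 : 0 < 2 * A by rewrite mulr_gt0.
  rewrite -exprVn lerXn2r ?nnegrE ?invr_ge0 ?(ltW rho0) ?(ltW A20)//.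
  by rewrite -[leLHS]invrK lef_pV2 ?posrE ?invr_gt0.
have c0 := cauchy_cvg rho0 (ltW N0) (ltW M0) bN aM' urho.
have /cvgCP fu : psum a u @ \oo --> f u.
  by apply: ha; rewrite (lt_le_trans urho)// (le_trans rhor)// ltW.
pose q := cmod u / rho.
have h1 : (f u * psum (inv_coef a) u n : C R) @[n --> \oo] --> (1 : C R).
  pose e n := cmod (psum a u n - f u) * (N / (1 - q)) +
    cmod (psum (inv_coef a) u n * psum a u n - psum (cauchy (inv_coef a) a) u n).
  apply: (@cvgC_squeeze _ _ _ _ _ _ e).
    exists 1%N => // n /= n1; rewrite {}/e.
    have c1 : psum (cauchy (inv_coef a) a) u n = 1.
      case: n n1 => // n _; rewrite /psum big_ord_recl /= cauchy_inv_coef// mulr1.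
      by rewrite big1 ?addr0// => i _; rewrite cauchy_inv_coef// mul0r.
    set B := psum (inv_coef a) u n; rewrite c1.
    have -> : f u * B - 1 = - ((psum a u n - f u) * B) + (B * psum a u n - 1) by ring.
    rewrite (le_trans (cmodD _ _))// lerD2r cmodN cmodM ler_wpM2l ?cmod_ge0//.
    have := psum_tail_le rho0 (ltW N0) bN urho (leq0n n).
    by rewrite {2}/psum big_ord0 subr0 expr0 mulr1.
  rewrite -[X in _ --> X](addr0 0); apply: cvgD => //.
  by rewrite -[X in _ --> X](mul0r (N / (1 - q))); apply: cvgMl.
have fu0 : f u != 0.
  apply/eqP => fu0; have : (1 : C R) = 0; last by move/eqP; rewrite oner_eq0.
  apply: (@cvg_unique _ (@norm_hausdorff _ (C R)) _ _ _ _ h1).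
  by rewrite /= fu0; under eq_fun do rewrite mul0r; exact: cvg_cst.
rewrite -[X in _ --> X]mulr1 (_ : psum (inv_coef a) u =
  (fun n => (f u)^-1 * (f u * psum (inv_coef a) u n) : C R)).
  by apply: cvgM h1; exact: cvg_cst.
by apply/funext => n; rewrite mulrA mulVf// mul1r.
Qed.

End PSAlgebra.

(** * Cauchy transform of a measure with bounded support *)

Section Support.
Context {R : realType}.

Lemma measurable_invr : measurable_fun [set: R] (fun x : R => x^-1).
Proof.
rewrite -(setvU [set 0 : R]) setUC; apply/measurable_funU => //.
  exact: measurableC.
split; first exact: measurable_fun_set1.
apply: open_continuous_measurable_fun.
  by apply: closed_openC; exact: closed_eq.
by move=> x; rewrite inE /= => /eqP x0; exact: inv_continuous.
Qed.

(** The left-hand side is one term of the exponential series of n. *)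
Lemma expn_fact_le n : (n ^ n)%N%:R / n`!%:R <= expR n%:R :> R.
Proof.
case: n => [|n]; first by rewrite expR0 fact0 expn0 divr1.
rewrite natrX (le_trans _ (expR_ge1Dxn n _))// lerDr//.
Qed.

Variable mu : probability (measurableTypeR R) R.
Hypothesis mu_moments : has_moments mu (fun k => (k ^ k)%N%:R / (k.+1)`!%N%:R).

(** Markov's inequality for the moment of even order 2k, which is at most e^(2k). *)
Lemma measure_tail_le (L : R) k : 0 < L ->
  (mu [set x : R | (L < `|x|)%R] <= ((expR 1 / L) ^+ k.*2)%:E)%E.
Proof.
move=> L0; set A := [set x : R | (L < `|x|)%R].
have mA : measurable (A : set (measurableTypeR R)).
  have -> : A = (@Num.norm _ R @^-1` `]L, +oo[%classic).
    by apply/seteqP; split => x /=; rewrite in_itv/= andbT.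
  by rewrite -[X in measurable X]setTI; apply: normr_measurable => //; exact: measurable_itv.
have [_ hk] := mu_moments k.*2.
have Lk0 : 0 < L ^+ k.*2 by rewrite exprn_gt0.
have ev x : 0 <= x ^+ k.*2 :> R by rewrite -mul2n exprM exprn_ge0 ?sqr_ge0.
have mX : measurable_fun [set: measurableTypeR R] (fun x : measurableTypeR R => ((x : R) ^+ k.*2)%:E).
  by apply/measurable_EFinP; exact: measurable_funX.
have h : ((L ^+ k.*2)%:E * mu A <= ((expR 1) ^+ k.*2)%:E)%E.
  rewrite -integral_cst//.
  apply: (@le_trans _ _ (\int[mu]_(x in A) ((x : R) ^+ k.*2)%:E)%E).
    apply: ge0_le_integral => //.
    - by move=> x _; rewrite lee_fin ltW.
    - exact: measurable_funTS.
    - move=> x /= Ax; rewrite lee_fin.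
      by rewrite -mul2n !exprM lerXn2r ?nnegrE ?sqr_ge0//
        -[x ^+ 2]real_normK ?num_real// lerXn2r ?nnegrE ?(ltW L0)// ltW.
  apply: (@le_trans _ _ (\int[mu]_x ((x : R) ^+ k.*2)%:E)%E).
    by apply: ge0_subset_integral => // x _; rewrite lee_fin.
  rewrite hk lee_fin; apply: (@le_trans _ _ ((k.*2 ^ k.*2)%N%:R / (k.*2)`!%N%:R)).
    rewrite ler_wpM2l// lef_pV2 ?posrE ?ltr0n ?fact_gt0// ler_nat.
    by rewrite factS leq_pmull.
  by rewrite (le_trans (expn_fact_le _))// -expRM_natl mulr1.
rewrite expr_div_n EFinM -[leLHS]mul1e.
have -> : (1 = (L ^+ k.*2)^-1%:E * (L ^+ k.*2)%:E)%E by rewrite -EFinM mulVf// gt_eqF.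
by rewrite -muleA [leRHS]muleC lee_wpmul2l// lee_fin invr_ge0 ltW.
Qed.

Lemma measure_tail0 (L : R) : expR 1 < L -> mu [set x : R | (L < `|x|)%R] = 0%E.
Proof.
move=> eL; have L0 : 0 < L by apply: lt_trans eL; exact: expR_gt0.
have q0 : 0 <= expR 1 / L by rewrite divr_ge0 ?expR_ge0 ?ltW.
have q1 : expR 1 / L < 1 by rewrite ltr_pdivrMr// mul1r.
apply/eqP; rewrite eq_le measure_ge0 andbT.
apply/lee_addgt0Pr => e e0; rewrite add0e.
have /cvgrPdist_lt/(_ _ e0)[N _ hN] := @cvg_expr0 R _ q0 q1.
have := hN N.*2; rewrite /= -{1}addnn leq_addr => /(_ isT).
rewrite sub0r normrN ger0_norm ?exprn_ge0// => h.
by rewrite (le_trans (measure_tail_le N L0))// lee_fin ltW.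
Qed.

End Support.

Section ComplexIntegral.
Context {R : realType}.
Variables (mu : probability (measurableTypeR R) R) (L : R).
Hypothesis mu_supp : mu [set x : R | (L < `|x|)%R] = 0%E.
Implicit Types (f g : R -> C R).

Let D : set (measurableTypeR R) := [set x : R | (`|x| <= L)%R].

Lemma measurable_supp : measurable D.
Proof.
have -> : D = `[- L, L]%classic by apply/seteqP; split => x /=; rewrite in_itv/= -ler_norml.
exact: measurable_itv.
Qed.
Let mD := measurable_supp.

(** Measurability on the whole line lets integrals be restricted to [-L, L]; boundedness is asked
    only there, because the resolvent at a real point beyond L is unbounded on the line. *)
Definition mbounded f :=
  [/\ measurable_fun [set: R] (fun x => complex.Re (f x)),
      measurable_fun [set: R] (fun x => complex.Im (f x)) &
      exists2 M : R, 0 < M & forall x, `|x| <= L -> cmod (f x) <= M].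

Definition cint f : C R :=
  (\int[mu]_(x in D) complex.Re (f x)) +i* (\int[mu]_(x in D) complex.Im (f x)).

Lemma mbounded_cst (c : C R) : mbounded (fun=> c).
Proof.
split; [exact: measurable_cst|exact: measurable_cst|].
exists (cmod c + 1); first by rewrite ltr_wpDl// cmod_ge0.
by move=> x _; rewrite lerDl.
Qed.

Lemma mbounded_id : mbounded (fun x => x%:C).
Proof.
split => /=; [exact: measurable_id|exact: measurable_cst|].
exists (`|L| + 1); first by rewrite ltr_wpDl.
by move=> x xL; rewrite cmod_real (le_trans xL)// (le_trans (ler_norm _))// lerDl.
Qed.

Lemma mboundedD f g : mbounded f -> mbounded g -> mbounded (fun x => f x + g x).
Proof.
move=> [f1 f2 [M M0 fM]] [g1 g2 [N N0 gN]]; split.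
- by under eq_fun do rewrite ReD; exact: measurable_funD.
- by under eq_fun do rewrite ImD; exact: measurable_funD.
- exists (M + N) => [|x xL]; first exact: addr_gt0.
  by rewrite (le_trans (cmodD _ _))// lerD ?fM ?gN.
Qed.

Lemma mboundedM f g : mbounded f -> mbounded g -> mbounded (fun x => f x * g x).
Proof.
move=> [f1 f2 [M M0 fM]] [g1 g2 [N N0 gN]]; split.
- by under eq_fun do rewrite ReM; apply: measurable_funB; exact: measurable_funM.
- by under eq_fun do rewrite ImM; apply: measurable_funD; exact: measurable_funM.
- exists (M * N) => [|x xL]; first exact: mulr_gt0.
  by rewrite cmodM ler_pM ?cmod_ge0 ?fM ?gN.
Qed.

Lemma mboundedN f : mbounded f -> mbounded (fun x => - f x).
Proof.
move=> hf; have -> : (fun x => - f x) = (fun x => (-1) * f x).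
  by apply/funext => x; rewrite mulN1r.
by apply: mboundedM => //; exact: mbounded_cst.
Qed.

Lemma mboundedX f n : mbounded f -> mbounded (fun x => f x ^+ n).
Proof.
move=> hf; elim: n => [|n IH]; first exact: mbounded_cst.
by under eq_fun do rewrite exprS; exact: mboundedM.
Qed.

Lemma mbounded_sum n (F : nat -> R -> C R) : (forall i, mbounded (F i)) ->
  mbounded (fun x => \sum_(i < n) F i x).
Proof.
move=> hF; elim: n => [|n IH].
  by under eq_fun do rewrite big_ord0; exact: mbounded_cst.
by under eq_fun do rewrite big_ord_recr /=; exact: mboundedD.
Qed.

Lemma mboundedV f (d : R) : 0 < d -> mbounded f ->
  (forall x, `|x| <= L -> d <= cmod (f x)) -> mbounded (fun x => (f x)^-1).
Proof.
move=> d0 [f1 f2 _] fd.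
have m1 : measurable_fun [set: R] (fun x => (cmod (f x) ^+ 2)^-1).
  apply: (measurableT_comp measurable_invr).
  under eq_fun do rewrite cmodE sqr_sqrtr ?addr_ge0 ?sqr_ge0//.
  by apply: measurable_funD; exact: measurable_funX.
split.
- by under eq_fun do rewrite ReV; exact: measurable_funM.
- under eq_fun do rewrite ImV mulNr.
  by apply: measurableT_comp => //; exact: measurable_funM.
- exists d^-1 => [|x xL]; first by rewrite invr_gt0.
  have dx := fd x xL.
  by rewrite cmodV lef_pV2 ?posrE// (lt_le_trans d0).
Qed.

Lemma integrable_bounded (g : R -> R) (M : R) : measurable_fun [set: R] g ->
  (forall x, `|x| <= L -> `|g x| <= M) -> mu.-integrable D (EFin \o g).
Proof.
move=> mg gM; apply: measurable_bounded_integrable => //.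
- by rewrite (le_lt_trans (probability_le1 _ _))// ltry.
- exact: measurable_funTS.
- exists M; split; first exact: num_real.
  by move=> N MN x /= xL; rewrite (le_trans (gM x xL))// ltW.
Qed.

Lemma integrable_Re f : mbounded f -> mu.-integrable D (EFin \o (fun x => complex.Re (f x))).
Proof.
move=> [f1 _ [M M0 fM]]; apply: (@integrable_bounded _ M) => // x xL.
by rewrite (le_trans (normRe_le _))// fM.
Qed.

Lemma integrable_Im f : mbounded f -> mu.-integrable D (EFin \o (fun x => complex.Im (f x))).
Proof.
move=> [_ f1 [M M0 fM]]; apply: (@integrable_bounded _ M) => // x xL.
by rewrite (le_trans (normIm_le _))// fM.
Qed.

Lemma eq_cint f g : (forall x, `|x| <= L -> f x = g x) -> cint f = cint g.
Proof.
by move=> fg; rewrite /cint; congr (_ +i* _); apply: eq_Rintegral => x;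
  rewrite inE => /fg ->.
Qed.

Lemma cintD f g : mbounded f -> mbounded g ->
  cint (fun x => f x + g x) = cint f + cint g.
Proof.
move=> hf hg; apply: complexP; rewrite ?ReD ?ImD /=.
- under eq_Rintegral do rewrite ReD.
  by apply: RintegralD => //; exact: integrable_Re.
- under eq_Rintegral do rewrite ImD.
  by apply: RintegralD => //; exact: integrable_Im.
Qed.

Lemma cintZ (c : C R) f : mbounded f -> cint (fun x => c * f x) = c * cint f.
Proof.
move=> hf; have [hr hi] := (integrable_Re hf, integrable_Im hf).
have hZ (a : R) (g : R -> R) : mu.-integrable D (EFin \o g) ->
  mu.-integrable D (EFin \o (fun x => a * g x)).
  by move=> ?; under [X in _.-integrable _ X]eq_fun do rewrite /= EFinM; exact: integrableZl.
apply: complexP; rewrite ?ReM ?ImM /=.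
- under eq_Rintegral do rewrite ReM.
  by rewrite RintegralB ?RintegralZl//; exact: hZ.
- under eq_Rintegral do rewrite ImM.
  by rewrite RintegralD ?RintegralZl//; exact: hZ.
Qed.

Lemma cintN f : mbounded f -> cint (fun x => - f x) = - cint f.
Proof.
move=> hf; rewrite -[RHS]mulN1r -cintZ//.
by apply: eq_cint => x _; rewrite mulN1r.
Qed.

Lemma cintB f g : mbounded f -> mbounded g ->
  cint (fun x => f x - g x) = cint f - cint g.
Proof. by move=> hf hg; rewrite cintD ?cintN//; exact: mboundedN. Qed.

Lemma cint_sum n (F : nat -> R -> C R) : (forall i, mbounded (F i)) ->
  cint (fun x => \sum_(i < n) F i x) = \sum_(i < n) cint (F i).
Proof.
move=> hF; elim: n => [|n IH].
  rewrite big_ord0 -[RHS](mul0r (cint (fun=> 0))) -cintZ; last exact: mbounded_cst.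
  by apply: eq_cint => x _; rewrite big_ord0 mul0r.
rewrite big_ord_recr /= -IH -cintD//; last exact: mbounded_sum.
by apply: eq_cint => x _; rewrite big_ord_recr.
Qed.

Lemma Rintegral_le (g : R -> R) (M : R) : 0 <= M -> measurable_fun [set: R] g ->
  (forall x, `|x| <= L -> `|g x| <= M) -> `|\int[mu]_(x in D) g x| <= M.
Proof.
move=> M0 mg gM; apply: (le_trans (le_normr_Rintegral _ (integrable_bounded mg gM))) => //.
apply: (@le_trans _ _ (\int[mu]_(x in D) M)).
  apply: le_Rintegral => //.
  - by apply: (@integrable_bounded _ M) => [|x xL]; [exact: measurableT_comp|rewrite normr_id gM].
  - by apply: (@integrable_bounded _ M) => [|x xL]; [exact: measurable_cst|rewrite ger0_norm].
rewrite Rintegral_cst// ler_piMr//.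
by rewrite -lee_fin fineK ?fin_num_measure// probability_le1.
Qed.

(** The factor 2 is the price of bounding the real and imaginary parts separately. *)
Lemma cint_le f (M : R) : 0 <= M -> mbounded f ->
  (forall x, `|x| <= L -> cmod (f x) <= M) -> cmod (cint f) <= 2 * M.
Proof.
move=> M0 [f1 f2 _] fM; rewrite (le_trans (cmod_le_ReIm _))// mulr2n mulrDl mul1r.
rewrite lerD// Rintegral_le// => x xL.
  by rewrite (le_trans (normRe_le _))// fM.
by rewrite (le_trans (normIm_le _))// fM.
Qed.

Lemma Rintegral_supp (g : R -> R) : measurable_fun [set: R] g ->
  \int[mu]_x g x = \int[mu]_(x in D) g x.
Proof.
move=> mg; rewrite [RHS]Rintegral_mkcond; congr fine.
apply: ae_eq_integral => //.
- exact/measurable_EFinP.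
- apply/measurable_EFinP; apply/(measurable_restrictT _ _).1 => //.
  exact: measurable_funTS.
exists [set x : R | (L < `|x|)%R]; split => //.
  rewrite (_ : [set x | _] = ~` D); first exact: measurableC.
  by apply/seteqP; split => x /=; rewrite ltNge => /negP.
move=> x /= h; rewrite ltNge; apply/negP => xL; apply: h => _.
by rewrite /= patchE mem_set.
Qed.

Lemma cint_cst (c : C R) : cint (fun=> c) = c.
Proof.
have muD : mu D = 1%E.
  have := probability_setC mu mD; rewrite (_ : ~` D = [set x : R | (L < `|x|)%R]).
    rewrite mu_supp => /eqP; rewrite eq_sym sube_eq// ?fin_num_measure//.
    by rewrite add0e eq_sym => /eqP.
  by apply/seteqP; split => x /=; rewrite ltNge => /negP.
have muD1 : fine (mu D) = 1 := congr1 fine muD.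
rewrite /cint !(Rintegral_cst _ mD).
by transitivity (complex.Re c * 1 +i* (complex.Im c * 1));
  [congr (_ * _ +i* (_ * _))|rewrite !mulr1; case: c].
Qed.

End ComplexIntegral.

(** With s = sqrt q, n s^n is at most the sum of s^i for i < n, hence at most 1 / (1 - s), and a
    factor s^n remains. *)
Lemma cvg_natX0 (R : realType) (q : R) : 0 <= q -> q < 1 ->
  n%:R * q ^+ n @[n --> \oo] --> (0 : R).
Proof.
move=> q0 q1; pose s := Num.sqrt q.
have s0 : 0 <= s by rewrite sqrtr_ge0.
have s1 : s < 1 by rewrite -sqrtr1 ltr_sqrt.
have sq n : q ^+ n = s ^+ n * s ^+ n by rewrite -exprMn -expr2 sqr_sqrtr.
apply: (@squeeze_cvgr _ _ _ _ (cst 0) (fun n => (1 - s)^-1 * s ^+ n)); last 2 first.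
- exact: cvg_cst.
- by rewrite -[X in _ --> X](mulr0 (1 - s)^-1); apply: cvgMl_tmp; exact: cvg_expr0.
near=> n; rewrite mulr_ge0 ?exprn_ge0//= sq mulrA ler_wpM2r ?exprn_ge0//.
apply: le_trans (geo_sum_le n s0 s1).
rewrite mulr_natl -[X in X <= _](_ : \sum_(i < n) s ^+ n = _).
  by apply: ler_sum => i _; rewrite ler_wiXn2l ?(ltW s1) ?(ltnW (ltn_ord i)).
by rewrite sumr_const card_ord.
Unshelve. all: by end_near. Qed.

(** Exact remainder, multiplied by (1 - g)^2, of the expansion of (1 - g)^-2 cut after n terms. *)
Lemma geo_sum2 (A : comNzRingType) (g : A) n :
  1 - (1 - g) ^+ 2 * \sum_(i < n) i.+1%:R * g ^+ i = n%:R * g ^+ n * (1 - g) + g ^+ n.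
Proof.
elim: n => [|m IH]; first by rewrite big_ord0 mulr0 subr0 mul0r mul0r add0r.
by rewrite big_ord_recr /= mulrDr opprD addrA IH -natr1 [g ^+ m.+1]exprS; ring.
Qed.

Section Transform.
Context {R : realType}.
Variables (mu : probability (measurableTypeR R) R) (L : R).
Hypothesis L0 : 0 < L.
Hypothesis mu_supp : mu [set x : R | (L < `|x|)%R] = 0%E.
Implicit Types (z c u : C R).

Local Notation cint := (cint mu L).

(** Positive distance from [-L, L]: the common condition for the upper half-plane and for a
    neighbourhood of infinity, real points included. *)
Definition off_supp z := exists2 d : R, 0 < d & forall x : R, `|x| <= L -> d <= cmod (x%:C - z).

Lemma off_supp_Im z : 0 < complex.Im z -> off_supp z.
Proof.
move=> z0; exists (complex.Im z) => // x _.
apply: le_trans (normIm_le _); rewrite ImD ImN /= add0r normrN.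
by rewrite ler_norm.
Qed.

Lemma off_supp_large z : L < cmod z -> off_supp z.
Proof.
move=> Lz; exists (cmod z - L); first by rewrite subr_gt0.
move=> x xL; rewrite cmodBC (le_trans _ (cmodB_ge _ _))// lerB// cmod_real//.
Qed.

Definition resolvent z (x : R) : C R := (x%:C - z)^-1.

Lemma off_supp_neq z x : off_supp z -> `|x| <= L -> x%:C - z != 0.
Proof. by move=> [d d0 h] xL; rewrite -cmod_gt0 (lt_le_trans d0)// h. Qed.

Lemma mbounded_shift c : mbounded L (fun x => x%:C - c).
Proof. by apply: mboundedD; [exact: mbounded_id|exact: mbounded_cst]. Qed.

Lemma mbounded_resolvent z : off_supp z -> mbounded L (resolvent z).
Proof. by move=> [d d0 h]; apply: (@mboundedV _ _ _ d) => //; exact: mbounded_shift. Qed.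

Definition cauchyT z := cint (resolvent z).
Definition cauchyT' z := cint (fun x => resolvent z x ^+ 2).

Lemma stieltjesE z : off_supp z -> stieltjes mu z = cauchyT z.
Proof.
move=> /mbounded_resolvent[m1 m2 _]; rewrite /stieltjes /cauchyT.
by rewrite (Rintegral_supp mu_supp m1) (Rintegral_supp mu_supp m2).
Qed.

Lemma cauchyT_le z d : 0 < d -> (forall x : R, `|x| <= L -> d <= cmod (x%:C - z)) ->
  cmod (cauchyT z) <= 2 / d.
Proof.
move=> d0 h; apply: cint_le => //; first by rewrite invr_ge0 ltW.
  by apply: mbounded_resolvent; exists d.
by move=> x xL; rewrite cmodV lef_pV2 ?posrE ?h// (lt_le_trans d0)// h.
Qed.

Lemma cauchyT_large z : L < cmod z -> cmod (cauchyT z) <= 2 / (cmod z - L).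
Proof.
move=> Lz; apply: cauchyT_le; first by rewrite subr_gt0.
by move=> x xL; rewrite cmodBC (le_trans _ (cmodB_ge _ _))// lerB// cmod_real//.
Qed.

(** Integrated form of the second-order resolvent identity. A quadratic error bound with explicit
    radius is what [cder_quadratic] turns into a derivative along real paths. *)
Lemma cauchyT_diff z : off_supp z -> exists2 K : R, 0 < K &
  exists2 e : R, 0 < e & forall h, cmod h < e ->
   cmod (cauchyT (z + h) - cauchyT z - h * cauchyT' z) <= K * cmod h ^+ 2.
Proof.
move=> oz; have [d d0 hd] := oz.
have d20 : 0 < d / 2 by lra.
exists (2 * (d^-1 ^+ 2 * (d / 2)^-1)).
  by rewrite !mulr_gt0 ?exprn_gt0 ?invr_gt0.
exists (d / 2) => // h hh.
have hd2 x : `|x| <= L -> d / 2 <= cmod (x%:C - (z + h)).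
  move=> xL; rewrite opprD addrA (le_trans _ (cmodB_ge _ _))//.
  by have := hd x xL; lra.
have ozh : off_supp (z + h) by exists (d / 2).
have [m1 m2] := (mbounded_resolvent oz, mbounded_resolvent ozh).
have m3 : mbounded L (fun x => resolvent z x ^+ 2) by exact: mboundedX.
have m4 : mbounded L (fun x => resolvent (z + h) x - resolvent z x).
  by apply: mboundedD => //; exact: mboundedN.
have m5 : mbounded L (fun x => h * resolvent z x ^+ 2).
  by apply: mboundedM => //; exact: mbounded_cst.
rewrite /cauchyT /cauchyT' -cintZ// -!cintB//.
rewrite -mulrA; apply: cint_le => //.
- by rewrite !mulr_ge0 ?exprn_ge0 ?invr_ge0 ?cmod_ge0 ?ltW.
- by apply: mboundedD => //; exact: mboundedN.
move=> x xL; have [n1 n2] := (off_supp_neq oz xL, off_supp_neq ozh xL).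
have -> : resolvent (z + h) x - resolvent z x - h * resolvent z x ^+ 2 =
   resolvent z x ^+ 2 * resolvent (z + h) x * h ^+ 2.
  by rewrite /resolvent; field; rewrite n1 n2.
rewrite cmodM cmodM !cmodX ler_wpM2r ?exprn_ge0 ?cmod_ge0//.
apply: ler_pM; rewrite ?exprn_ge0 ?cmod_ge0//.
  rewrite lerXn2r ?nnegrE ?cmod_ge0 ?invr_ge0 ?(ltW d0)//.
  by rewrite cmodV lef_pV2 ?posrE ?hd// (lt_le_trans d0)// hd.
by rewrite cmodV lef_pV2 ?posrE ?hd2// (lt_le_trans d20)// hd2.
Qed.

Section Expansion.
Variables (c : C R) (r : R).
Hypothesis (r0 : 0 < r) (hr : forall x : R, `|x| <= L -> cmod (x%:C - c) <= r).

(** Expansion at infinity about the centre c: for z = c + 1 / u, the transform is - u [genf] u and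
    its derivative u^2 [genf'] u. The coefficients of [genf] are the moments about c, and [genf'] is
    the derivative of u [genf] u. *)
Definition moment k := cint (fun x => (x%:C - c) ^+ k).
Definition genf u := cint (fun x => (1 - (x%:C - c) * u)^-1).
Definition genf' u := cint (fun x => (1 - (x%:C - c) * u)^-1 ^+ 2).

Let den u x : C R := 1 - (x%:C - c) * u.

Let den_ge u x : cmod u < r^-1 -> `|x| <= L -> 1 - r * cmod u <= cmod (den u x).
Proof.
move=> ur xL; rewrite (le_trans _ (cmodB_ge _ _))// cmod1 lerB// cmodM.
by rewrite ler_wpM2r ?cmod_ge0// hr.
Qed.

Let q1 u : cmod u < r^-1 -> 0 < 1 - r * cmod u.
Proof. by move=> ur; rewrite subr_gt0 mulrC -ltr_pdivlMr// mul1r. Qed.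

Let mden u : cmod u < r^-1 -> mbounded L (fun x => (den u x)^-1).
Proof.
move=> ur; apply: (@mboundedV _ _ _ (1 - r * cmod u)); first exact: q1.
- apply: mboundedD; first exact: mbounded_cst.
  apply: mboundedN; apply: mboundedM; last exact: mbounded_cst.
  exact: mbounded_shift.
- by move=> x; exact: den_ge.
Qed.

Let mpow k : mbounded L (fun x => (x%:C - c) ^+ k).
Proof. by apply: mboundedX; exact: mbounded_shift. Qed.

Lemma hasps_genf : hasps r^-1 moment genf.
Proof.
move=> u ur; set q := r * cmod u.
have q10 : 0 < 1 - q by exact: q1.
have q0 : 0 <= q by rewrite mulr_ge0 ?cmod_ge0 ?ltW.
apply: (@cvgC_squeeze _ _ _ _ _ _ (fun n => 2 * (1 - q)^-1 * q ^+ n)); last first.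
  rewrite -[X in _ --> X](mulr0 (2 * (1 - q)^-1)); apply: cvgMl_tmp.
  by apply: cvg_expr0 => //; lra.
near=> n; rewrite cmodBC /psum.
pose F i x : C R := u ^+ i * (x%:C - c) ^+ i.
have mF i : mbounded L (F i) by apply: mboundedM => //; exact: mbounded_cst.
have -> : \sum_(k < n) moment k * u ^+ k = cint (fun x => \sum_(i < n) F i x).
  by rewrite cint_sum//; apply: eq_bigr => i _; rewrite mulrC -cintZ.
have mFs : mbounded L (fun x => \sum_(i < n) F i x) by exact: mbounded_sum.
rewrite -cintB//; last exact: mden.
rewrite -mulrA; apply: cint_le => //.
- by rewrite mulr_ge0 ?exprn_ge0 ?invr_ge0 ?(ltW q10).
- by apply: mboundedD; [exact: mden|exact: mboundedN].
move=> x xL; have dx := den_ge ur xL.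
have den0 : den u x != 0 by rewrite -cmod_gt0 (lt_le_trans q10).
set g := (x%:C - c) * u.
have -> : (1 - g)^-1 - \sum_(i < n) F i x = (den u x)^-1 * g ^+ n.
  rewrite (_ : \sum_(i < n) _ = \sum_(i < n) g ^+ i); last first.
    by apply: eq_bigr => i _; rewrite /F mulrC -exprMn.
  apply: (mulfI den0); rewrite mulrA mulfV// mul1r mulrBr mulfV//.
  have -> : g ^+ n = 1 + (g - 1) * \sum_(i < n) g ^+ i by rewrite -subrX1 addrC subrK.
  by rewrite /den -/g; ring.
rewrite cmodM cmodV cmodX ler_pM ?invr_ge0 ?exprn_ge0 ?cmod_ge0//.
  by rewrite lef_pV2 ?posrE// (lt_le_trans q10).
rewrite lerXn2r ?nnegrE ?cmod_ge0// cmodM /q ler_wpM2r ?cmod_ge0//.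
exact: hr.
Unshelve. all: by end_near. Qed.

Lemma hasps_genf' : hasps r^-1 (fun k => k.+1%:R * moment k) genf'.
Proof.
move=> u ur; set q := r * cmod u.
have q10 : 0 < 1 - q by exact: q1.
have q0 : 0 <= q by rewrite mulr_ge0 ?cmod_ge0 ?ltW.
pose K := (1 - q)^-1 ^+ 2.
have K0 : 0 <= K by rewrite exprn_ge0// invr_ge0 ltW.
apply: (@cvgC_squeeze _ _ _ _ _ _ (fun n => 2 * K * (2 * (n%:R * q ^+ n) + q ^+ n))); last first.
  rewrite -[X in _ --> X](mulr0 (2 * K)); apply: cvgMl_tmp.
  rewrite -[X in _ --> X](addr0 0); apply: cvgD; last by apply: cvg_expr0 => //; lra.
  rewrite -[X in _ --> X](mulr0 2); apply: cvgMl_tmp.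
  by apply: cvg_natX0 => //; lra.
near=> n; rewrite cmodBC /psum.
pose F i x : C R := i.+1%:R * u ^+ i * (x%:C - c) ^+ i.
have mF i : mbounded L (F i) by apply: mboundedM => //; exact: mbounded_cst.
have -> : \sum_(k < n) k.+1%:R * moment k * u ^+ k = cint (fun x => \sum_(i < n) F i x).
  by rewrite cint_sum//; apply: eq_bigr => i _; rewrite mulrAC -cintZ.
have mFs : mbounded L (fun x => \sum_(i < n) F i x) by exact: mbounded_sum.
have mden2 : mbounded L (fun x => (den u x)^-1 ^+ 2) by apply: mboundedX; exact: mden.
rewrite -cintB//.
rewrite -mulrA; apply: cint_le => //.
- by apply: mulr_ge0 => //; apply: addr_ge0; rewrite ?mulr_ge0// exprn_ge0.
- by apply: mboundedD => //; exact: mboundedN.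
move=> x xL; have dx := den_ge ur xL.
have den0 : den u x != 0 by rewrite -cmod_gt0 (lt_le_trans q10).
set g := (x%:C - c) * u.
have gq : cmod g <= q by rewrite cmodM /q ler_wpM2r ?cmod_ge0// hr.
have -> : (1 - g)^-1 ^+ 2 - \sum_(i < n) F i x =
    (den u x)^-1 ^+ 2 * ((n%:R * g ^+ n) * (1 - g) + g ^+ n).
  rewrite (_ : \sum_(i < n) _ = \sum_(i < n) i.+1%:R * g ^+ i); last first.
    by apply: eq_bigr => i _; rewrite /F -mulrA [u ^+ _ * _]mulrC -exprMn.
  have den20 : den u x ^+ 2 != 0 by rewrite expf_neq0.
  apply: (mulfI den20); rewrite mulrA -exprMn mulfV// expr1n mul1r mulrBr -exprMn mulfV// expr1n.
  by rewrite /den -/g geo_sum2.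
rewrite cmodM cmodX cmodV; apply: ler_pM; rewrite ?exprn_ge0 ?invr_ge0 ?cmod_ge0//.
  rewrite lerXn2r ?nnegrE ?invr_ge0 ?cmod_ge0 ?(ltW q10)//.
  by rewrite lef_pV2 ?posrE// (lt_le_trans q10).
have gn : cmod g ^+ n <= q ^+ n by rewrite lerXn2r ?nnegrE ?cmod_ge0.
rewrite (le_trans (cmodD _ _))// cmodX lerD// !cmodM cmodX cmod_nat mulrC.
apply: ler_pM; rewrite ?mulr_ge0 ?exprn_ge0 ?cmod_ge0//; last by rewrite ler_wpM2l.
by rewrite (le_trans (cmodB _ _))// cmod1; lra.
Unshelve. all: by end_near. Qed.

End Expansion.
End Transform.

(** * Differential and functional equations *)

Section ODE.
Context {R : realType}.
Variables (mu : probability (measurableTypeR R) R) (L : R).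
Hypothesis L0 : 0 < L.
Hypothesis mu_supp : mu [set x : R | (L < `|x|)%R] = 0%E.
Hypothesis mu_moments : has_moments mu (fun k => (k ^ k)%N%:R / (k.+1)`!%N%:R).
Implicit Types (z c u : C R).

Local Notation T z := (1 + cauchyT mu L z).
Local Notation T' z := (cauchyT' mu L z).

(* Zero when [z (z T - 1) T' = T], which is [moment_convolution] read on
   generating functions. *)
Definition ode_defect z := z ^+ 2 * T' z * T z - T z - z * T' z.

(** [ode_defect] at z = c + 1 / u written in u: the poles have cancelled, so that u = 0, that is z =
    infinity, is an ordinary point. *)
Let defect_series c u := (1 + c * u) ^+ 2 * genf' mu L c u * (1 - u * genf mu L c u)
  - (1 - u * genf mu L c u) - (1 + c * u) * (u * genf' mu L c u).

Lemma ode_defectE c u : u != 0 -> (forall x : R, `|x| <= L -> x%:C != c + u^-1) ->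
  (exists2 r : R, 0 < r & cmod u < r^-1 /\ forall x : R, `|x| <= L -> cmod (x%:C - c) <= r) ->
  ode_defect (c + u^-1) = defect_series c u.
Proof.
move=> u0 xn [r r0 [ur hr]].
have rr x : `|x| <= L -> cmod ((x%:C - c) * u) <= r * cmod u.
  by move=> xL; rewrite cmodM ler_wpM2r ?cmod_ge0// hr.
have ru : r * cmod u < 1 by rewrite mulrC -ltr_pdivlMr// mul1r.
have mden : mbounded L (fun x : R => (1 - (x%:C - c) * u)^-1 : C R).
  apply: (@mboundedV _ _ _ (1 - r * cmod u)); first by rewrite subr_gt0.
  - apply: mboundedD; first exact: mbounded_cst.
    apply: mboundedN; apply: mboundedM; last exact: mbounded_cst.
    exact: mbounded_shift.
  - move=> x xL; rewrite (le_trans _ (cmodB_ge _ _))// cmod1 lerB//.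
    exact: rr.
have key (x : R) : `|x| <= L -> resolvent (c + u^-1) x = - u * (1 - (x%:C - c) * u)^-1.
  move=> xL; rewrite /resolvent.
  have d0 : 1 - (x%:C - c) * u != 0.
    rewrite subr_eq0; apply/eqP => h; have := rr x xL; rewrite -h cmod1.
    by rewrite leNgt ru.
  have -> : x%:C - (c + u^-1) = - u^-1 * (1 - (x%:C - c) * u) by field.
  by rewrite invfM invrN invrK.
have e1 : cauchyT mu L (c + u^-1) = - u * genf mu L c u.
  by rewrite /cauchyT (eq_cint _ key) cintZ.
have e2 : cauchyT' mu L (c + u^-1) = u ^+ 2 * genf' mu L c u.
  rewrite /cauchyT' /genf' -cintZ; last exact: mboundedX.
  by apply: eq_cint => x xL; rewrite key// exprMn sqrrN.
rewrite /ode_defect /defect_series e1 e2; set G := genf _ _ _ _; set G' := genf' _ _ _ _.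
by field.
Qed.

Let hasps_defect c r : 0 < r -> (forall x : R, `|x| <= L -> cmod (x%:C - c) <= r) ->
  exists a, hasps r^-1 a (defect_series c).
Proof.
move=> r0 hr; have h1 := hasps_genf (mu := mu) r0 hr; have h2 := hasps_genf' (mu := mu) r0 hr.
have i1 := @hasps_id R r^-1; have c1 := @hasps_cst R r^-1 1.
have lin := hasps_add c1 (hasps_mul (@hasps_cst R r^-1 c) i1).
have tT := hasps_add c1 (hasps_opp (hasps_shift h1)).
have h3 := hasps_add (hasps_add (hasps_mul (hasps_mul (hasps_mul lin lin) h2) tT) (hasps_opp tT))
  (hasps_opp (hasps_mul lin (hasps_shift h2))).
eexists; apply: hasps_ext h3 => u _; rewrite /defect_series expr2.
by [].
Qed.

Lemma moment0E k : moment mu L 0 k = ((k ^ k)%N%:R / (k.+1)`!%N%:R)%:C.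
Proof.
have [ik hk] := mu_moments k.
have mX : measurable_fun [set: R] (fun x : R => x ^+ k) by exact: measurable_funX.
have reX (x : R) : (x%:C - 0) ^+ k = (x ^+ k)%:C :> C R by rewrite subr0 rmorphXn.
rewrite /moment /cint; apply: complexP => /=.
  under eq_Rintegral do rewrite reX /=.
  by rewrite -(Rintegral_supp mu_supp mX) /Rintegral hk.
under eq_Rintegral do rewrite reX /=.
by rewrite Rintegral_cst ?mul0r//; exact: measurable_supp.
Qed.

Let defect0_coef u : cmod u < L^-1 -> defect_series 0 u = 0.
Proof.
move=> uL.
have hr (x : R) : `|x| <= L -> cmod (x%:C - 0 : C R) <= L by move=> xL; rewrite subr0 cmod_real.
have h1 := hasps_genf (mu := mu) L0 hr; have h2 := hasps_genf' (mu := mu) L0 hr.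
have c1 := @hasps_cst R L^-1 1.
have tT := hasps_add c1 (hasps_opp (hasps_shift h1)).
have h3 := hasps_add (hasps_add (hasps_mul h2 tT) (hasps_opp tT)) (hasps_opp (hasps_shift h2)).
have := h3 u uL; set a := (X in psum X u); set v := (X in _ --> X).
have -> : v = defect_series 0 u.
  by rewrite /v /defect_series mul0r addr0 expr1n !mul1r.
(* Coefficient 0 is m_0 - 1, and coefficient n + 1 is (n+2) m_(n+1) - n m_n minus the sum of
   [moment_convolution]. *)
have a0 n : a n = 0.
  rewrite /a /cauchy; case: n => [|n].
    rewrite big_ord1 /= moment0E oppr0 !addr0 mulr1 mul1r.
    by rewrite expn0 divr1 subrr.
  rewrite big_ord_recr /= subnn oppr0 addr0 mulr1.
  rewrite (eq_bigr (fun i : 'I_n.+1 => - (i.+1%:R * ((i ^ i)%N%:R / (i.+1)`!%N%:R) *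
    (((n - i) ^ (n - i))%N%:R / ((n - i).+1)`!%N%:R))%:C)); last first.
    move=> i _; rewrite subSn -1?ltnS// add0r !moment0E mulrN !rmorphM /= .
    by rewrite !rmorph_nat.
  rewrite sumrN -rmorph_sum /= moment_convolution !moment0E add0r opprK.
  rewrite rmorphB !rmorphM /= !rmorph_nat -[n.+1%:R]natr1; ring.
rewrite (_ : psum a u = cst 0); last first.
  by apply/funext => n; rewrite /psum big1// => i _; rewrite a0 mul0r.
by move/cvg_lim => <- //; rewrite lim_cst.
Qed.

Lemma ode_large z : L < cmod z -> ode_defect z = 0.
Proof.
move=> Lz; have z0 : z != 0 by rewrite -cmod_gt0 (lt_trans L0).
have u0 : z^-1 != 0 by rewrite invr_eq0.
have uL : cmod z^-1 < L^-1 by rewrite cmodV ltf_pV2 ?posrE// (lt_trans L0).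
rewrite -[z]invrK -[z^-1^-1]add0r ode_defectE ?defect0_coef//.
  move=> x xL; rewrite add0r invrK; apply/eqP => h; move: Lz.
  by rewrite -h cmod_real ltNge xL.
by exists L => //; split => // x xL; rewrite subr0 cmod_real.
Qed.

(* The expansion at infinity centred at [- i N] converges at [z] for large [N],
   and close to infinity the equation is already known. *)
Lemma ode_upper z : 0 < complex.Im z -> ode_defect z = 0.
Proof.
move=> b0; set b := complex.Im z in b0.
(* Since b N = L^2 + 1, |z - c|^2 >= (b + N)^2 > L^2 + N^2: the disc of radius r about c contains
   [-L, L] but not z. *)
pose N := (L ^+ 2 + 1) / b.
have N0 : 0 < N by rewrite divr_gt0// ltr_wpDl ?sqr_ge0.
pose c : C R := 0 +i* (- N).
pose r := Num.sqrt (L ^+ 2 + N ^+ 2).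
have rr0 : 0 < L ^+ 2 + N ^+ 2 by rewrite addr_gt0 ?exprn_gt0.
have r0 : 0 < r by rewrite sqrtr_gt0.
have hr (x : R) : `|x| <= L -> cmod (x%:C - c) <= r.
  move=> xL; rewrite cmodE /r ler_sqrt ?(ltW rr0)//= opprK add0r subr0 lerD2r.
  by rewrite -[x ^+ 2]real_normK ?num_real// lerXn2r ?nnegrE ?(ltW L0).
have zr : r < cmod (z - c).
  have re : complex.Re (z - c) = complex.Re z by rewrite ReD ReN /= oppr0 addr0.
  have im : complex.Im (z - c) = b + N by rewrite ImD ImN /= opprK.
  have bN : b * N = L ^+ 2 + 1 by rewrite /N mulrC divfK ?gt_eqF.
  have bN0 : 0 < b + N by rewrite addr_gt0.
  rewrite cmodE re im /r ltr_sqrt; last by rewrite ltr_wpDl ?sqr_ge0// exprn_gt0.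
  rewrite sqrrD bN; have := sqr_ge0 (complex.Re z); have := sqr_ge0 b.
  by have := sqr_ge0 L; lra.
pose u := (z - c)^-1.
have zc0 : z - c != 0 by rewrite -cmod_gt0 (lt_trans r0).
have u0 : u != 0 by rewrite invr_eq0.
have ur : cmod u < r^-1 by rewrite cmodV ltf_pV2 ?posrE// (lt_trans r0).
have zE : z = c + u^-1 by rewrite invrK addrC subrK.
rewrite zE ode_defectE//; last 2 first.
- move=> x xL; rewrite -zE; apply/eqP => xz.
  by move: b0; rewrite /b -xz /= ltxx.
- by exists r.
have [a ha] := hasps_defect r0 hr.
have ri0 : 0 < r^-1 by rewrite invr_gt0.
apply: (hasps_identity ri0 ha) => // e e0.
(* The three bounds make d < e, put d inside the disc of convergence, and give |c + 1 / d| > L, so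
   that [ode_large] provides a zero at u = d. *)
pose d := Num.min (e / 2) (Num.min (r^-1 / 2) (L + cmod c + 1)^-1).
have K0 : 0 < L + cmod c + 1 by rewrite ltr_wpDl// addr_ge0 ?cmod_ge0 ?ltW.
have d0 : 0 < d by rewrite !lt_min invr_gt0 K0 !divr_gt0.
have cd : cmod (d%:C : C R) = d by rewrite cmod_real gtr0_norm.
have d0' : d%:C != 0 :> C R by rewrite -cmod_gt0 cd.
have Lz' : L < cmod (c + d%:C^-1).
  rewrite addrC -[c]opprK (lt_le_trans _ (cmodB_ge _ _))// cmodN cmodV cd.
  rewrite ltrBrDr (lt_le_trans (_ : _ < L + cmod c + 1))//; first by lra.
  by rewrite -[leLHS]invrK lef_pV2 ?posrE ?invr_gt0// /d !ge_min lexx !orbT.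
exists d%:C; split => //.
  by rewrite cd /d gt_min (_ : e / 2 < e)//; lra.
rewrite -ode_defectE ?ode_large//.
- move=> x xL; apply/eqP => h; move: Lz'.
  by rewrite -h cmod_real ltNge xL.
- exists r => //; split => //; rewrite cd /d !gt_min (_ : r^-1 / 2 < r^-1) ?orbT//.
  lra.
Qed.

End ODE.

(** * Complex exponential and derivatives along real paths *)

Section Paths.
Context {R : realType}.
Implicit Types (f g : R -> C R) (z w : C R).

Lemma cvg_ReImP (T : Type) (F : set_system T) {FF : Filter F} (f : T -> C R) (l : C R) :
  f @ F --> l <->
  (complex.Re (f t) @[t --> F] --> complex.Re l) /\ (complex.Im (f t) @[t --> F] --> complex.Im l).
Proof.
split=> [/cvgCP h|[hr hi]].
  split; apply/cvgrPdist_lt => e e0; move/cvgrPdist_lt/(_ _ e0): h; apply: filterS => t;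
    rewrite sub0r normrN ger0_norm ?cmod_ge0//; apply: le_lt_trans.
    by rewrite distrC -ReN -ReD normRe_le.
  by rewrite distrC -ImN -ImD normIm_le.
apply: (@cvgC_squeeze _ _ _ _ _ _ (fun t => `|complex.Re (f t) - complex.Re l| +
   `|complex.Im (f t) - complex.Im l|)).
  by apply: nearW => t; rewrite (le_trans (cmod_le_ReIm _))// ReD ImD ReN ImN.
have sub0 (g : T -> R) (a : R) : g @ F --> a -> `|g t - a| @[t --> F] --> (0 : R).
  move=> ga; rewrite -[X in _ --> X](normr0 R); apply: cvg_norm.
  by rewrite -[X in _ --> X](subrr a); apply: cvgB => //; exact: cvg_cst.
by rewrite -[X in _ --> X](addr0 0); apply: cvgD; exact: sub0.
Qed.

Lemma cexp0 : cexp (0 : C R) = 1.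
Proof. by rewrite /cexp /= expR0 cos0 sin0 mulr1 mulr0. Qed.

Lemma cexpD z w : cexp (z + w) = cexp z * cexp w.
Proof.
apply: complexP; rewrite ?ReM ?ImM /cexp ReD ImD /= expRD ?cosD ?sinD; ring.
Qed.

Lemma cmod_cexp z : cmod (cexp z) = expR (complex.Re z).
Proof.
rewrite cmodE /cexp /= !exprMn -mulrDr cos2Dsin2 mulr1 sqrtr_sqr.
by rewrite ger0_norm ?expR_ge0.
Qed.

Lemma cexp_neq0 z : cexp z != 0.
Proof. by rewrite -cmod_gt0 cmod_cexp expR_gt0. Qed.

Lemma cexpN z : cexp (- z) = (cexp z)^-1.
Proof. by apply: (mulfI (cexp_neq0 z)); rewrite -cexpD subrr cexp0 mulfV ?cexp_neq0. Qed.

Lemma cexp_continuous : continuous (cexp : C R -> C R).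
Proof.
move=> z; have FN := @nbhs_filter (C R) z.
have [hr hi] := (@cvg_ReImP _ _ FN id z).1 (@cvg_id _ _).
have he := cvg_comp _ _ hr (@continuous_expR R (complex.Re z)).
have hc := cvg_comp _ _ hi (@continuous_cos R (complex.Im z)).
have hs := cvg_comp _ _ hi (@continuous_sin R (complex.Im z)).
by apply/(@cvg_ReImP _ _ FN); split; [exact: (cvgM he hc)|exact: (cvgM he hs)].
Qed.

Lemma cvg_epsdelta (F : C R -> C R) (z l : C R) (e : R) : F w @[w --> z] --> l -> 0 < e ->
  exists2 d : R, 0 < d & forall w, cmod (w - z) < d -> cmod (F w - l) < e.
Proof.
have FN := @nbhs_filter (C R) z.
move=> /(@cvgCP _ _ _ FN)/cvgrPdist_lt h e0; apply/nearC; move: (h _ e0).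
by apply: filterS => w; rewrite sub0r normrN ger0_norm ?cmod_ge0.
Qed.

(** A path in the plane is differentiated componentwise, so that the real mean value theorem and the
    constancy criterion apply to each component. *)
Definition cder f (t : R) (d : C R) :=
  is_derive t 1 (fun s => complex.Re (f s)) (complex.Re d) /\
  is_derive t 1 (fun s => complex.Im (f s)) (complex.Im d).

Lemma cder_cst c t : cder (fun=> c) t 0.
Proof. by split; exact: is_derive_cst. Qed.

Lemma cderD f g t df dg : cder f t df -> cder g t dg -> cder (fun s => f s + g s) t (df + dg).
Proof.
move=> [f1 f2] [g1 g2]; split.
  by under eq_fun do rewrite ReD; rewrite ReD; exact: is_deriveD.
by under eq_fun do rewrite ImD; rewrite ImD; exact: is_deriveD.
Qed.

Lemma cder_eq f t d d' : cder f t d -> d = d' -> cder f t d'.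
Proof. by move=> ? <-. Qed.

Lemma cderM f g t df dg : cder f t df -> cder g t dg ->
  cder (fun s => f s * g s) t (df * g t + f t * dg).
Proof.
move=> [f1 f2] [g1 g2]; split.
  under eq_fun do rewrite ReM; rewrite ReD !ReM.
  by apply: is_derive_eq; rewrite -![_ *: _]/(_ * _); ring.
under eq_fun do rewrite ImM; rewrite ImD !ImM.
by apply: is_derive_eq; rewrite -![_ *: _]/(_ * _); ring.
Qed.

Lemma cderV f t df : f t != 0 -> cder f t df -> cder (fun s => (f s)^-1) t (- df / f t ^+ 2).
Proof.
move=> f0 [f1 f2].
pose n s := complex.Re (f s) ^+ 2 + complex.Im (f s) ^+ 2.
have nE s : n s = cmod (f s) ^+ 2 by rewrite cmodE sqr_sqrtr ?addr_ge0 ?sqr_ge0.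
have n0 : n t != 0 by rewrite nE expf_neq0// cmod_eq0.
have dn : is_derive t 1 n (2 * (complex.Re (f t) * complex.Re df + complex.Im (f t) * complex.Im df)).
  by apply: is_derive_eq; rewrite -![_ *: _]/(_ * _); ring.
have dV : is_derive t 1 (fun s => (n s)^-1)
    (- n t ^- 2 *: (2 * (complex.Re (f t) * complex.Re df + complex.Im (f t) * complex.Im df))).
  exact: is_deriveV.
have nt : n t = complex.Re (f t) ^+ 2 + complex.Im (f t) ^+ 2 by [].
have c2 : cmod (f t ^+ 2) ^+ 2 = n t ^+ 2 by rewrite cmodX -nE.
split.
  under eq_fun do rewrite ReV -nE; rewrite ReM ReN ImN ReV ImV c2.
  rewrite !expr2 ReM ImM -!expr2; apply: is_derive_eq; rewrite -![_ *: _]/(_ * _).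
  by move: n0; rewrite nt => n0; field.
under eq_fun do rewrite ImV -nE; rewrite ImM ReN ImN ReV ImV c2.
rewrite !expr2 ReM ImM -!expr2; apply: is_derive_eq; rewrite -![_ *: _]/(_ * _).
by move: n0; rewrite nt => n0; field.
Qed.

Lemma cder_exp f t df : cder f t df -> cder (fun s => cexp (f s)) t (df * cexp (f t)).
Proof.
move=> [f1 f2]; split; rewrite /cexp ?ReM ?ImM /=.
  by apply: is_derive_eq; rewrite -![_ *: _]/(_ * _); ring.
by apply: is_derive_eq; rewrite -![_ *: _]/(_ * _); ring.
Qed.

Lemma is_derive_quadratic (g : R -> R) (t d K e : R) : 0 < e ->
  (forall h : R, `|h| < e -> `|g (t + h) - g t - h * d| <= K * h ^+ 2) ->
  is_derive t 1 g d.
Proof.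
move=> e0 hq.
have hc : h^-1 *: (g (h *: 1 + t) - g t) @[h --> (0 : R)^'] --> d.
  apply/cvgrPdist_lt => eps eps0; rewrite /dnbhs /within /=.
  pose K' := Num.max 1 K; have K'0 : 0 < K' by rewrite lt_max ltr01.
  pose m := Num.min e (eps / K').
  have m0 : 0 < m by rewrite lt_min e0 divr_gt0.
  apply/nbhs_ballP; exists m => //= h; rewrite /ball /= sub0r normrN lt_min => /andP[he hm] h0.
  have hh := hq h he; rewrite -[h *: 1]/(h * 1) mulr1 [h + t]addrC.
  rewrite distrC; have -> : h^-1 *: (g (t + h) - g t) - d = h^-1 * (g (t + h) - g t - h * d).
    by rewrite -[_ *: _]/(_ * _); field.
  have hp : 0 < `|h| by rewrite normr_gt0.
  rewrite normrM normfV -ltr_pdivlMl ?invr_gt0// invrK.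
  apply: (@le_lt_trans _ _ (`|h| * (K' * `|h|))); last first.
    by rewrite ltr_pM2l// mulrC -ltr_pdivlMr.
  rewrite mulrCA -expr2 real_normK ?num_real// (le_trans hh)//.
  by rewrite ler_wpM2r ?sqr_ge0// le_max lexx orbT.
apply: DeriveDef; first by apply/cvg_ex; exists d.
exact: cvg_lim.
Qed.

Lemma cder_quadratic f (t K e : R) d : 0 < e ->
  (forall h : R, `|h| < e -> cmod (f (t + h) - f t - h%:C * d) <= K * h ^+ 2) ->
  cder f t d.
Proof.
move=> e0 hq; split; apply: (@is_derive_quadratic _ _ _ K e) => // h /hq; apply: le_trans.
  have := normRe_le (f (t + h) - f t - h%:C * d).
  by rewrite !(ReD, ReN, ReM) /= mul0r subr0.
have := normIm_le (f (t + h) - f t - h%:C * d).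
by rewrite !(ImD, ImN, ImM) /= mul0r addr0.
Qed.

Lemma cder_comp f (g : R -> R) t d (g' : R) : cder f (g t) d -> is_derive t 1 g g' ->
  cder (fun s => f (g s)) t (g'%:C * d).
Proof.
move=> [f1 f2] dg; split.
  by rewrite ReM /= mul0r subr0 mulrC; exact: (is_derive1_comp f1 dg).
by rewrite ImM /= mul0r addr0 mulrC; exact: (is_derive1_comp f2 dg).
Qed.

Lemma cder0_cst f s t : (forall u, cder f u 0) -> f s = f t.
Proof.
by move=> hf; apply: complexP; apply: (is_derive_0_is_cst (f := fun v => _ (f v))) => u;
  have [] := hf u.
Qed.

(** With w in the role of S(z): for |z| large, 1 + w is near 1 and 1 / (z (1 + w)) is near 0. The
    estimate is uniform in w. *)
Lemma functional_eq_limit (L e : R) : 0 < L -> 0 < e ->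
  exists2 M : R, 0 < M & forall z w, M <= cmod z -> L < cmod z /\
    (cmod w <= 2 / (cmod z - L) ->
     cmod ((1 + w) * cexp ((z * (1 + w))^-1) - 1) <= e).
Proof.
move=> L0 e0; have e40 : 0 < e / 4 by rewrite divr_gt0.
have [d d0 hd] := @cvg_epsdelta cexp 0 (cexp 0) _ (@cexp_continuous 0) e40.
rewrite cexp0 in hd.
have [p1e p1d] : 0 < 4 / e /\ 0 < 3 / d by rewrite !divr_gt0.
(* The summand 4 gives |w| <= 1/2, hence 1/2 <= |1 + w| <= 2; 4 / e gives |w| <= e / 2; 3 / d brings
   the argument of the exponential below 2 d / 3. *)
exists (L + 4 + 4 / e + 3 / d); first by rewrite !addr_gt0.
move=> z w; set G := cmod z => gM.
have gL : L < G by lra.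
split=> // hw; have gL0 : 0 < G - L by rewrite subr_gt0.
have hS1 : cmod w <= e / 2.
  apply: le_trans hw _; rewrite (ler_pdivrMr _ _ gL0).
  have e2 : e / 2 * (4 / e) = 2 by field; rewrite gt_eqF.
  by rewrite -[leLHS]e2 (ler_pM2l (_ : 0 < e / 2)) ?divr_gt0//; lra.
have hS2 : cmod w <= 2^-1.
  by apply: le_trans hw _; rewrite (ler_pdivrMr _ _ gL0); lra.
have T1 : 2^-1 <= cmod (1 + w).
  by have := cmodB_ge 1 (- w); rewrite opprK cmodN cmod1; lra.
have T2 : cmod (1 + w) <= 2 by have := cmodD 1 w; rewrite cmod1; lra.
have hE : cmod (cexp ((z * (1 + w))^-1) - 1) < e / 4.
  apply: hd; rewrite subr0 cmodV cmodM invfM.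
  have h1 : (cmod (1 + w))^-1 <= 2 by rewrite invf_ple ?posrE//; lra.
  have h2 : G^-1 <= d / 3.
    have d30 : 0 < d / 3 by lra.
    have G0 : 0 < G by lra.
    by rewrite invf_ple ?posrE// invf_div; lra.
  apply: (le_lt_trans (ler_pM _ _ h2 h1)); rewrite ?invr_ge0 ?cmod_ge0//.
  by lra.
set E := cexp _ in hE *.
have -> : (1 + w) * E - 1 = (1 + w) * (E - 1) + w by ring.
rewrite (le_trans (cmodD _ _))// cmodM.
have := ler_pM (cmod_ge0 _) (cmod_ge0 _) T2 (ltW hE); lra.
Qed.
End Paths.

(** * Functional equation *)

Section FunctionalEquation.
Context {R : realType}.
Variables (mu : probability (measurableTypeR R) R) (L : R).
Hypothesis L0 : 0 < L.
Hypothesis mu_supp : mu [set x : R | (L < `|x|)%R] = 0%E.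
Hypothesis mu_moments : has_moments mu (fun k => (k ^ k)%N%:R / (k.+1)`!%N%:R).
Implicit Types (z w : C R).

Local Notation T z := (1 + cauchyT mu L z).

(** A region stable under scaling by t >= 1, so that it contains the ray from each of its points to
    infinity. Beyond L + 2 one has |S| < 1, which keeps T nonzero where no sign of Im T is
    available. *)
Definition admissible z := 0 < complex.Im z \/ L + 2 < cmod z.

Lemma admissible_off_supp z : admissible z -> off_supp L z.
Proof.
by move=> [/off_supp_Im //|h]; apply: off_supp_large; apply: le_lt_trans h; rewrite lerDl.
Qed.

Lemma admissible_scale z (t : R) : 1 <= t -> admissible z -> admissible (t%:C * z).
Proof.
move=> t1 [z0|zL]; [left|right].
  by rewrite ImM /= mul0r addr0 mulr_gt0// (lt_le_trans ltr01).
rewrite cmodM cmod_real ger0_norm ?(le_trans ler01)//.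
by rewrite (lt_le_trans zL)// ler_peMl ?cmod_ge0.
Qed.

Lemma admissible_neq0 z : admissible z -> z != 0.
Proof.
move=> [z0|zL]; apply/eqP => zz; first by move: z0; rewrite zz /= ltxx.
by move: zL; rewrite zz cmod0 ltNge addr_ge0// ltW.
Qed.

Lemma admissible_ode z : admissible z -> ode_defect mu L z = 0.
Proof.
move=> [h|h]; first exact: ode_upper.
by apply: ode_large => //; apply: le_lt_trans h; rewrite lerDl.
Qed.

(** The integrand Im z / |x - z|^2 is bounded below by a positive constant on [-L, L]; its sign
    alone would not give a strict inequality. *)
Lemma cauchyT_Im z : 0 < complex.Im z -> 0 < complex.Im (cauchyT mu L z).
Proof.
move=> z0; have oz := off_supp_Im L z0.
have [m1 m2 _] := mbounded_resolvent oz.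
pose B := (L + cmod z) ^+ 2.
have B0 : 0 < B by rewrite exprn_gt0// ltr_wpDr// cmod_ge0.
have k0 : 0 < complex.Im z / B by rewrite divr_gt0.
apply: (lt_le_trans k0).
have -> : complex.Im z / B = complex.Im (cint mu L (fun=> 0 +i* (complex.Im z / B))).
  by rewrite cint_cst.
rewrite /cauchyT /cint /=; apply: le_Rintegral => //.
- exact: measurable_supp.
- apply: (@integrable_bounded _ _ _ _ `|complex.Im z / B|) => // ; exact: measurable_cst.
- exact: (integrable_Im mu (mbounded_resolvent oz)).
move=> x /= xL; rewrite /resolvent ImV ImD ImN /= add0r opprK.
have dx := off_supp_neq oz xL.
rewrite ler_pM2l// lef_pV2 ?posrE ?exprn_gt0 ?cmod_gt0//.
  by rewrite lerXn2r ?nnegrE ?cmod_ge0 ?(le_trans (cmodB _ _))// ?lerD2r ?cmod_real// addr_ge0 ?cmod_ge0 ?ltW.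
by rewrite ltr_wpDr// cmod_ge0.
Qed.

Lemma admissible_T_neq0 z : admissible z -> T z != 0.
Proof.
move=> az; apply/eqP => /eqP; rewrite addrC addr_eq0 => /eqP T0.
case: az => [/cauchyT_Im|zL]; first by rewrite T0 /= oppr0 ltxx.
have : cmod (cauchyT mu L z) <= 2 / (cmod z - L).
  by apply: cauchyT_large => //; apply: le_lt_trans zL; rewrite lerDl.
rewrite T0 cmodN cmod1 leNgt => /negP; apply.
by rewrite ltr_pdivrMr; lra.
Qed.

Lemma cder_cauchyT z (t : R) : off_supp L (t%:C * z) ->
  cder (fun s : R => cauchyT mu L (s%:C * z)) t (z * cauchyT' mu L (t%:C * z)).
Proof.
move=> /(cauchyT_diff mu) [K K0 [e e0 h]].
have cz : 0 < cmod z + 1 by rewrite ltr_wpDl// cmod_ge0.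
apply: (@cder_quadratic _ _ _ (K * cmod z ^+ 2) (e / (cmod z + 1))); first by rewrite divr_gt0.
move=> s hs; have sz : cmod (s%:C * z) < e.
  rewrite cmodM cmod_real; move: hs; rewrite ltr_pdivlMr//; apply: le_lt_trans.
  by rewrite ler_wpM2l// lerDl.
have c2 : cmod (s%:C * z) ^+ 2 = cmod z ^+ 2 * s ^+ 2.
  by rewrite cmodM cmod_real exprMn real_normK ?num_real// mulrC.
by rewrite rmorphD /= mulrDl [s%:C * (z * _)]mulrA -[K * _ * _]mulrA -c2; exact: h.
Qed.

(* By the differential equation the left-hand side is constant along the ray
   from [z] to infinity, where it tends to 1. The parametrization [1 + s ^ 2] of
   this ray is defined for all real [s]. *)
Lemma functional_eq z : admissible z -> T z * cexp ((z * T z)^-1) = 1.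
Proof.
move=> az.
pose p (s : R) : R := 1 + s ^+ 2.
have p1 s : 1 <= p s by rewrite lerDl sqr_ge0.
pose g (s : R) : C R := (p s)%:C * z.
have ag s : admissible (g s) by exact: admissible_scale.
pose Phi s := T (g s) * cexp ((g s * T (g s))^-1).
have dp (s : R) : is_derive s 1 p (2 * s).
  by apply: is_derive_eq; rewrite -![_ *: _]/(_ * _); ring.
have dPhi s : cder Phi s 0.
  have os := admissible_off_supp (ag s).
  have dS : cder (fun t => T (g t)) s (0 + (2 * s)%:C * (z * cauchyT' mu L (g s))).
    apply: cderD; first exact: cder_cst.
    exact: (cder_comp (cder_cauchyT os) (dp s)).
  have dg : cder g s ((2 * s)%:C * z).
    split; rewrite ?ReM ?ImM /=; under eq_fun do rewrite ?ReM ?ImM /=.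
      by apply: is_derive_eq; rewrite -![_ *: _]/(_ * _); ring.
    by apply: is_derive_eq; rewrite -![_ *: _]/(_ * _); ring.
  have gT0 : g s * T (g s) != 0.
    by apply: mulf_neq0; [apply: admissible_neq0|apply: admissible_T_neq0].
  apply: cder_eq (cderM dS (cder_exp (cderV gT0 (cderM dg dS)))) _.
  have := admissible_ode (ag s); rewrite /ode_defect => h.
  set E := cexp _; set T' := cauchyT' _ _ _ in h *; set TT := T (g s) in h gT0 *.
  have [g0 t0] : g s != 0 /\ TT != 0 by move: gT0; rewrite mulf_eq0 negb_or => /andP.
  set gs := g s in h g0 *.
  transitivity (E * (2 * s)%:C * z / (gs ^+ 2 * TT) * (gs ^+ 2 * T' * TT - TT - gs * T')); last first.
    by rewrite h mulr0.
  by field; rewrite g0 t0.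
have Phi0 : Phi 0 = T z * cexp ((z * T z)^-1).
  by rewrite /Phi /g /p expr0n addr0 mul1r.
rewrite -Phi0; apply/eqP; rewrite -subr_eq0 -cmod_eq0 eq_le cmod_ge0 andbT.
apply/ler_addgt0Pr => e e0; rewrite add0r.
have [M M0 hM] := functional_eq_limit L0 e0.
have z0 : 0 < cmod z by rewrite cmod_gt0 admissible_neq0.
(* As 1 + s^2 >= s, this parameter already gives |g s| >= s |z| = M. *)
pose s := M / cmod z.
have s0 : 0 < s by rewrite divr_gt0.
have gM : M <= cmod (g s).
  rewrite cmodM cmod_real ger0_norm ?(le_trans ler01)// -ler_pdivrMr// -/s /p.
  by have := sqr_ge0 (s - 1); rewrite sqrrB1; move: (ltW s0) => {}s0; lra.
have -> : Phi 0 = Phi s by exact: cder0_cst.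
have [ML hMs] := hM _ (cauchyT mu L (g s)) gM.
by apply: hMs; apply: cauchyT_large.
Qed.

(** The candidate for W(- 1 / z), built from the measure alone. *)
Definition lambertT z : C R := - (z * T z)^-1.

Lemma cexp_lambertT z : admissible z -> cexp (lambertT z) = T z.
Proof.
move=> az; rewrite /lambertT cexpN.
have := functional_eq az => h; apply: (mulIf (cexp_neq0 (z * T z)^-1)).
by rewrite h mulVf ?cexp_neq0.
Qed.

Lemma lambertT_eq z : admissible z -> lambertT z * cexp (lambertT z) = - z^-1.
Proof.
move=> az; rewrite cexp_lambertT// /lambertT invfM mulNr.
by rewrite -mulrA mulVf ?mulr1// admissible_T_neq0.
Qed.

End FunctionalEquation.

(** * Solutions of w e^w = y *)

Section Lambert.
Context {R : realType}.
Implicit Types (z w y : C R).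

Lemma derive_within_continuous (f df : R -> R) (a b : R) :
  (forall x : R, is_derive x 1 f (df x)) -> {within `[a, b], continuous f}.
Proof.
move=> hf; apply: continuous_subspaceT => x.
apply: differentiable_continuous; apply/derivable1_diffP.
by have [] := hf x.
Qed.

Lemma sin_le_id (x : R) : 0 <= x -> sin x <= x.
Proof.
rewrite le_eqVlt => /predU1P[<-|x0]; first by rewrite sin0.
have [c _] := MVT x0 (fun t _ => is_derive_sin t) (@derive_within_continuous _ _ 0 x (@is_derive_sin R)).
by rewrite sin0 !subr0 => ->; rewrite ler_piMl ?cos_le1// ltW.
Qed.

Lemma cos_ge_subr (x : R) : 0 <= x -> 1 - x <= cos x.
Proof.
rewrite le_eqVlt => /predU1P[<-|x0]; first by rewrite cos0 subr0.
have [c _] := MVT x0 (fun t _ => is_derive_cos t) (@derive_within_continuous _ _ 0 x (@is_derive_cos R)).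
rewrite cos0 subr0 => /eqP; rewrite subr_eq => /eqP ->.
by rewrite addrC lerD2r mulNr lerN2 ler_piMl ?sin_le1// ltW.
Qed.

(** Argument of w for Im w > 0, as an arc cotangent: a single differentiable formula on the open
    upper half-plane. *)
Definition logarg w : R := pi / 2 - atan (complex.Re w / complex.Im w).

Lemma logarg_itv w : 0 < logarg w < pi.
Proof.
rewrite /logarg; have := atan_gtNpi2 (complex.Re w / complex.Im w).
by have := atan_ltpi2 (complex.Re w / complex.Im w); lra.
Qed.

Lemma sin_atan (x : R) : sin (atan x) = x * cos (atan x).
Proof.
have c0 : cos (atan x) != 0.
  by rewrite gt_eqF// cos_gt0_pihalf// atan_gtNpi2 atan_ltpi2.
by have := @atanK R x; rewrite /tan => h; rewrite -{2}h divfK.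
Qed.

Lemma polar w : 0 < complex.Im w ->
  w = (cmod w * cos (logarg w)) +i* (cmod w * sin (logarg w)).
Proof.
move=> w0; set q := complex.Re w / complex.Im w.
have n0 : 0 < cmod w by rewrite (lt_le_trans w0)// (le_trans (ler_norm _))// normIm_le.
have wc : cmod w = complex.Im w * Num.sqrt (1 + q ^+ 2).
  rewrite cmodE -[X in X * _](ger0_norm (ltW w0)) -sqrtr_sqr -sqrtrM ?sqr_ge0//.
  by congr Num.sqrt; rewrite /q; field; rewrite gt_eqF.
have s0 : Num.sqrt (1 + q ^+ 2) != 0.
  by rewrite gt_eqF// sqrtr_gt0 ltr_wpDr// sqr_ge0.
have cE : cos (pi / 2 - atan q) = sin (atan q).
  by rewrite cosB cos_pihalf sin_pihalf mul0r add0r mul1r.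
have sE : sin (pi / 2 - atan q) = cos (atan q).
  by rewrite sinB cos_pihalf sin_pihalf mul0r subr0 mul1r.
apply: complexP; rewrite /= /logarg -/q ?cE ?sE ?sin_atan cos_atan wc.
  by rewrite /q; field; rewrite s0 gt_eqF.
by field.
Qed.

(* Real and imaginary parts of [w + log w], the logarithm of [w e^w]. *)
Definition wlogRe w : R := complex.Re w + ln (cmod w).
Definition wlogIm w : R := complex.Im w + logarg w.

Lemma wexpE w : 0 < complex.Im w ->
  w * cexp w = (expR (wlogRe w) * cos (wlogIm w)) +i* (expR (wlogRe w) * sin (wlogIm w)).
Proof.
move=> w0; have n0 : 0 < cmod w by rewrite (lt_le_trans w0)// (le_trans (ler_norm _))// normIm_le.
rewrite {1}(polar w0) /cexp /wlogRe /wlogIm expRD lnK// cosD sinD.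
by apply: complexP; rewrite ?ReM ?ImM /=; ring.
Qed.

Lemma cmod_wexp w : w != 0 -> cmod (w * cexp w) = expR (wlogRe w).
Proof.
by move=> w0; rewrite cmodM cmod_cexp /wlogRe expRD lnK ?posrE ?cmod_gt0// mulrC.
Qed.

(* The imaginary part of [(w2 + log w2 - w1 - log w1) / (w2 - w1)] is negative,
   being an average of [Im (1 / w)] over the segment from [w1] to [w2]. *)
Lemma wlog_inj w1 w2 : 0 < complex.Im w1 -> 0 < complex.Im w2 ->
  wlogRe w1 = wlogRe w2 -> wlogIm w1 = wlogIm w2 -> w1 = w2.
Proof.
move=> i1 i2 hr hi; apply: contrapT => w12.
pose a := complex.Re w2 - complex.Re w1; pose b := complex.Im w2 - complex.Im w1.
have ab0 : 0 < a ^+ 2 + b ^+ 2.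
  rewrite lt_neqAle addr_ge0 ?sqr_ge0// andbT eq_sym.
  apply/eqP => /eqP; rewrite paddr_eq0 ?sqr_ge0// !sqrf_eq0 !subr_eq0 => /andP[/eqP e1 /eqP e2].
  by apply: w12; exact: complexP.
pose x (t : R) := complex.Re w1 + t * a; pose y (t : R) := complex.Im w1 + t * b.
(* F is the imaginary part of conj(w2 - w1) (w + log w) at w = x t + i y t. Its derivative is |w2 -
   w1|^2 Im (1 / w) < 0, although F would take the same value at both ends. *)
pose F (t : R) := a * (y t + (pi / 2 - atan (x t / y t))) - b * (x t + 2^-1 * ln (x t ^+ 2 + y t ^+ 2)).
pose dF t := - (a ^+ 2 + b ^+ 2) * (y t / (x t ^+ 2 + y t ^+ 2)).
have yp (t : R) : t \in `[0, 1] -> 0 < y t.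
  rewrite in_itv /= => /andP[t0 t1]; rewrite /y /b.
  have -> : complex.Im w1 + t * (complex.Im w2 - complex.Im w1) =
    (1 - t) * complex.Im w1 + t * complex.Im w2 by ring.
  have [t10|t10] := ltP t 1.
    by rewrite ltr_wpDr ?mulr_ge0 ?mulr_gt0 ?subr_gt0// ltW.
  by rewrite ltr_wpDl ?mulr_ge0 ?mulr_gt0 ?subr_ge0// ?(lt_le_trans ltr01)// ltW.
have lnE w (h : 0 < complex.Im w) : 2^-1 * ln (complex.Re w ^+ 2 + complex.Im w ^+ 2) = ln (cmod w).
  have n0 : 0 < complex.Re w ^+ 2 + complex.Im w ^+ 2 by rewrite ltr_wpDl ?sqr_ge0// exprn_gt0.
  have c0 : 0 < cmod w by rewrite (lt_le_trans h)// (le_trans (ler_norm _))// normIm_le.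
  rewrite -[X in ln X](@sqr_sqrtr _ (complex.Re w ^+ 2 + complex.Im w ^+ 2)) ?ltW// -cmodE.
  by rewrite lnXn// -[ln _ *+ 2]mulr_natl mulrA mulVf ?mul1r.
have d (t : R) : t \in `[0, 1] -> is_derive t 1 F (dF t).
  move=> /yp yt; have n0 : 0 < x t ^+ 2 + y t ^+ 2 by rewrite ltr_wpDl ?sqr_ge0// exprn_gt0.
  have dx : is_derive t 1 x a.
    by apply: is_derive_eq; rewrite -![_ *: _]/(_ * _); ring.
  have dy : is_derive t 1 y b.
    by apply: is_derive_eq; rewrite -![_ *: _]/(_ * _); ring.
  have yn : y t != 0 by rewrite gt_eqF.
  have dV : is_derive t 1 (fun s => (y s)^-1) (- y t ^- 2 *: b) by exact: is_deriveV.
  have dq : is_derive t 1 (fun s => x s / y s) (a / y t - x t * b / y t ^+ 2).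
    by apply: is_derive_eq; rewrite -![_ *: _]/(_ * _); field.
  have da := @is_derive1_comp _ atan (fun s => x s / y s) t _ _ (is_derive1_atan _) dq.
  have dn : is_derive t 1 (fun s => x s ^+ 2 + y s ^+ 2) (2 * (x t * a + y t * b)).
    by apply: is_derive_eq; rewrite -![_ *: _]/(_ * _); ring.
  have dl := @is_derive1_comp _ (@ln R) (fun s => x s ^+ 2 + y s ^+ 2) t _ _ (is_derive1_ln n0) dn.
  have -> : F = (fun s => a * (y s + (pi / 2 - (atan \o (fun s => x s / y s)) s)) -
     b * (x s + 2^-1 * (@ln R \o (fun s => x s ^+ 2 + y s ^+ 2)) s)) by [].
  apply: is_derive_eq; rewrite -![_ *: _]/(_ * _) /dF.
  have n0' : x t ^+ 2 + y t ^+ 2 != 0 by rewrite gt_eqF.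
  by field; rewrite n0' yn.
have cF : {within `[0, 1], continuous F}.
  by apply: derivable_within_continuous => t /d[].
have dI (t : R) : t \in `]0, 1[ -> is_derive t 1 F (dF t).
  by move=> tI; apply: d; exact: subset_itv_oo_cc.
have [c cI] := MVT ltr01 dI cF.
have yc : 0 < y c by apply: yp; exact: subset_itv_oo_cc.
have F0 : F 0 = a * wlogIm w1 - b * wlogRe w1.
  by rewrite /F /x /y !mul0r !addr0 lnE.
have F1 : F 1 = a * wlogIm w2 - b * wlogRe w2.
  by rewrite /F /x /y !mul1r /a /b !subrKC lnE.
rewrite F0 F1 hr hi subrr subr0 mulr1 => /esym/eqP; rewrite lt_eqF//.
rewrite /dF mulNr oppr_lt0 mulr_gt0// divr_gt0// ltr_wpDl ?sqr_ge0// exprn_gt0//.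
Qed.

(** In the strip the angle Im w + arg w lies a priori between 0 and 2 pi; Im (w e^w) >= 0 confines
    it to [0, pi], where the cosine is injective. Thus w e^w determines w + log w, and [wlog_inj]
    concludes. *)
Lemma wexp_inj w1 w2 : 0 < complex.Im w1 < pi -> 0 < complex.Im w2 < pi ->
  w1 * cexp w1 = w2 * cexp w2 -> 0 <= complex.Im (w1 * cexp w1) -> w1 = w2.
Proof.
move=> /andP[i1 p1] /andP[i2 p2] e12 im0.
have n0 w : 0 < complex.Im w -> w != 0 by move=> h; apply/eqP => w0; move: h; rewrite w0 /= ltxx.
have hr : wlogRe w1 = wlogRe w2.
  by apply: expR_inj; rewrite -!cmod_wexp ?n0// e12.
apply: wlog_inj => //.
have itv w : 0 < complex.Im w < pi -> 0 <= complex.Im (w * cexp w) -> wlogIm w \in `[0, pi].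
  move=> /andP[w0 wp]; rewrite wexpE//= => h.
  have /andP[l0 lp] := logarg_itv w.
  rewrite in_itv /=; apply/andP; split; first by rewrite ltW// addr_gt0.
  rewrite leNgt; apply/negP => h2; move: h; rewrite pmulr_rge0 ?expR_gt0// leNgt => /negP; apply.
  rewrite -[wlogIm w](subrK pi) sinDpi oppr_lt0 sin_gt0_pi//.
  by rewrite subr_gt0 h2 /= /wlogIm; lra.
apply: cos_inj; rewrite ?itv ?i1 ?i2 ?p1 ?p2 -?e12//.
have := congr1 (@complex.Re R) e12; rewrite !wexpE//= hr.
by apply: mulfI; rewrite gt_eqF ?expR_gt0.
Qed.

Lemma Im_wexp w : complex.Im (w * cexp w) =
  expR (complex.Re w) * (complex.Re w * sin (complex.Im w) + complex.Im w * cos (complex.Im w)).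
Proof. by rewrite ImM /cexp /=; ring. Qed.

(* [Im w] can reach neither 0 nor [pi], since [Im (w e^w) <= 0] there. *)
Lemma strip (w : R -> C R) :
  {within `[0, 1], continuous (fun u => complex.Re (w u))} ->
  {within `[0, 1], continuous (fun u => complex.Im (w u))} ->
  w 0 = 0 -> (forall u, 0 < u -> u <= 1 -> 0 < complex.Im (w u * cexp (w u))) ->
  0 < complex.Im (w 1) < pi.
Proof.
move=> cr ci w0 wi; set eta := fun u => complex.Im (w u) in ci *.
have nz u : 0 < u -> u <= 1 -> eta u != 0.
  move=> u0 u1; apply/eqP => e; have := wi u u0 u1.
  by rewrite Im_wexp -/(eta u) e sin0 mulr0 mul0r addr0 mulr0 ltxx.
have eta0 : eta 0 = 0 by rewrite /eta w0.
(* Just below the real axis near 0, Im (w e^w) is not positive: with a = - Im w, Re w sin a > - a /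
   2 whereas a cos a >= a (1 - a) >= a / 2. So the path can only leave 0 upwards. *)
have pos u : 0 < u -> u <= 1 -> eta u < 0 -> - 2^-1 < complex.Re (w u) -> - 2^-1 < eta u -> False.
  move=> u0 u1 e0 r2 e2; have := wi u u0 u1; rewrite Im_wexp -/(eta u).
  rewrite pmulr_rgt0 ?expR_gt0// ltNge => /negP; apply.
  rewrite -[eta u]opprK; set a := - eta u; rewrite sinN cosN.
  have [a0 a2] : 0 < a /\ a < 2^-1 by rewrite /a; lra.
  have s1 := sin_le_id (ltW a0); have c1 := cos_ge_subr (ltW a0).
  have s0 : 0 < sin a by apply: sin2_gt0; lra.
  have key (b s c x : R) : 0 < b -> b < 2^-1 -> s <= b -> 1 - b <= c -> 0 < s ->
      - 2^-1 < x -> x * - s + - b * c <= 0.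
    move=> b0 b2 sb bc s00 x2.
    have h1 : - 2^-1 * s <= x * s by rewrite ler_wpM2r// ltW.
    have h2 : b * (1 - b) <= b * c by rewrite ler_wpM2l// ltW.
    have h3 : b * b <= b * 2^-1 by rewrite ler_wpM2l ?ltW.
    by lra.
  exact: key.
have [a0|a0|a0] := ltgtP (eta 1) 0; last 2 first.
- rewrite /= ltNge; apply/negP => ap.
  have [|c cI ec] := IVT (v := pi) ler01 ci.
    by rewrite eta0 min_l ?max_r ?(ltW a0)// pi_ge0.
  have [c0|c0] := eqVneq c 0.
    by move: ec; rewrite c0 eta0 => /eqP; rewrite lt_eqF ?pi_gt0.
  move: cI; rewrite in_itv /= => /andP[c0' c1]; have {}c0 : 0 < c by rewrite lt_neqAle eq_sym c0.
  have := wi c c0 c1; rewrite Im_wexp -/(eta c) ec sinpi cospi mulr0 add0r mulrN1.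
  by rewrite pmulr_rgt0 ?expR_gt0// oppr_gt0 ltNge pi_ge0.
- by have := nz 1 ltr01 (lexx _); rewrite a0 eqxx.
(* If Im (w 1) < 0, then Im w, which has no zero on ]0, 1], is negative there, contradicting [pos]
   at a small u. *)
exfalso.
have [_ c0r _] := (continuous_within_itvP _ ltr01).1 cr.
have [_ c0i _] := (continuous_within_itvP _ ltr01).1 ci.
have h2 : (0 : R) < 2^-1 by rewrite invr_gt0.
near (0 : R)^'+ => u.
have u0 : 0 < u by [].
have u1 : u < 1 by near: u; apply: nbhs_right_lt.
have hr : `|complex.Re (w u)| < 2^-1.
  near: u; move/cvgrPdist_lt : c0r => /(_ _ h2); apply: filterS => t /=.
  by rewrite w0 /= sub0r normrN.
have hi : `|eta u| < 2^-1.
  near: u; move/cvgrPdist_lt : c0i => /(_ _ h2); apply: filterS => t /=.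
  by rewrite eta0 /= sub0r normrN.
apply: (pos u) => //; rewrite ?(ltW u1)//.
- rewrite ltNge; apply/negP; rewrite le_eqVlt eq_sym (negPf (nz u u0 (ltW u1)))/= => eu.
  have cu : {within `[u, 1], continuous eta}.
    apply: continuous_subspaceW ci => t /=; rewrite !in_itv /= => /andP[ut ->].
    by rewrite (le_trans (ltW u0)).
  have [|c cI ec] := IVT (v := 0) (ltW u1) cu.
    by rewrite min_r ?max_l ?(ltW a0) ?(ltW eu) ?(ltW (lt_trans a0 eu)).
  move: cI; rewrite in_itv /= => /andP[uc c1].
  by have := nz c (lt_le_trans u0 uc) c1; rewrite ec eqxx.
- by move: hr; rewrite ltr_norml => /andP[].
- by move: hi; rewrite ltr_norml => /andP[].
Unshelve. all: by end_near. Qed.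

End Lambert.

(** * Identification with the Lambert function *)

Section Germs.
Context {R : realType}.
Implicit Types (z w : C R) (f : C R -> C R).

Lemma analytic_hasps (U : set (C R)) f z0 : analytic_on U f -> U z0 ->
  exists2 r : R, 0 < r & exists a, hasps r a (fun h => f (z0 + h)).
Proof.
move=> /[apply] -[a] /nearC[r r0 h]; exists r => //; exists a => u ur.
have := h (z0 + u); rewrite [z0 + u - z0]addrAC subrr add0r => /(_ ur).
by rewrite psumE.
Qed.

Lemma hasps_analytic (U : set (C R)) f :
  (forall z0, U z0 -> exists2 r : R, 0 < r & exists a, hasps r a (fun h => f (z0 + h))) ->
  analytic_on U f.
Proof.
move=> h z0 /h[r r0 [a ha]]; exists a; apply/nearC; exists r => // z zr.
by have := ha _ zr; rewrite psumE subrKC.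
Qed.

Lemma hasps_value r (a : nat -> C R) f : 0 < r -> hasps r a f -> f 0 = a 0%N.
Proof.
move=> r0 h; have := h 0; rewrite cmod0 => /(_ r0) h0.
apply: (@cvg_unique _ (@norm_hausdorff _ (C R)) _ _ _ _ h0).
apply: (cvgC_squeeze _ (cvg_cst 0)); exists 1%N => // n /= n1.
rewrite /psum; case: n n1 => // n _; rewrite big_ord_recl big1 /=.
  by rewrite expr0 mulr1 addr0 subrr cmod0.
by move=> i _; rewrite expr0n mulr0.
Qed.

Lemma analytic_continuous (U : set (C R)) f z0 : analytic_on U f -> U z0 ->
  forall e : R, 0 < e -> exists2 d : R, 0 < d &
    forall z, cmod (z - z0) < d -> cmod (f z - f z0) < e.
Proof.
move=> /analytic_hasps/[apply] -[r r0 [a ha]] e e0.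
have [d d0 hd] := cvg_epsdelta (hasps_cvg0 r0 ha) e0.
have := hasps_value r0 ha; rewrite addr0 => f0.
exists d => // z zd; rewrite f0 -[z in f z](subrKC z0).
by apply: hd; rewrite subr0.
Qed.

End Germs.

Section UpperHalfPlane.
Context {R : realType}.
Variables (mu : probability (measurableTypeR R) R) (L : R).
Hypothesis L0 : 0 < L.
Hypothesis mu_supp : mu [set x : R | (L < `|x|)%R] = 0%E.
Hypothesis mu_moments : has_moments mu (fun k => (k ^ k)%N%:R / (k.+1)`!%N%:R).
Implicit Types (z w : C R).

Local Notation T z := (1 + cauchyT mu L z).

Lemma continuous_pathP (w : R -> C R) :
  (forall u : R, 0 <= u -> forall e : R, 0 < e -> exists2 d : R, 0 < d &
     forall v, 0 <= v -> `|v - u| < d -> cmod (w v - w u) < e) ->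
  {within `[0, 1], continuous (fun u => complex.Re (w u))} /\
  {within `[0, 1], continuous (fun u => complex.Im (w u))}.
Proof.
move=> h.
have key (g : C R -> R) : (forall x y, `|g x - g y| <= cmod (x - y)) ->
    {within `[0, 1], continuous (fun u => g (w u))}.
  move=> hg; apply/subspace_continuousP => u /=; rewrite in_itv /= => /andP[u0 u1].
  apply/cvgrPdist_lt => e /(h u u0)[d d0 hd].
  rewrite /within /=; apply/nbhs_ballP; exists d => //= v uv.
  rewrite in_itv /= => /andP[v0 _].
  by rewrite (le_lt_trans (hg _ _))// cmodBC hd// distrC.
split; apply: key => x y.
  by rewrite -ReN -ReD normRe_le.
by rewrite -ImN -ImD normIm_le.
Qed.

Lemma cder_epsdelta (f : R -> C R) (t : R) d (e : R) : cder f t d -> 0 < e ->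
  exists2 a : R, 0 < a & forall s, `|s - t| < a -> cmod (f s - f t) < e.
Proof.
move=> [[f1 _] [f2 _]] e0.
have c1 := differentiable_continuous ((derivable1_diffP _ _).1 f1).
have c2 := differentiable_continuous ((derivable1_diffP _ _).1 f2).
have /cvgCP/cvgrPdist_lt/(_ _ e0) : f s @[s --> t] --> f t by apply/cvg_ReImP.
move=> /nbhs_ballP[a a0 h]; exists a => // s st.
have := h s; rewrite /ball /= distrC => /(_ st).
by rewrite sub0r normrN ger0_norm ?cmod_ge0.
Qed.

(** [strip] along the ray z / u, from infinity at u = 0 to z at u = 1. *)
Lemma lambertT_strip z : 0 < complex.Im z -> 0 < complex.Im (lambertT mu L z) < pi.
Proof.
move=> z0; pose w (u : R) := lambertT mu L ((u^-1)%:C * z).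
have zn0 : z != 0 by apply/eqP => h; move: z0; rewrite h /= ltxx.
have cz : 0 < cmod z by rewrite cmod_gt0.
have Imp u : 0 < u -> 0 < complex.Im ((u^-1)%:C * z).
  by move=> u0; rewrite ImM /= mul0r addr0 mulr_gt0// invr_gt0.
have az u : 0 < u -> admissible L ((u^-1)%:C * z) by move=> /Imp; left.
have -> : z = (1^-1)%:C * z by rewrite invr1 mul1r.
(* The convention 0^-1 = 0 gives w 0 the value 0, which is also the limit at infinity by the bound
   [small]. *)
have w00 : w 0 = 0 by rewrite /w /lambertT invr0 !mul0r invr0 oppr0.
have small u : 0 < u -> u * (L + 4) <= cmod z -> cmod (w u) <= u * (2 / cmod z).
  move=> u0 uz; set zu := (u^-1)%:C * z.
  have czu : cmod zu = cmod z / u by rewrite cmodM cmod_real gtr0_norm ?invr_gt0// mulrC.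
  have L4 : L + 4 <= cmod zu by rewrite czu ler_pdivlMr// mulrC.
  have gL : L < cmod zu by move: L4; lra.
  have hS2 : cmod (cauchyT mu L zu) <= 2^-1.
    apply: (le_trans (cauchyT_large mu gL)); rewrite ler_pdivrMr ?subr_gt0//.
    by move: L4; move: (cmod zu) => G; lra.
  have T1 : 2^-1 <= cmod (T zu).
    by have := cmodB_ge 1 (- cauchyT mu L zu); rewrite opprK cmodN cmod1; lra.
  rewrite /w /lambertT cmodN cmodV cmodM czu invfM invf_div -mulrA ler_pM2l//.
  rewrite mulrC ler_pM2r ?invr_gt0//.
  by rewrite invf_ple ?posrE// (lt_le_trans _ T1)// invr_gt0.
have [|cr ci] := @continuous_pathP w.
  move=> u; rewrite le_eqVlt => /predU1P[<-|u0] e e0.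
    pose d := Num.min (cmod z / (L + 4)) (e / (2 / cmod z)).
    have L40 : 0 < L + 4 by rewrite addr_gt0.
    have d0 : 0 < d by rewrite lt_min (divr_gt0 cz L40) divr_gt0// divr_gt0.
    exists d => // v v0; rewrite subr0 ger0_norm// lt_min => /andP[v1 v2].
    move: v0; rewrite le_eqVlt => /predU1P[<-|v0]; first by rewrite subrr cmod0.
    rewrite w00 subr0 (le_lt_trans (small _ v0 _))//.
      by rewrite -ler_pdivlMr// ltW.
    by rewrite -ltr_pdivlMr// divr_gt0.
  have zt : (u^-1)%:C * z != 0 by apply: (@admissible_neq0 _ L) => //; exact: az.
  have dV : is_derive u 1 (fun s : R => s^-1) (- u ^- 2 *: 1) by apply: is_deriveV; rewrite gt_eqF.
  have oz := admissible_off_supp (az u u0).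
  have dS := cderD (cder_cst 1 u) (cder_comp (cder_cauchyT mu oz) dV).
  have dz := cderM (cder_comp (_ : cder (fun s : R => s%:C) u^-1 1) dV) (cder_cst z u).
  have {}dz := dz ltac:(by split; [exact: is_derive_id|exact: is_derive_cst]).
  have TT0 : (u^-1)%:C * z * T ((u^-1)%:C * z) != 0.
    by apply: mulf_neq0 => //; apply: admissible_T_neq0 => //; exact: az.
  have dw := cderM (cder_cst (- 1) u) (cderV TT0 (cderM dz dS)).
  have [a a0 ha] := cder_epsdelta dw e0.
  exists a => // v _ /ha; rewrite /w /lambertT.
  by rewrite !mulN1r.
apply: (strip cr ci w00) => u u0 u1.
rewrite lambertT_eq//; last exact: az.
by rewrite ImN ImV mulNr opprK divr_gt0 ?Imp// exprn_gt0// cmod_gt0;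
  apply: (@admissible_neq0 _ L) => //; exact: az.
Qed.

(** [strip] along the segment from 0 to - 1 / z, which lies in the open upper half-plane except for
    0, hence in [slit_plane]. *)
Lemma lambertW0_strip (W : C R -> C R) z : is_lambertW0 W -> 0 < complex.Im z ->
  0 < complex.Im (W (- z^-1)) < pi.
Proof.
move=> [Wan W0 WE] z0.
have zn0 : z != 0 by apply/eqP => h; move: z0; rewrite h /= ltxx.
have cz : 0 < cmod z by rewrite cmod_gt0.
pose p (u : R) : C R := u%:C * - z^-1.
have Imp u : complex.Im (p u) = u * (complex.Im z / cmod z ^+ 2).
  by rewrite ImM /= mul0r addr0 ImN ImV mulNr opprK.
have i0 : 0 < complex.Im z / cmod z ^+ 2 by rewrite divr_gt0// exprn_gt0.
have sp u : 0 <= u -> slit_plane (p u).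
  rewrite le_eqVlt => /predU1P[<-|u0] []; rewrite ?Imp.
    by move=> _; rewrite /p !mul0r /= leNgt oppr_lt0 expR_gt0.
  by move/eqP; rewrite gt_eqF// mulr_gt0.
have -> : - z^-1 = p 1 by rewrite /p mul1r.
have [|cr ci] := @continuous_pathP (fun u => W (p u)).
  move=> u u0 e e0; have [d d0 hd] := analytic_continuous Wan (sp u u0) e0.
  exists (d * cmod z); first by rewrite mulr_gt0.
  move=> v v0 uv; apply: hd; rewrite /p -mulrBl -rmorphB cmodM cmod_real cmodN cmodV.
  by rewrite ltr_pdivrMr.
apply: (strip cr ci); first by rewrite /p mul0r.
move=> u u0 u1; rewrite WE; last by apply: sp; exact: ltW.
by rewrite Imp mulr_gt0.
Qed.

Lemma stieltjes_lambertW0 (W : C R -> C R) z : is_lambertW0 W -> 0 < complex.Im z ->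
  W (- z^-1) = lambertT mu L z.
Proof.
move=> hW z0; have [_ _ WE] := hW.
have az : admissible L z by left.
have zn0 : z != 0 by apply: (@admissible_neq0 _ L).
have im : complex.Im (- z^-1) > 0.
  by rewrite ImN ImV mulNr opprK divr_gt0// exprn_gt0// cmod_gt0.
have sz : slit_plane (- z^-1) by move=> [h _]; move: im; rewrite h ltxx.
apply: wexp_inj; rewrite ?WE ?lambertT_eq//.
- exact: lambertW0_strip.
- exact: lambertT_strip.
- exact: ltW.
Qed.

Lemma stieltjes_formula (W : C R -> C R) z : is_lambertW0 W -> 0 < complex.Im z ->
  stieltjes mu z = - 1 - (z * W (- z^-1))^-1 /\ stieltjes mu z = - 1 + cexp (W (- z^-1)).
Proof.
move=> hW z0; have az : admissible L z by left.
rewrite (stieltjes_lambertW0 hW z0) cexp_lambertT//.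
rewrite (stieltjesE mu_supp); last exact: admissible_off_supp.
split; last by ring.
have zn0 : z != 0 by apply: (@admissible_neq0 _ L).
have T0 : T z != 0 by exact: admissible_T_neq0.
by rewrite /lambertT; field; rewrite T0 zn0.
Qed.

End UpperHalfPlane.

(** * Boundary solutions for real y *)

Section BoundaryUniqueness.
Context {R : realType}.
Implicit Types (z w : C R).

Lemma mulr_cos_lt_sin (x : R) : 0 < x -> x < pi -> x * cos x < sin x.
Proof.
move=> x0 xp; pose g (t : R) := sin t - t * cos t.
have dg (t : R) : is_derive t 1 g (t * sin t).
  by apply: is_derive_eq; rewrite -![_ *: _]/(_ * _); ring.
have [c cI] := MVT x0 (fun t _ => dg t) (@derive_within_continuous R g _ 0 x dg).
rewrite /g sin0 mul0r !subr0 -subr_gt0 => ->.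
move: cI; rewrite in_itv /= => /andP[c0 cx].
by rewrite !mulr_gt0// sin_gt0_pi// c0 (lt_trans cx).
Qed.

Lemma sin_lt_id (x : R) : 0 < x -> x < pi -> sin x < x.
Proof.
move=> x0 xp; pose g (t : R) := t - sin t.
have dg (t : R) : is_derive t 1 g (1 - cos t).
  exact: is_derive_eq.
have [c cI] := MVT x0 (fun t _ => dg t) (@derive_within_continuous R g _ 0 x dg).
rewrite /g sin0 !subr0 -subr_gt0 => ->.
move: cI; rewrite in_itv /= => /andP[c0 cx].
rewrite mulr_gt0// subr_gt0 -cos0 ltr_cos ?in_itv /= ?lexx ?pi_ge0 ?(ltW c0)//=.
by rewrite ltW// (lt_trans cx).
Qed.

Lemma Re_wexp w : complex.Re (w * cexp w) =
  expR (complex.Re w) * (complex.Re w * cos (complex.Im w) - complex.Im w * sin (complex.Im w)).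
Proof. by rewrite ReM /cexp /=; ring. Qed.

(** With w = x + i v, the hypothesis reads x sin v + v cos v >= 0, and v cos v < sin v on ]0, pi[
    forces x > - 1. *)
Lemma strip_Re w : 0 < complex.Im w < pi -> 0 <= complex.Im (w * cexp w) -> - 1 < complex.Re w.
Proof.
move=> /andP[i0 ip]; rewrite Im_wexp pmulr_rge0 ?expR_gt0// => h.
have s0 : 0 < sin (complex.Im w) by rewrite sin_gt0_pi// i0.
have cs := mulr_cos_lt_sin i0 ip.
by rewrite -(ltr_pM2r s0) mulN1r; lra.
Qed.

(** With w = x + i v, the vanishing of x sin v + v cos v gives Re (w e^w) = - e^x v / sin v, where
    e^x > e^-1 and v / sin v > 1. *)
Lemma strip_real_lt w : 0 < complex.Im w < pi -> complex.Im (w * cexp w) = 0 ->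
  complex.Re (w * cexp w) < - expR (- 1).
Proof.
move=> iw im0; have r1 := strip_Re iw ltac:(by rewrite im0).
move: iw => /andP[i0 ip].
have s0 : 0 < sin (complex.Im w) by rewrite sin_gt0_pi// i0.
have sl := sin_lt_id i0 ip.
move: im0; rewrite Im_wexp => /eqP; rewrite mulf_eq0 gt_eqF ?expR_gt0//= => /eqP im0.
rewrite Re_wexp -(ltr_pM2r s0) -mulrA.
have -> : (complex.Re w * cos (complex.Im w) - complex.Im w * sin (complex.Im w)) * sin (complex.Im w)
  = - complex.Im w.
  have cs := cos2Dsin2 (complex.Im w).
  transitivity ((complex.Re w * sin (complex.Im w) + complex.Im w * cos (complex.Im w)) * cos (complex.Im w)
     - complex.Im w * (cos (complex.Im w) ^+ 2 + sin (complex.Im w) ^+ 2)); first by ring.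
  by rewrite im0 cs; ring.
rewrite mulrN mulNr ltrN2 ltr_pM ?expR_ge0 ?(ltW s0)//.
by rewrite ltr_expR.
Qed.

Lemma real_wexp_ge (x : R) : - expR (- 1) <= x * expR x.
Proof.
have := expR_ge1Dx (- x - 1); rewrite -(ler_pM2r (expR_gt0 x)) -expRD.
rewrite (_ : - x - 1 + x = - 1); last by ring.
by rewrite (_ : 1 + (- x - 1) = - x); [rewrite mulNr lerNl|ring].
Qed.

Lemma real_wexp_inj (a b : R) : - 1 <= a -> - 1 <= b -> a * expR a = b * expR b -> a = b.
Proof.
wlog ab : a b / a < b.
  move=> h a1 b1 e; have [ab|ab|//] := ltgtP a b; first exact: h.
  by apply/esym; apply: h.
move=> a1 b1 e; pose g (t : R) := t * expR t.
have dg (t : R) : is_derive t 1 g ((1 + t) * expR t).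
  by apply: is_derive_eq; rewrite -![_ *: _]/(_ * _); ring.
have [c cI] := MVT ab (fun t _ => dg t) (@derive_within_continuous R g _ a b dg).
rewrite /g e subrr => /esym/eqP; rewrite gt_eqF// mulr_gt0 ?subr_gt0//.
by rewrite mulr_gt0 ?expR_gt0//; move: cI; rewrite in_itv /= => /andP[]; lra.
Qed.

(** Closed conditions, which survive in a limit from the upper half-plane. The bound Re w >= - 1,
    inherited from [strip_Re], selects the principal one of the two real solutions when - 1/e < y <
    0. *)
Definition boundary_sol (y : R) w :=
  [/\ 0 <= complex.Im w <= pi, - 1 <= complex.Re w & w * cexp w = y%:C].

(** On the line Im w = pi the imaginary part of w e^w is - pi e^(Re w), so only the open strip and
    the real axis remain; [strip_real_lt] and [real_wexp_ge] show that they serve opposite sides of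
    y = - 1/e. *)
Lemma boundary_sol_cases y w : boundary_sol y w ->
  (0 < complex.Im w < pi /\ y < - expR (- 1)) \/
  (complex.Im w = 0 /\ y = complex.Re w * expR (complex.Re w)).
Proof.
move=> [/andP[i0 ip] r1 e].
have im0 : complex.Im (w * cexp w) = 0 by rewrite e.
have re : complex.Re (w * cexp w) = y by rewrite e.
move: i0; rewrite le_eqVlt => /predU1P[i0|i0].
  by right; split => //; rewrite -re Re_wexp -i0 cos0 mulr1 mul0r subr0 mulrC.
move: ip; rewrite le_eqVlt => /predU1P[ip|ip].
  move: im0; rewrite Im_wexp ip sinpi cospi mulr0 add0r => /eqP.
  by rewrite mulf_eq0 gt_eqF ?expR_gt0//= mulf_eq0 gt_eqF ?pi_gt0//= oppr_eq0 oner_eq0.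
by left; rewrite i0 ip; split => //; rewrite -re; apply: strip_real_lt; rewrite ?i0 ?ip.
Qed.

Lemma boundary_sol_uniq y w1 w2 : boundary_sol y w1 -> boundary_sol y w2 -> w1 = w2.
Proof.
move=> b1 b2; have [_ r1 e1] := b1; have [_ r2 e2] := b2.
have [[i1 y1]|[i1 y1]] := boundary_sol_cases b1;
  have [[i2 y2]|[i2 y2]] := boundary_sol_cases b2.
- by apply: wexp_inj; rewrite ?e1 ?e2.
- by move: y1; rewrite y2 ltNge real_wexp_ge.
- by move: y2; rewrite y1 ltNge real_wexp_ge.
- apply: complexP; last by rewrite i1 i2.
  by apply: real_wexp_inj => //; rewrite -y1.
Qed.

End BoundaryUniqueness.

(** * Boundary values *)

Section Boundary.
Context {R : realType}.
Variables (mu : probability (measurableTypeR R) R) (L : R).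
Hypothesis L0 : 0 < L.
Hypothesis mu_supp : mu [set x : R | (L < `|x|)%R] = 0%E.
Hypothesis mu_moments : has_moments mu (fun k => (k ^ k)%N%:R / (k.+1)`!%N%:R).
Implicit Types (z w : C R).

Local Notation T z := (1 + cauchyT mu L z).
Local Notation lam z := (lambertT mu L z).

Lemma cluster_lim (S : Type) (X : topologicalType) (F : set_system S) {FF : Filter F}
    (f : S -> X) (P : X -> R) (p : X) (l : R) :
  {for p, continuous P} -> cluster (f @ F) p -> P (f s) @[s --> F] --> l -> P p = l.
Proof.
move=> cP clp /cvgrPdist_lt hl; apply: contrapT => /eqP Pl.
have e0 : 0 < `|P p - l| / 2 by rewrite divr_gt0// normr_gt0 subr_eq0.
have h1 : nbhs p [set q | `|P p - P q| < `|P p - l| / 2].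
  by move/cvgrPdist_lt : cP => /(_ _ e0).
have [q [/= q1 q2]] := clp [set q | `|l - P q| < `|P p - l| / 2] _ (hl _ e0) h1.
have : `|P p - l| <= `|P p - P q| + `|l - P q|.
  by rewrite [`|l - _|]distrC (le_trans _ (ler_normD _ _))// addrA subrK.
by move: (`|P p - l|) (`|P p - P q|) (`|l - P q|) q1 q2 => a b c; lra.
Qed.

Definition upper_at (x : R) : set_system (C R) :=
  within (fun z => 0 < complex.Im z) (nbhs (x%:C : C R)).

Lemma upper_atP (x : R) (P : set (C R)) : upper_at x P <->
  exists2 d : R, 0 < d & forall z, 0 < complex.Im z -> cmod (z - x%:C) < d -> P z.
Proof.
have := nearC (x%:C : C R) (fun z => 0 < complex.Im z -> P z).
move=> [h1 h2]; split=> [/h1[d d0 h]|[d d0 h]]; first by exists d => // z /[swap]; exact: h.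
by apply: h2; exists d => // z /[swap]; exact: h.
Qed.

Instance upper_at_filter (x : R) : ProperFilter (upper_at x).
Proof.
apply: Build_ProperFilter_ex.
move=> P /upper_atP[d d0 h]; exists (x +i* (d / 2)); apply: h => /=.
  by rewrite divr_gt0.
have -> : x +i* (d / 2) - x%:C = (d / 2)%:C * 'i%C :> C R.
  by apply: complexP; rewrite ?(ReD, ReN, ImD, ImN, ReM, ImM) /=; ring.
rewrite cmodM cmod_real [cmod 'i%C]cmodE /= expr0n expr1n add0r sqrtr1 mulr1.
by rewrite ger0_norm ?divr_ge0 ?ltW//; lra.
Qed.

(** For the upper bound: if Re w > 1 then |w| > 1, so 1 / |z| = |w| e^(Re w) >= e^(Re w) >= 1 + Re
    w. *)
Lemma lambertT_box z : 0 < complex.Im z ->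
  [/\ 0 <= complex.Im (lam z) <= pi, - 1 <= complex.Re (lam z) &
      complex.Re (lam z) <= 1 + (cmod z)^-1].
Proof.
move=> z0; have az : admissible L z by left.
have zn0 : z != 0 by apply: (@admissible_neq0 _ L).
have cz : 0 < cmod z by rewrite cmod_gt0.
have st := lambertT_strip L0 mu_supp mu_moments z0.
have E := lambertT_eq L0 mu_supp mu_moments az.
have im : 0 <= complex.Im (lam z * cexp (lam z)).
  by rewrite E ImN ImV mulNr opprK divr_ge0 ?exprn_ge0 ?cmod_ge0 ?ltW.
split; first by case/andP: st => /ltW -> /ltW ->.
  by rewrite ltW// strip_Re.
have [r1|r1] := leP (complex.Re (lam z)) 1; first by rewrite (le_trans r1)// lerDl invr_ge0 ltW.
have ex : 1 + complex.Re (lam z) <= expR (complex.Re (lam z)) by exact: expR_ge1Dx.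
have := congr1 cmod E; rewrite cmodM cmod_cexp [cmod (- z^-1)]cmodN [cmod z^-1]cmodV => <-.
have h : complex.Re (lam z) <= cmod (lam z) by rewrite (le_trans (ler_norm _))// normRe_le.
have : 1 * expR (complex.Re (lam z)) <= cmod (lam z) * expR (complex.Re (lam z)).
  by rewrite ler_wpM2r ?expR_ge0//; lra.
by lra.
Qed.

(* Near [x], [lambertT z] stays in a compact box, and its cluster points all solve
   [w e^w = - 1 / x] in the closed strip, which has only one such solution. *)
Lemma boundary_limit (x : R) : x != 0 -> exists2 w, boundary_sol (- x^-1) w &
  forall e : R, 0 < e -> exists2 d : R, 0 < d &
    forall z, 0 < complex.Im z -> cmod (z - x%:C) < d -> cmod (lam z - w) < e.
Proof.
move=> x0; have x0' : 0 < `|x| by rewrite normr_gt0.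
pose M := 1 + (`|x| / 2)^-1.
pose f z : R * R := (complex.Re (lam z), complex.Im (lam z)).
pose B : set (R * R) := `[- 1, M]%classic `*` `[0, pi]%classic.
(* A compact neighbourhood of every point of B: convergence follows from the uniqueness of the
   cluster point inside a compact set to which that point is interior. *)
pose B' : set (R * R) := `[- 2, M + 1]%classic `*` `[- 1, pi + 1]%classic.
have cB : compact B by apply: compact_setX; exact: segment_compact.
have cB' : compact B' by apply: compact_setX; exact: segment_compact.
have BB' p : B p -> nbhs p B'.
  case: p => a b [/=]; rewrite !in_itv /= => /andP[a1 a2] /andP[b1 b2].
  exists (`]- 2, M + 1[%classic, `]- 1, pi + 1[%classic) => /=.
    by split; apply: near_in_itvoo; rewrite in_itv /=; apply/andP; split; lra.
  by move=> [c d] [/= h1 h2]; split => /=; exact: subset_itv_oo_cc.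
have FB : (f @ upper_at x) B.
  apply/upper_atP; exists (`|x| / 2); first by rewrite divr_gt0.
  move=> z z0 zx; have [i1 r1 r2] := lambertT_box z0.
  rewrite /B /f; split; rewrite /= in_itv //= r1 (le_trans r2)// /M lerD2l.
  have h : `|x| / 2 <= cmod z.
    have := cmodB_ge (x%:C) (x%:C - z); rewrite subKr cmod_real cmodBC; lra.
  by rewrite lef_pV2 ?posrE ?divr_gt0// (lt_le_trans _ h)// divr_gt0.
(* P and Q are the real and imaginary parts of w e^w in the coordinates of w. *)
pose P (p : R * R) := expR p.1 * (p.1 * cos p.2 - p.2 * sin p.2).
pose Q (p : R * R) := expR p.1 * (p.1 * sin p.2 + p.2 * cos p.2).
have cmp (g : R -> R) (pr : R * R -> R) (q : R * R) : continuous g -> pr r @[r --> q] --> pr q ->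
    g (pr r) @[r --> q] --> g (pr q).
  by move=> cg cpr; exact: (cvg_comp _ _ cpr (cg _)).
have cE (q : R * R) : expR r.1 @[r --> q] --> expR q.1.
  by apply: cmp; [exact: continuous_expR|exact: cvg_fst].
have cC (q : R * R) : cos r.2 @[r --> q] --> cos q.2.
  by apply: cmp; [exact: continuous_cos|exact: cvg_snd].
have cS (q : R * R) : sin r.2 @[r --> q] --> sin q.2.
  by apply: cmp; [exact: continuous_sin|exact: cvg_snd].
have c1 (q : R * R) : r.1 @[r --> q] --> q.1 by exact: cvg_fst.
have c2 (q : R * R) : r.2 @[r --> q] --> q.2 by exact: cvg_snd.
have cP : continuous P.
  by move=> q; exact: (cvgM (cE q) (cvgB (cvgM (c1 q) (cC q)) (cvgM (c2 q) (cS q)))).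
have cQ : continuous Q.
  by move=> q; exact: (cvgM (cE q) (cvgD (cvgM (c1 q) (cS q)) (cvgM (c2 q) (cC q)))).
have lim : (- z^-1 : C R) @[z --> upper_at x] --> ((- (x^-1))%:C : C R).
  rewrite rmorphN fmorphV; apply: cvgN; apply: cvgV.
    by rewrite -cmod_gt0 cmod_real.
  exact: cvg_within.
have clus p : cluster (f @ upper_at x) p -> boundary_sol (- x^-1) (p.1 +i* p.2).
  move=> clp; have [lr li] := (cvg_ReImP _ _).1 lim.
  have PE : P p = - x^-1.
    apply: (cluster_lim (cP p) clp); apply: cvg_trans lr.
    apply: near_eq_cvg; apply/upper_atP; exists 1 => // z z0 _.
    rewrite /P /f -Re_wexp lambertT_eq//; by left.
  have QE : Q p = 0.
    apply: (cluster_lim (cQ p) clp); apply: cvg_trans li.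
    apply: near_eq_cvg; apply/upper_atP; exists 1 => // z z0 _.
    rewrite /Q /f -Im_wexp lambertT_eq//; by left.
  have Bp : B p.
    have clB : closed B by apply: compact_closed => //; exact: norm_hausdorff.
    rewrite closure_id in clB; rewrite clB => N Np.
    exact: clp.
  move: Bp => [/= ]; rewrite !in_itv /= => /andP[r1 _] i1; split => //=.
  by apply: complexP; rewrite ?Re_wexp ?Im_wexp.
have [p0 [Bp0 clp0]] := cB _ _ FB.
exists (p0.1 +i* p0.2); first exact: clus.
move=> e e0; apply/upper_atP.
have cl1 : cluster (f @ upper_at x) = [set p0].
  apply/seteqP; split => [p /clus bp | p ->//].
  by have := boundary_sol_uniq bp (clus _ clp0); case: p {bp} => a b /= [-> ->]; rewrite -surjective_pairing.
have FP : ProperFilter (f @ upper_at x) by exact: fmap_proper_filter.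
have FB' : (f @ upper_at x) B'.
  by apply: filterS FB => q Bq; exact: nbhs_singleton (BB' _ Bq).
have e2 : 0 < e / 2 by rewrite divr_gt0.
have hb := compact_cluster_set1 (@norm_hausdorff _ _) cB' (BB' _ Bp0) FP FB' cl1.
have hb2 : upper_at x (fun z => ball p0 (e / 2) (f z)) := hb _ (nbhsx_ballx p0 _ e2).
apply: filterS hb2 => z [/=]; rewrite /ball /=; move: (lam z) => v h1 h2.
rewrite (le_lt_trans (cmod_le_ReIm _))// ReD ImD ReN ImN [e]splitr.
by rewrite ltrD// distrC.
Qed.

Lemma boundary_limit_T (x : R) : x != 0 -> exists2 w, boundary_sol (- x^-1) w &
  forall e : R, 0 < e -> exists2 d : R, 0 < d &
    forall z, 0 < complex.Im z -> cmod (z - x%:C) < d -> cmod (T z - cexp w) < e.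
Proof.
move=> /boundary_limit[w bw hw]; exists w => // e e0.
have [d' d'0 hd'] := @cvg_epsdelta R cexp w (cexp w) _ (@cexp_continuous R w) e0.
have [d d0 hd] := hw d' d'0; exists d => // z z0 zx.
rewrite -cexp_lambertT//; last by left.
exact/hd'/hd.
Qed.

(** The density is Im e^w / pi for the boundary solution w at - 1 / x. Its continuity follows from
    the boundary limits alone. *)
Lemma exists_boundary_density : exists f0 : R -> R,
  [/\ f0 0 = 0, forall x, 0 <= f0 x,
      forall x, (0 < f0 x) = (0 < x < expR 1),
      forall x, x != 0 -> forall e : R, 0 < e -> exists2 d : R, 0 < d &
        forall z, 0 < complex.Im z -> cmod (z - x%:C) < d ->
          `|complex.Im (cauchyT mu L z) / pi - f0 x| < e &
      forall x, x != 0 -> {for x, continuous f0}].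
Proof.
have /choice[w hw] : forall x : R, exists w, x != 0 -> boundary_sol (- x^-1) w /\
  forall e : R, 0 < e -> exists2 d : R, 0 < d &
    forall z, 0 < complex.Im z -> cmod (z - x%:C) < d -> cmod (T z - cexp w) < e.
  move=> x; have [x0|/boundary_limit_T[w h1 h2]] := eqVneq x 0; first by exists 0.
  by exists w.
(* The value 0 at the origin makes the set where f0 is positive exactly ]0, e[. *)
pose f0 (x : R) : R := if x == 0 then 0 else complex.Im (cexp (w x)) / pi.
have ipi0 : 0 < (pi : R)^-1 by rewrite invr_gt0 pi_gt0.
have E1 : 0 < expR 1 :> R by exact: expR_gt0.
have pos x : (0 < f0 x) = (0 < x < expR 1).
  rewrite /f0; case: eqP => [->|/eqP x0]; first by rewrite ltxx.
  have [bs _] := hw x x0.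
  (* For y = - 1 / x the non-real case of [boundary_sol_cases], y < - 1/e, is the case 0 < x < e. *)
  have key : (- x^-1 < - expR (- 1)) = (0 < x < expR 1).
    rewrite ltrN2 expRN; have [x0'|x0'] := leP x 0.
      by rewrite ltNge (le_trans (_ : x^-1 <= 0))// ?invr_le0// invr_ge0 ltW.
    by rewrite ltf_pV2 ?posrE.
  have [[/andP[i0 ip] y1]|[i0 y1]] := boundary_sol_cases bs.
    by rewrite -key y1 pmulr_lgt0// /cexp /= mulr_gt0 ?expR_gt0// sin_gt0_pi// i0.
  by rewrite pmulr_lgt0// /cexp /= i0 sin0 mulr0 ltxx -key y1 ltNge real_wexp_ge.
have ge0 x : 0 <= f0 x.
  rewrite /f0; case: eqP => [//|/eqP x0]; have [bs _] := hw x x0.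
  rewrite divr_ge0 ?pi_ge0// /cexp /= mulr_ge0 ?expR_ge0//.
  have [[/andP[i0 ip] y1]|[i0 y1]] := boundary_sol_cases bs; last by rewrite i0 sin0.
  by rewrite ltW// sin_gt0_pi// i0.
have lim x : x != 0 -> forall e : R, 0 < e -> exists2 d : R, 0 < d &
    forall z, 0 < complex.Im z -> cmod (z - x%:C) < d ->
      `|complex.Im (cauchyT mu L z) / pi - f0 x| < e.
  move=> x0 e e0; have [_ h] := hw x x0.
  have ep : 0 < e * pi by rewrite mulr_gt0// pi_gt0.
  have [d d0 hd] := h _ ep; exists d => // z z0 zx.
  rewrite /f0 (negPf x0) -mulrBl normrM [`|pi^-1|]gtr0_norm// ltr_pdivrMr ?pi_gt0//.
  apply: le_lt_trans (hd z z0 zx); apply: le_trans (normIm_le _).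
  by rewrite ImD ImN ImD /= add0r.
exists f0; split => //; first by rewrite /f0 eqxx.
move=> x x0; apply/cvgrPdist_lt => e e0.
have e2 : 0 < e / 2 by rewrite divr_gt0.
have [d d0 hd] := lim x x0 _ e2.
pose m := Num.min (d / 2) `|x|.
have m0 : 0 < m by rewrite lt_min normr_gt0 x0 divr_gt0.
apply/nbhs_ballP; exists m => //= y; rewrite /ball /= lt_min => /andP[y1 y2].
have y0 : y != 0 by apply/eqP => y0; move: y2; rewrite y0 subr0 ltxx.
have [d' d'0 hd'] := lim y y0 _ e2.
(* The point z = y + i t is close to y and to x at once, so Im T / pi at z is within e / 2 of both
   f0 y and f0 x. *)
pose t := Num.min (d / 2) (d' / 2).
have t0 : 0 < t by rewrite lt_min !divr_gt0.
pose z : C R := y +i* t.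
have zy : cmod (z - y%:C) = t.
  have -> : z - y%:C = t%:C * 'i%C :> C R.
    by apply: complexP; rewrite ?(ReD, ReN, ImD, ImN, ReM, ImM) /=; ring.
  rewrite cmodM cmod_real [cmod 'i%C]cmodE /= expr0n expr1n add0r sqrtr1 mulr1.
  by rewrite gtr0_norm.
have zx : cmod (z - x%:C) < d.
  have -> : z - x%:C = (z - y%:C) + (y - x)%:C by rewrite rmorphB; ring.
  rewrite (le_lt_trans (cmodD _ _))// zy cmod_real distrC.
  have : t <= d / 2 by rewrite ge_min lexx.
  by move: y1; lra.
have zy' : cmod (z - y%:C) < d'.
  by rewrite zy (le_lt_trans (_ : _ <= d' / 2))// ?ge_min ?lexx ?orbT//; lra.
have := hd z t0 zx; have := hd' z t0 zy'.
set v := _ / pi => h1 h2.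
rewrite (_ : f0 x - f0 y = (v - f0 y) - (v - f0 x)); last by ring.
by rewrite (le_lt_trans (ler_normB _ _))// [e]splitr ltrD.
Qed.

End Boundary.

(** * Stieltjes inversion *)

Section PoissonKernel.
Context {R : realType}.
Variables (mu : probability (measurableTypeR R) R) (L : R).
Hypothesis mu_supp : mu [set x : R | (L < `|x|)%R] = 0%E.

(** Without the usual factor 1 / pi, the kernel is exactly the imaginary part of the resolvent at x
    + i y. *)
Definition poisson (y x t : R) : R := y / ((t - x) ^+ 2 + y ^+ 2).

Lemma poisson_den (y x t : R) : 0 < y -> 0 < (t - x) ^+ 2 + y ^+ 2.
Proof. by move=> y0; rewrite ltr_wpDl ?sqr_ge0// exprn_gt0. Qed.

Lemma poisson_ge0 (y x t : R) : 0 < y -> 0 <= poisson y x t.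
Proof. by move=> y0; rewrite divr_ge0 ?ltW// poisson_den. Qed.

Lemma poisson_le (y x t : R) : 0 < y -> poisson y x t <= y^-1.
Proof.
move=> y0; rewrite ler_pdivrMr ?poisson_den// mulrDr expr2 mulKf ?gt_eqF//.
by rewrite lerDr mulr_ge0 ?sqr_ge0// invr_ge0 ltW.
Qed.

Lemma measurable_poisson (y : R) :
  measurable_fun [set: measurableTypeR R * measurableTypeR R] (fun p => poisson y p.1 p.2).
Proof.
apply: measurable_funM; first exact: measurable_cst.
apply: (measurableT_comp measurable_invr).
apply: measurable_funD; last exact: measurable_cst.
by apply: measurable_funX; apply: measurable_funB; [exact: measurable_snd|exact: measurable_fst].
Qed.

Lemma measurable_poisson2 (y x : R) :
  measurable_fun [set: measurableTypeR R] (fun t => poisson y x t).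
Proof.
apply: measurable_funM; first exact: measurable_cst.
apply: (measurableT_comp measurable_invr).
apply: measurable_funD; last exact: measurable_cst.
by apply: measurable_funX; apply: measurable_funB; [exact: measurable_id|exact: measurable_cst].
Qed.

Lemma Im_cauchyT (x y : R) : 0 < y ->
  ((complex.Im (cauchyT mu L (x +i* y)))%:E = \int[mu]_t (poisson y x t)%:E)%E.
Proof.
move=> y0; have E (t : R) : complex.Im (resolvent (x +i* y) t) = poisson y x t.
  by rewrite /resolvent /poisson /= add0r sqrrN -mulNr opprK.
have -> : complex.Im (cauchyT mu L (x +i* y)) =
    \int[mu]_(t in [set t : R | (`|t| <= L)%R]) poisson y x t.
  by apply: eq_Rintegral => t _; exact: E.
rewrite -(Rintegral_supp mu_supp) ?fineK//; last exact: measurable_poisson2.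
apply: integrable_fin_num => //.
apply: (@measurable_bounded_integrable _ _ _ mu (fun t => poisson y x t) setT) => //.
- by rewrite (le_lt_trans (probability_le1 _ _))// ltry.
- exact: measurable_poisson2.
- exists y^-1; split; first exact: num_real.
  move=> N MN t _ /=; rewrite ger0_norm ?poisson_ge0//.
  by rewrite (le_trans (poisson_le _ _ y0))// ltW.
Qed.

Lemma integral_poisson (a b y t : R) : a < b -> 0 < y ->
  (\int[lebesgue_measure]_(x in `[a, b]) (poisson y x t)%:E =
  (atan ((b - t) / y) - atan ((a - t) / y))%:E)%E.
Proof.
move=> ab y0; pose F (x : R) := atan ((x - t) / y).
have yn : y != 0 by rewrite gt_eqF.
have dF (x : R) : is_derive x 1 F (poisson y x t).
  have d1 : is_derive x 1 (fun s => (s - t) / y) (y^-1).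
    by apply: is_derive_eq; rewrite -![_ *: _]/(_ * _); ring.
  have := @is_derive1_comp _ atan (fun s => (s - t) / y) x _ _ (is_derive1_atan _) d1.
  move=> h; apply: is_derive_eq => //.
  have := poisson_den x t y0; rewrite /poisson => n0.
  have n2 : (t - x) ^+ 2 + y ^+ 2 != 0 by rewrite gt_eqF.
  by field; rewrite yn n2.
have cF x : {for x, continuous F}.
  by apply: differentiable_continuous; apply/derivable1_diffP; have [] := dF x.
have -> : (atan ((b - t) / y) - atan ((a - t) / y))%:E = ((F b)%:E - (F a)%:E)%E by [].
apply: continuous_FTC2 => //.
- apply: continuous_subspaceT => x.
  apply: cvgM; first exact: cvg_cst.
  apply: cvgV; first by rewrite gt_eqF// poisson_den.
  apply: cvgD; last exact: cvg_cst.
  apply: (@cvg_comp _ _ _ (fun s => t - s) (fun s => s ^+ 2) _ (nbhs (t - x))).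
    by apply: cvgB; [exact: cvg_cst|exact: cvg_id].
  exact: exprn_continuous.
- split.
  + by move=> x _; have [] := dF x.
  + by apply: cvg_at_right_filter; exact: cF.
  + by apply: cvg_at_left_filter; exact: cF.
- by move=> x _; rewrite derive1E; have [_ ->] := dF x.
Qed.

(** Tonelli's theorem for the nonnegative kernel; the indicator of [a, b] moves into the integrand
    so that both integrals run over the whole line. *)
Lemma integral_Im_cauchyT (a b y : R) : a < b -> 0 < y ->
  (\int[lebesgue_measure]_(x in `[a, b]) (complex.Im (cauchyT mu L (x +i* y)))%:E =
  \int[mu]_t (atan ((b - t) / y) - atan ((a - t) / y))%:E)%E.
Proof.
move=> ab y0; under eq_integral do rewrite Im_cauchyT//.
pose h (p : measurableTypeR R * measurableTypeR R) : \bar R :=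
  (poisson y p.1 p.2 * \1_(`[a, b]%classic : set (measurableTypeR R)) p.1)%:E.
have mI : measurable (`[a, b]%classic : set (measurableTypeR R)) by exact: measurable_itv.
have mh : measurable_fun setT h.
  apply/measurable_EFinP; apply: measurable_funM; first exact: measurable_poisson.
  by apply: measurableT_comp; [exact: measurable_indic|exact: measurable_fst].
have h0 p : (0 <= h p)%E by rewrite lee_fin mulr_ge0 ?poisson_ge0.
have := @fubini_tonelli _ _ _ _ _ (@lebesgue_measure R) mu h mh h0.
have -> : (\int[lebesgue_measure]_x \int[mu]_t h (x, t) =
   \int[lebesgue_measure]_(x in `[a, b]) \int[mu]_t (poisson y x t)%:E)%E.
  rewrite [RHS]integral_mkcond; apply: eq_integral => x _.
  rewrite patchE /h /= indicE; case: ifPn => xI.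
    by under eq_integral do rewrite mulr1.
  by under eq_integral do rewrite mulr0; rewrite integral0.
move=> ->; apply: eq_integral => t _.
rewrite -integral_poisson// [RHS]integral_mkcond; apply: eq_integral => x _.
rewrite patchE /h /= indicE; case: ifPn => xI; first by rewrite mulr1.
by rewrite mulr0.
Qed.

End PoissonKernel.

Section Inversion.
Context {R : realType}.
Variables (mu : probability (measurableTypeR R) R) (L : R).
Hypothesis L0 : 0 < L.
Hypothesis mu_supp : mu [set x : R | (L < `|x|)%R] = 0%E.
Hypothesis mu_moments : has_moments mu (fun k => (k ^ k)%N%:R / (k.+1)`!%N%:R).

Local Notation T z := (1 + cauchyT mu L z).

Lemma Im_cauchyT_le (z : C R) : 0 < complex.Im z ->
  complex.Im (cauchyT mu L z) <= cmod (T z) /\ cmod (T z) <= expR (1 + (cmod z)^-1).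
Proof.
move=> z0; have az : admissible L z by left.
split.
  have -> : complex.Im (cauchyT mu L z) = complex.Im (T z) by rewrite ImD /= add0r.
  by rewrite (le_trans (ler_norm _))// normIm_le.
rewrite -(cexp_lambertT L0 mu_supp mu_moments az) cmod_cexp ler_expR.
by have [] := lambertT_box L0 mu_supp mu_moments z0.
Qed.

(* [mu [set t] <= y * Im T (t + i y)], so this excludes atoms. *)
Lemma small_yT (t e : R) : 0 < e -> exists2 y : R, 0 < y & y * cmod (T (t +i* y)) <= e.
Proof.
move=> e0; have [->|t0] := eqVneq t 0.
  (* At t = 0 the bound on T from [lambertT_box] degenerates. Instead y |T| = 1 / |w|, and |w| < B
     would give 1 / y = |w e^w| < B e^B, against the choice of y. *)
  pose B := e^-1; have B0 : 0 < B by rewrite invr_gt0.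
  pose y := (B * expR B)^-1.
  have y0 : 0 < y by rewrite invr_gt0 mulr_gt0// expR_gt0.
  exists y => //; set z : C R := 0 +i* y.
  have z0 : 0 < complex.Im z by [].
  have az : admissible L z by left.
  have zn0 : z != 0 by apply: (@admissible_neq0 _ L).
  have cz : cmod z = y by rewrite cmodE /= expr0n add0r sqrtr_sqr gtr0_norm.
  have E := lambertT_eq L0 mu_supp mu_moments az.
  set w := lambertT mu L z in E.
  have wE : y * cmod (T z) = (cmod w)^-1.
    by rewrite /w /lambertT cmodN cmodV invrK cmodM cz.
  rewrite wE -[e]invrK -/B.
  have w0 : w != 0.
    by apply/eqP => w0; move: E; rewrite w0 mul0r => /esym/eqP; rewrite oppr_eq0 invr_eq0 (negPf zn0).
  rewrite lef_pV2 ?posrE ?cmod_gt0// leNgt; apply/negP => wB.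
  have := congr1 cmod E; rewrite cmodM cmod_cexp [cmod (- z^-1)]cmodN [cmod z^-1]cmodV cz /y invrK => h.
  have : cmod w * expR (complex.Re w) < B * expR B.
    have r : complex.Re w < B by rewrite (le_lt_trans _ wB)// (le_trans (ler_norm _))// normRe_le.
    by rewrite ltr_pM ?cmod_ge0 ?expR_ge0// ltr_expR.
  by rewrite h ltxx.
pose B := expR (1 + `|t|^-1); have B0 : 0 < B by exact: expR_gt0.
have y0 : 0 < e / B by rewrite divr_gt0.
exists (e / B) => //.
set z : C R := t +i* (e / B).
have zt : `|t| <= cmod z by exact: (@normRe_le _ z).
have [_ hT] := @Im_cauchyT_le z y0.
have TB : cmod (T z) <= B.
  by rewrite (le_trans hT)// ler_expR lerD2l lef_pV2 ?posrE ?normr_gt0// (lt_le_trans _ zt)// normr_gt0.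
by rewrite mulrAC ler_pdivrMr// ler_pM2l.
Qed.

Lemma no_atom (t : R) : mu [set t] = 0%E.
Proof.
have mt : measurable ([set t] : set (measurableTypeR R)) by exact: measurable_set1.
apply/eqP; rewrite eq_le measure_ge0 andbT.
apply/lee_addgt0Pr => e e0; rewrite add0e.
have [y y0 hy] := small_yT t e0.
have [hI _] := @Im_cauchyT_le (t +i* y) y0.
have h : ((y^-1)%:E * mu [set t] <= (complex.Im (cauchyT mu L (t +i* y)))%:E)%E.
  rewrite Im_cauchyT// -integral_cst//.
  have mp := measurable_poisson2 y t.
  apply: (@le_trans _ _ (\int[mu]_(s in [set t]) (poisson y t s)%:E)%E).
    apply: ge0_le_integral => //.
    - by move=> x _; rewrite lee_fin invr_ge0 ltW.
    - by apply/measurable_EFinP; exact: measurable_funTS.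
    - move=> x ->; rewrite lee_fin /poisson subrr expr0n add0r expr2 invfM mulrA.
      by rewrite mulfV ?gt_eqF// mul1r.
  apply: ge0_subset_integral => //; first exact/measurable_EFinP.
  by move=> x _; rewrite lee_fin poisson_ge0.
have -> : (mu [set t] = y%:E * ((y^-1)%:E * mu [set t]))%E.
  by rewrite muleA -EFinM mulfV ?gt_eqF// mul1e.
apply: (@le_trans _ _ (y%:E * (complex.Im (cauchyT mu L (t +i* y)))%:E)%E).
  by rewrite lee_wpmul2l// lee_fin ltW.
by rewrite -EFinM lee_fin (le_trans _ hy)// ler_wpM2l// ltW.
Qed.

Variable f0 : R -> R.
Hypothesis f0_lim : forall x, x != 0 -> forall e : R, 0 < e -> exists2 d : R, 0 < d &
  forall z, 0 < complex.Im z -> cmod (z - x%:C) < d ->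
    `|complex.Im (cauchyT mu L z) / pi - f0 x| < e.
Hypothesis f0_cont : forall x, x != 0 -> {for x, continuous f0}.

Lemma measurable_f0 : measurable_fun [set: R] f0.
Proof.
rewrite -(setvU [set 0 : R]); apply/measurable_funU => //; first exact: measurableC.
split; last exact: measurable_fun_set1.
apply: open_continuous_measurable_fun.
  by apply: closed_openC; exact: closed_eq.
by move=> x; rewrite inE /= => /eqP; exact: f0_cont.
Qed.

Let y_ (n : nat) : R := n.+1%:R^-1.
Let y_gt0 n : 0 < y_ n. Proof. by rewrite invr_gt0 ltr0n. Qed.

Lemma cmod_Im_shift (x y : R) : 0 <= y -> cmod ((x +i* y : C R) - x%:C) = y.
Proof.
move=> y0; have -> : (x +i* y : C R) - x%:C = y%:C * 'i%C.
  by apply: complexP; rewrite ?(ReD, ReN, ImD, ImN, ReM, ImM) /=; ring.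
by rewrite cmodM cmod_real [cmod 'i%C]cmodE /= expr0n expr1n add0r sqrtr1 mulr1 ger0_norm.
Qed.

(** Dominated convergence: at distance at least d from 0, Im T is bounded by the constant e^(1 + 1 /
    d). *)
Lemma inversion_lhs (a b : R) : a < b -> 0 < a \/ b < 0 ->
  (\int[lebesgue_measure]_(x in `[a, b]) (complex.Im (cauchyT mu L (x +i* y_ n)))%:E)%E
   @[n --> \oo] --> (\int[lebesgue_measure]_(x in `[a, b]) (pi * f0 x)%:E)%E.
Proof.
move=> ab ab0; pose d := Num.min `|a| `|b|.
have d0 : 0 < d by rewrite lt_min !normr_gt0; case: ab0 => h; apply/andP; split; lra.
have xd x : x \in `[a, b] -> d <= `|x|.
  rewrite in_itv /= => /andP[ax xb]; rewrite /d ge_min.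
  case: ab0 => h.
    by rewrite gtr0_norm ?(ger0_norm (le_trans (ltW h) ax)) ?ax.
  by rewrite orbC ltr0_norm// ler0_norm ?lerN2 ?xb// (le_trans xb)// ltW.
pose B := expR (1 + d^-1).
have mI : measurable (`[a, b]%classic : set (measurableTypeR R)) by exact: measurable_itv.
have xn0 x : `[a, b]%classic x -> x != 0.
  by move=> /xd dx; rewrite -normr_gt0 (lt_le_trans d0).
have B0 : 0 < B by exact: expR_gt0.
have mIm n : measurable_fun [set: measurableTypeR R] (fun x => (complex.Im (cauchyT mu L (x +i* y_ n)))%:E).
  have -> : (fun x => (complex.Im (cauchyT mu L (x +i* y_ n)))%:E) =
      (fun x => \int[mu]_t (poisson (y_ n) x t)%:E)%E.
    by apply/funext => x; rewrite Im_cauchyT.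
  apply: (@measurable_fun_fubini_tonelli_F _ _ _ _ _ mu (fun p => (poisson (y_ n) p.1 p.2)%:E)).
    by apply/measurable_EFinP; exact: measurable_poisson.
  by move=> p; rewrite lee_fin poisson_ge0.
have [] := @dominated_convergence _ _ _ (@lebesgue_measure R) `[a, b]%classic mI
  (fun n x => (complex.Im (cauchyT mu L (x +i* y_ n)))%:E) (fun x => (pi * f0 x)%:E) (cst B%:E).
- by move=> n; apply: measurable_funTS; exact: mIm.
- apply: measurable_funTS; apply/measurable_EFinP.
  by apply: measurable_funM; [exact: measurable_cst|exact: measurable_f0].
- apply: aeW => x xI; have x0 := xn0 x xI.
  apply: cvg_EFin; first exact: nearW.
  apply/cvgrPdist_lt => e e0.
  have [dd dd0 hdd] := f0_lim x0 (divr_gt0 e0 (pi_gt0 R)).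
  have : y_ n @[n --> \oo] --> 0 by exact: cvg_harmonic.
  move=> /cvgrPdist_lt /(_ _ dd0); apply: filterS => n.
  rewrite sub0r normrN gtr0_norm// => yn /=.
  have := hdd (x +i* y_ n) (y_gt0 n); rewrite cmod_Im_shift ?(ltW (y_gt0 n))// => /(_ yn).
  rewrite ltr_pdivlMr ?pi_gt0// -[X in _ * X](@gtr0_norm _ pi) ?pi_gt0// -normrM mulrBl.
  by rewrite divfK ?gt_eqF ?pi_gt0// distrC [f0 x * _]mulrC.
- apply/integrableP; split; first exact: measurable_cst.
  rewrite integral_cst//= lebesgue_measure_itv /= lte_fin ab -EFinD -EFinM ltry //.
- apply: aeW => x n xI; rewrite lee_fin.
  have [hI hT] := @Im_cauchyT_le (x +i* y_ n) (y_gt0 n).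
  rewrite ger0_norm; last by rewrite -lee_fin Im_cauchyT// integral_ge0// => t _; rewrite lee_fin poisson_ge0.
  rewrite (le_trans hI)// (le_trans hT)// ler_expR lerD2l lef_pV2 ?posrE//.
    by rewrite (le_trans (xd _ xI))// (@normRe_le _ (x +i* y_ n)).
  by rewrite (lt_le_trans d0)// (le_trans (xd _ xI))// (@normRe_le _ (x +i* y_ n)).
- by move=> _ _.
Qed.

End Inversion.

(** * From intervals to a density *)

Section Density.
Context {R : realType}.
Variables (mu : probability (measurableTypeR R) R) (f : R -> R).
Hypothesis f_ge0 : forall x, 0 <= f x.
Hypothesis mf : measurable_fun [set: measurableTypeR R] (f : measurableTypeR R -> R).
Hypothesis mu0 : mu [set 0] = 0%E.
Hypothesis mu_itv : forall a b : R, a < b -> 0 < a \/ b < 0 ->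
  mu `]a, b]%classic = (\int[lebesgue_measure]_(x in `]a, b]) (f x)%:E)%E.

(** The hypothesis reaches only intervals that avoid 0. Continuity from below extends it to ]a, b]
    with a >= 0 and to ]a, 0[; neither measure charges 0, so they agree on all half-open intervals,
    a generating class stable under intersection. *)
Lemma is_density_itv : is_density mu f.
Proof.
split => //.
pose nu0 (A : set (measurableTypeR R)) := (\int[lebesgue_measure]_(x in A) (f x)%:E)%E.
have nu00 : nu0 set0 = 0%E by rewrite /nu0 integral_set0.
have nu0_ge0 A : (0 <= nu0 A)%E by apply: integral_ge0 => x _; rewrite lee_fin.
have nu0_sa : semi_sigma_additive nu0.
  move=> F mF tF mUF; rewrite /nu0; apply: cvg_toP.
    apply: ereal_nondecreasing_is_cvgn => m n mn.
    by apply: lee_sum_nneg_natr => // k _ _; exact: nu0_ge0.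
  rewrite ge0_integral_bigcup//=.
    by apply: measurable_funTS; exact/measurable_EFinP.
  by move=> x _; rewrite lee_fin.
pose nu : {measure set (measurableTypeR R) -> \bar R} :=
  HB.pack nu0 (isMeasure.Build _ _ _ nu0 nu00 nu0_ge0 nu0_sa).
have nu_itv a b : 0 < a \/ b < 0 -> mu `]a, b]%classic = nu `]a, b]%classic.
  move=> ab0; have [ab|ba] := ltP a b; first exact: mu_itv.
  by rewrite set_itv_ge ?bnd_simp -?leNgt// !measure0.
have nu_set0 : nu [set 0] = 0%E.
  exact: integral_set1.
have shrink (F : nat -> set (measurableTypeR R)) A : A = \bigcup_n F n ->
    (forall n, measurable (F n)) -> nondecreasing_seq F ->
    (forall n, mu (F n) = nu (F n)) -> mu A = nu A.
  move=> -> mF ndF E.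
  have mU : measurable (\bigcup_n F n) by exact: bigcupT_measurable.
  have h1 := nondecreasing_cvg_mu (mu := mu) mF mU ndF.
  have h2 := nondecreasing_cvg_mu (mu := nu) mF mU ndF.
  have EE : mu \o F = nu \o F by apply/funext => n /=; rewrite E.
  move: h1; rewrite EE => h1.
  by apply: cvg_unique h1 h2 => //; exact: ereal_hausdorff.
have pos a b : 0 <= a -> mu `]a, b]%classic = nu `]a, b]%classic.
  move=> a0; apply: (@shrink (fun n => `](a + n.+1%:R^-1), b]%classic)).
  - apply/seteqP; split => x /=.
      rewrite in_itv /= => /andP[ax xb].
      have [n hn] := ltr_add_invr ax.
      by exists n => //=; rewrite in_itv /= hn.
    move=> [n _] /=; rewrite !in_itv /= => /andP[ax ->]; rewrite andbT.
    by rewrite (lt_trans _ ax)// ltrDl invr_gt0.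
  - by move=> n; exact: measurable_itv.
  - move=> m n mn; apply/subsetPset => x /=; rewrite !in_itv /= => /andP[ax ->]; rewrite andbT.
    by rewrite (le_lt_trans _ ax)// lerD2l lef_pV2 ?posrE// ler_nat.
  - by move=> n; apply: nu_itv; left; rewrite ltr_wpDl.
have neg a : mu `]a, 0[%classic = nu `]a, 0[%classic.
  apply: (@shrink (fun n => `]a, - n.+1%:R^-1]%classic)).
  - apply/seteqP; split => x /=.
      rewrite in_itv /= => /andP[ax x0].
      have /ltr_add_invr[n hn] : x < 0 by [].
      by exists n => //=; rewrite in_itv /= ax /= -subr_le0 opprK ltW.
    move=> [n _] /=; rewrite !in_itv /= => /andP[-> xb] /=.
    by rewrite (le_lt_trans xb)// oppr_lt0 invr_gt0.
  - by move=> n; exact: measurable_itv.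
  - move=> m n mn; apply/subsetPset => x /=; rewrite !in_itv /= => /andP[-> xb] /=.
    by rewrite (le_trans xb)// lerN2 lef_pV2 ?posrE// ler_nat.
  - by move=> n; apply: nu_itv; right; rewrite oppr_lt0 invr_gt0.
have all_itv a b : mu `]a, b]%classic = nu `]a, b]%classic.
  have [a0|a0] := leP 0 a; first exact: pos.
  have [b0|b0] := ltP b 0; first by apply: nu_itv; right.
  have -> : `]a, b]%classic = `]a, 0[%classic `|` ([set 0] `|` `]0, b]%classic) :> set R.
    apply/seteqP; split => x /=; rewrite !in_itv /=.
      move=> /andP[ax xb]; have [x0|x0|x0] := ltgtP x 0.
      - by left; rewrite ax.
      - by right; right; rewrite xb.
      - by right; left.
    move=> [/andP[-> x0]|[->|/andP[x0 ->]]] /=; rewrite ?a0 ?b0//.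
      by rewrite (le_trans (ltW x0)).
    by rewrite (lt_trans a0).
  have m1 : measurable (`]a, 0[%classic : set (measurableTypeR R)) by exact: measurable_itv.
  have m2 : measurable ([set 0] : set (measurableTypeR R)) by exact: measurable_set1.
  have m3 : measurable (`]0, b]%classic : set (measurableTypeR R)) by exact: measurable_itv.
  have d2 : [set 0] `&` `]0, b]%classic = set0 :> set R.
    by apply/seteqP; split => x //= -[->]; rewrite in_itv /= ltxx.
  have d1 : `]a, 0[%classic `&` ([set 0] `|` `]0, b]%classic) = set0 :> set R.
    apply/seteqP; split => x //= -[]; rewrite !in_itv /= => /andP[_ x0] [xE|/andP[x0' _]].
      by rewrite xE ltxx in x0.
    by have := lt_trans x0 x0'; rewrite ltxx.
  rewrite !measureU//; try exact: measurableU.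
  congr (_ + (_ + _))%E; [exact: neg | exact: etrans mu0 (esym nu_set0) | exact: pos].
move=> A mA; rewrite -[RHS]/(nu A).
apply: (@measure_unique _ _ (measurableTypeR R) (@ocitv R) (fun n => `](- n%:R), n%:R]%classic)) => //.
- exact: ocitvI.
- by move=> n; exact: is_ocitv.
- exact: bigcup_itvT.
- by move=> _ [[a b] _ <-]; exact: all_itv.
- move=> n; rewrite (le_lt_trans (probability_le1 _ _))// ?ltry//.
Qed.

End Density.

Section InversionFormula.
Context {R : realType}.
Variables (mu : probability (measurableTypeR R) R) (L : R).
Hypothesis L0 : 0 < L.
Hypothesis mu_supp : mu [set x : R | (L < `|x|)%R] = 0%E.
Hypothesis mu_moments : has_moments mu (fun k => (k ^ k)%N%:R / (k.+1)`!%N%:R).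

Let y_ (n : nat) : R := n.+1%:R^-1.
Let y_gt0 n : 0 < y_ n. Proof. by rewrite invr_gt0 ltr0n. Qed.

Lemma cvg_atan_harmonic (s : R) : s != 0 ->
  atan (s / y_ n) @[n --> \oo] --> (if 0 < s then pi / 2 else - (pi / 2)).
Proof.
have pos (u : R) : 0 < u -> atan (u / y_ n) @[n --> \oo] --> pi / 2.
  move=> u0; have h : u / y_ n @[n --> \oo] --> +oo.
    have -> : (fun n => u / y_ n) = (fun n => u * n.+1%:R) by apply/funext => n; rewrite /y_ invrK.
    apply: (cvg_comp _ _ _ (gt0_cvgMry u0 cvg_id)).
    by have := (@cvgr_idn R); rewrite -(cvg_shiftS (fun n => n%:R : R)).
  by apply: (cvg_comp _ _ h); exact: cvgy_atan.
move=> s0; have [sp|sn] := ltP 0 s; first exact: pos.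
have sn' : 0 < - s by rewrite oppr_gt0 lt_neqAle s0.
have -> : (fun n => atan (s / y_ n)) = (fun n => - atan (- s / y_ n)).
  by apply/funext => n; rewrite mulNr atanN opprK.
by apply: cvgN; exact: pos.
Qed.

(** The difference of arctangents tends to pi on ]a, b[ and to 0 outside [a, b]. At the two end
    points it tends to pi / 2, which does not matter since they carry no mass. *)
Lemma inversion_rhs (a b : R) : a < b ->
  (\int[mu]_t (atan ((b - t) / y_ n) - atan ((a - t) / y_ n))%:E)%E
   @[n --> \oo] --> (pi%:E * mu `]a, b]%classic)%E.
Proof.
move=> ab.
have mI : measurable (`]a, b]%classic : set (measurableTypeR R)) by exact: measurable_itv.
have mat (c : R) n : measurable_fun [set: measurableTypeR R] (fun t => atan ((c - t) / y_ n)).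
  apply: (measurableT_comp (continuous_measurable_fun (@continuous_atan R))).
  by apply: measurable_funM => //; exact: measurable_funB.
have -> : (pi%:E * mu `]a, b]%classic =
    \int[mu]_t (pi * \1_(`]a, b]%classic : set (measurableTypeR R)) t)%:E)%E.
  under eq_integral do rewrite EFinM.
  by rewrite integralZl//= ?integral_indic ?setIT//; exact: integrable_indic.
have [] := @dominated_convergence _ _ _ mu setT measurableT
  (fun n t => (atan ((b - t) / y_ n) - atan ((a - t) / y_ n))%:E)
  (fun t => (pi * \1_(`]a, b]%classic : set (measurableTypeR R)) t)%:E) (cst pi%:E).
- by move=> n; apply/measurable_EFinP; exact: measurable_funB; apply: mat.
- by apply/measurable_EFinP; exact: measurable_funM.
- exists ([set a] `|` [set b]); split.
  + by apply: measurableU; exact: measurable_set1.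
  + by apply: null_set_setU; [exact: measurable_set1|exact: measurable_set1|
      exact: (no_atom L0 mu_supp mu_moments)|exact: (no_atom L0 mu_supp mu_moments)].
  move=> t /= ht; apply: contrapT => /not_orP[ta tb]; apply: ht => _.
  apply: cvg_EFin; first exact: nearW.
  have ta0 : a - t != 0 by rewrite subr_eq0 eq_sym; exact/eqP.
  have tb0 : b - t != 0 by rewrite subr_eq0 eq_sym; exact/eqP.
  have := cvgB (cvg_atan_harmonic tb0) (cvg_atan_harmonic ta0) => /(_ _).
  rewrite !subr_gt0 indicE mem_setE in_itv /=.
  suff -> : (if t < b then pi / 2 else - (pi / 2)) - (if t < a then pi / 2 else - (pi / 2)) =
     pi * (a < t <= b)%R%:R :> R by apply.
  have [ta'|ta'|ta'] := ltgtP t a; last by rewrite ta' in ta.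
    by rewrite (lt_trans ta' ab) /= subrr mulr0.
  have [tb'|tb'|tb'] := ltgtP t b; last by rewrite tb' in tb.
    by rewrite opprK -splitr mulr1.
  by rewrite mulr0 subrr.
- by apply/integrableP; split => //; rewrite integral_cst//= probability_setT mule1 ltry.
- apply: aeW => t n _; rewrite lee_fin (le_trans (ler_normB _ _))//.
  have h (u : R) : `|atan u| <= pi / 2.
    by rewrite ler_norml !ltW ?atan_ltpi2 ?atan_gtNpi2.
  by rewrite (le_trans (lerD (h _) (h _)))// -splitr.
- by move=> _ _; apply.
Qed.

Variable f0 : R -> R.
Hypothesis f0_ge0 : forall x, 0 <= f0 x.
Hypothesis f0_lim : forall x, x != 0 -> forall e : R, 0 < e -> exists2 d : R, 0 < d &
  forall z, 0 < complex.Im z -> cmod (z - x%:C) < d ->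
    `|complex.Im (cauchyT mu L z) / pi - f0 x| < e.
Hypothesis f0_cont : forall x, x != 0 -> {for x, continuous f0}.

Lemma stieltjes_inversion (a b : R) : a < b -> 0 < a \/ b < 0 ->
  mu `]a, b]%classic = (\int[lebesgue_measure]_(x in `]a, b]) (f0 x)%:E)%E.
Proof.
move=> ab ab0; have mf := measurable_f0 f0_cont.
have h1 := inversion_lhs L0 mu_supp mu_moments f0_lim f0_cont ab ab0.
have h2 := inversion_rhs ab.
have E : (pi%:E * mu `]a, b]%classic = \int[lebesgue_measure]_(x in `[a, b]) (pi * f0 x)%:E)%E.
  apply: cvg_unique h2 _; first exact: ereal_hausdorff.
  apply: cvg_trans h1; apply: near_eq_cvg; apply: nearW => n.
  by rewrite (integral_Im_cauchyT mu_supp).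
have mI : measurable (`[a, b]%classic : set (measurableTypeR R)) by exact: measurable_itv.
move: E; under eq_integral do rewrite EFinM.
rewrite ge0_integralZl//; last 3 first.
- by apply: measurable_funTS; exact/measurable_EFinP.
- by move=> x _; rewrite lee_fin.
- by rewrite lee_fin pi_ge0.
move=> /(congr1 (fun u => (pi^-1)%:E * u)%E).
rewrite !muleA -!EFinM mulVf ?gt_eqF ?pi_gt0// !mul1e => ->.
rewrite integral_itv_obnd_cbnd//.
by apply: measurable_funTS; exact/measurable_EFinP.
Qed.

End InversionFormula.

(** * Support of a measure with a density positive exactly on an interval *)

Section Support.
Context {R : realType}.
Variables (mu : probability (measurableTypeR R) R) (f : R -> R) (a b : R).
Hypothesis ab : a < b.
Hypothesis mu_f : is_density mu f.
Hypothesis f_gt0 : forall x, (0 < f x) = (a < x < b).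
Hypothesis f_cont : forall x, a < x < b -> {for x, continuous f}.

Lemma msupport_density : msupport mu = `[a, b]%classic.
Proof.
have [f_ge0 mf muE] := mu_f.
apply/seteqP; split => x /=; last first.
  rewrite in_itv /= => /andP[ax xb] U oU Ux.
  have : nbhs x U by exact: open_nbhs_nbhs.
  move=> /nbhs_ballP[r /= r0 rU].
  (* x may be an end point of [a, b]; a shift by dl towards the midpoint stays in U and lands in the
     open interval, where the density is positive. *)
  pose dl := Num.min r (b - a) / 4.
  have m0 : 0 < Num.min r (b - a) by rewrite lt_min r0 subr_gt0.
  have dr : dl < r by rewrite /dl; have := ge_min r r (b - a); rewrite lexx => /= h; lra.
  have db : 4 * dl <= b - a.
    by rewrite /dl mulrC divfK// ge_min lexx orbT.
  have d0 : 0 < dl by rewrite divr_gt0.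
  have [y Uy yab] : exists2 y, U y & a < y < b.
    have [xm|xm] := leP x ((a + b) / 2).
      exists (x + dl); last by apply/andP; split; lra.
      by apply: rU; rewrite /ball /= opprD addrA subrr sub0r normrN gtr0_norm.
    exists (x - dl); last by apply/andP; split; lra.
    by apply: rU; rewrite /ball /= opprB addrC subrK gtr0_norm.
  have fy : 0 < f y by rewrite f_gt0.
  have : nbhs y U by exact: open_nbhs_nbhs.
  move=> /nbhs_ballP[s1 /= s10 s1U].
  have /cvgrPdist_lt/(_ _ (divr_gt0 fy (ltr0n _ 2))) := f_cont yab.
  move=> /nbhs_ballP[s2 /= s20 s2f].
  pose s := Num.min s1 s2; have s0 : 0 < s by rewrite lt_min s10.
  pose I : set (measurableTypeR R) := `]y - s, y + s[%classic.
  have mI : measurable I by exact: measurable_itv.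
  have mU : measurable (U : set (measurableTypeR R)) by exact: open_measurable.
  have Ib t : I t -> ball y s t.
    by rewrite /I /= in_itv /= => ?; rewrite /ball /= distrC ltr_norml; apply/andP; split; lra.
  have IU : I `<=` U.
    by move=> t /Ib; rewrite /ball /= lt_min => /andP[h _]; apply: s1U.
  apply: (@lt_le_trans _ _ (mu I)); last by apply: le_measure; rewrite ?inE.
  rewrite muE//; apply: (@lt_le_trans _ _ (\int[lebesgue_measure]_(t in I) (f y / 2)%:E)%E).
    rewrite integral_cst//= lebesgue_measure_itv /= lte_fin ltrD2l gtrN// -EFinD -EFinM lte_fin.
    by rewrite mulr_gt0// ?divr_gt0//; lra.
  apply: ge0_le_integral => //.
  - by move=> t _; rewrite lee_fin divr_ge0// ltW.
  - by apply: measurable_funTS; exact/measurable_EFinP.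
  - move=> t /Ib; rewrite /ball /= lt_min => /andP[_ h].
    have := s2f t h; rewrite /= lee_fin ltr_norml => /andP[_ h2]; lra.
move=> sx; apply: contrapT => xab.
pose U : set R := ~` `[a, b]%classic.
have oU : open U by apply: closed_openC; exact: itv_closed.
have mU : measurable (U : set (measurableTypeR R)) by exact: open_measurable.
have := sx U oU xab; rewrite (muE _ mU).
rewrite integral0_eq ?ltxx// => t Ut; congr EFin; apply/eqP.
rewrite eq_le f_ge0 andbT leNgt f_gt0; apply/negP => /andP[at_ tb]; apply: Ut.
by rewrite /= in_itv /= !ltW.
Qed.

End Support.

Section DensityOfMoments.
Context {R : realType}.
Variables (mu : probability (measurableTypeR R) R) (L : R).
Hypothesis L0 : 0 < L.
Hypothesis mu_supp : mu [set x : R | (L < `|x|)%R] = 0%E.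
Hypothesis mu_moments : has_moments mu (fun k => (k ^ k)%N%:R / (k.+1)`!%N%:R).

Lemma density_support :
  (exists f0 : R -> R,
     is_density mu f0 /\ (forall x : R, x != 0 -> {for x, continuous f0}))
  /\ msupport mu = `[0, expR 1]%classic.
Proof.
have [f [f0 f_ge0 f_gt0 f_lim f_cont]] := exists_boundary_density L0 mu_supp mu_moments.
have df : is_density mu f.
  apply: is_density_itv => //.
  - exact: measurable_f0.
  - exact: (no_atom L0 mu_supp mu_moments).
  - by move=> a b; apply: (stieltjes_inversion L0 mu_supp mu_moments).
split; first by exists f.
apply: (msupport_density _ df f_gt0); first exact: expR_gt0.
by move=> x /andP[x0 _]; apply: f_cont; rewrite gt_eqF.
Qed.

End DensityOfMoments.

(** * Principal logarithm *)

Section PrincipalLog.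
Context {R : realType}.
Implicit Types (v w p h : C R) (t : R).

(** The principal logarithm on the right half-plane, in a form whose components are differentiable;
    [clog] goes through [acos] and a case distinction on the sign of Im v. *)
Definition plog v : C R :=
  (ln (complex.Re v ^+ 2 + complex.Im v ^+ 2) / 2) +i* atan (complex.Im v / complex.Re v).

Lemma cos_atan_Re v : 0 < complex.Re v ->
  cos (atan (complex.Im v / complex.Re v)) = complex.Re v / cmod v.
Proof.
move=> v0; have c0 : 0 < cmod v by rewrite (lt_le_trans v0)// (le_trans (ler_norm _))// normRe_le.
have E : 1 + (complex.Im v / complex.Re v) ^+ 2 = (cmod v / complex.Re v) ^+ 2.
  rewrite [RHS]expr_div_n cmodE sqr_sqrtr ?addr_ge0 ?sqr_ge0//.
  by field; rewrite gt_eqF.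
by rewrite cos_atan E sqrtr_sqr ger0_norm ?divr_ge0 ?ltW// invf_div.
Qed.

Lemma clogE v : 0 < complex.Re v -> clog v = plog v.
Proof.
move=> v0; have c0 : 0 < cmod v by rewrite (lt_le_trans v0)// (le_trans (ler_norm _))// normRe_le.
rewrite /clog /plog; congr (_ +i* _).
  have -> : complex.Re v ^+ 2 + complex.Im v ^+ 2 = cmod v ^+ 2.
    by rewrite cmodE sqr_sqrtr ?addr_ge0 ?sqr_ge0.
  by rewrite lnXn// mulr2n; field.
rewrite /carg -cos_atan_Re//.
have := atan_ltpi2 (complex.Im v / complex.Re v); have := atan_gtNpi2 (complex.Im v / complex.Re v).
have := pi_gt0 R; have [i0|i0] := leP 0 (complex.Im v).
  move=> pi0 h1 h2; rewrite cosK// in_itv /= ; apply/andP; split; last lra.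
  by rewrite -atan0 le_atan// divr_ge0// ltW.
move=> pi0 h1 h2; rewrite cosKN ?opprK//; apply/andP; split; first lra.
by rewrite -atan0 le_atan// mulr_le0_ge0 ?invr_ge0// ltW.
Qed.

Lemma cexp_clog v : 0 < complex.Re v -> cexp (clog v) = v.
Proof.
move=> v0; have c0 : 0 < cmod v by rewrite (lt_le_trans v0)// (le_trans (ler_norm _))// normRe_le.
have cE := cos_atan_Re v0; rewrite /cexp; have -> : complex.Re (clog v) = ln (cmod v) by [].
rewrite lnK// clogE//= sin_atan cE.
apply: complexP => /=; first by rewrite mulrC divfK// gt_eqF.
by field; rewrite !gt_eqF.
Qed.

Lemma clog_cexp w : - (pi / 2) < complex.Im w < pi / 2 -> clog (cexp w) = w.
Proof.
move=> iw; have c0 : 0 < cos (complex.Im w) by apply: cos_gt0_pihalf.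
rewrite clogE ?mulr_gt0 ?expR_gt0//; apply: complexP => /=.
  by rewrite !exprMn -mulrDr cos2Dsin2 mulr1 lnXn ?expR_gt0// expRK mulr2n; field.
rewrite -[RHS]tanK//; congr atan.
by rewrite /tan; field; rewrite !gt_eqF// expR_gt0.
Qed.

Lemma cder_plog (f : R -> C R) t d : 0 < complex.Re (f t) -> cder f t d ->
  cder (fun s => plog (f s)) t (d / f t).
Proof.
move=> f0 [f1 f2].
pose n s := complex.Re (f s) ^+ 2 + complex.Im (f s) ^+ 2.
have c2 : cmod (f t) ^+ 2 = n t by rewrite cmodE sqr_sqrtr ?addr_ge0 ?sqr_ge0.
have n0 : 0 < n t by rewrite ltr_wpDr ?sqr_ge0// exprn_gt0.
have dn : is_derive t 1 n (2 * (complex.Re (f t) * complex.Re d + complex.Im (f t) * complex.Im d)).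
  by apply: is_derive_eq; rewrite -![_ *: _]/(_ * _); ring.
have dln := is_derive1_comp (is_derive1_ln n0) dn.
split; rewrite ?ReM ?ImM ReV ImV c2 /=.
  have -> : (fun s => ln (complex.Re (f s) ^+ 2 + complex.Im (f s) ^+ 2) / 2) =
    (fun s => 2^-1 * (@ln R \o n) s) by apply/funext => s; rewrite mulrC.
  apply: is_derive_eq; rewrite -![_ *: _]/(_ * _); field.
  by rewrite gt_eqF.
have f0' : complex.Re (f t) != 0 by rewrite gt_eqF.
have dV : is_derive t 1 (fun s => (complex.Re (f s))^-1) (- complex.Re (f t) ^- 2 *: complex.Re d).
  exact: is_deriveV.
pose g s := complex.Im (f s) / complex.Re (f s).
have dq : is_derive t 1 g
   ((complex.Im d * complex.Re (f t) - complex.Im (f t) * complex.Re d) / complex.Re (f t) ^+ 2).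
  by apply: is_derive_eq; rewrite -![_ *: _]/(_ * _); field.
have h := @is_derive1_comp _ atan g t _ _ (is_derive1_atan _) dq.
apply: is_derive_eq h _; rewrite /n /g in n0 *.
have n1 : complex.Re (f t) ^+ 2 + complex.Im (f t) ^+ 2 != 0 by rewrite gt_eqF.
by field; rewrite f0' n1.
Qed.

(** Mean value inequality applied to each component, hence the factor 2. *)
Lemma cder_bound (f d : R -> C R) (K : R) :
  (forall t, 0 <= t <= 1 -> cder f t (d t)) -> (forall t, 0 <= t <= 1 -> cmod (d t) <= K) ->
  cmod (f 1 - f 0) <= 2 * K.
Proof.
move=> fd dK.
have mvt (g dg : R -> R) : (forall t, 0 <= t <= 1 -> is_derive t 1 g (dg t)) ->
    (forall t, 0 <= t <= 1 -> `|dg t| <= K) -> `|g 1 - g 0| <= K.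
  move=> gd gK; have [||c c01 ->] := @MVT_segment _ g dg 0 1 ler01.
  - by move=> x; rewrite in_itv /= => /andP[/ltW x0 /ltW x1]; apply: gd; rewrite x0.
  - apply: derivable_within_continuous => x; rewrite in_itv /= => x01.
    by have := gd _ x01 => h; exact: ex_derive.
  - by rewrite subr0 mulr1 gK//; move: c01; rewrite in_itv.
rewrite (le_trans (cmod_le_ReIm _))// mulr2n mulrDl !mul1r.
rewrite !(ReD, ImD, ReN, ImN); apply: lerD.
  apply: (mvt (fun t => complex.Re (f t)) (fun t => complex.Re (d t))) => t t01.
    by have [] := fd t t01.
  by rewrite (le_trans (normRe_le _))// dK.
apply: (mvt (fun t => complex.Im (f t)) (fun t => complex.Im (d t))) => t t01.
  by have [] := fd t t01.
by rewrite (le_trans (normIm_le _))// dK.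
Qed.

Lemma cder_line h t : cder (fun s => s%:C * h) t h.
Proof.
split; under eq_fun do rewrite ?ReM ?ImM /=.
  by apply: is_derive_eq; rewrite -![_ *: _]/(_ * _); ring.
by apply: is_derive_eq; rewrite -![_ *: _]/(_ * _); ring.
Qed.

Lemma cderX f t d n : cder f t d -> cder (fun s => f s ^+ n.+1) t (n.+1%:R * d * f t ^+ n).
Proof.
move=> fd; elim: n => [|n IH].
  by under eq_fun do rewrite expr1; rewrite mul1r expr0 mulr1.
under eq_fun do rewrite exprS.
apply: cder_eq (cderM fd IH) _.
by rewrite -[n.+2%:R]natr1 exprS; ring.
Qed.

(** Taylor coefficients of h |-> log (p - h); with - h in place of h the signs do not alternate. *)
Definition log_coef p n : C R := if n is k.+1 then - (p ^+ k.+1 * k.+1%:R)^-1 else clog p.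

(** The derivative of the remainder remains a single term: subtracting one more Taylor term
    multiplies it by t h / p. *)
Lemma cder_log_rem p h t n : p != 0 -> 0 < complex.Re (p - t%:C * h) ->
  cder (fun s => plog (p - s%:C * h) - psum (log_coef p) (s%:C * h) n.+1) t
    (- h * (t%:C * h / p) ^+ n / (p - t%:C * h)).
Proof.
move=> p0 rp.
have q0 : p - t%:C * h != 0 by apply/eqP => q0; move: rp; rewrite q0 ltxx.
have dline : cder (fun s => p - s%:C * h) t (- h).
  apply: (@cder_eq _ _ t (0 + - 1 * h)); last by rewrite add0r mulN1r.
  apply: cderD; first exact: cder_cst.
  under eq_fun do rewrite -mulN1r.
  apply: cder_eq (cderM (cder_cst (-1) t) (cder_line h t)) _.
  by rewrite mul0r add0r.
elim: n => [|n IH].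
  rewrite /psum; under eq_fun do rewrite big_ord1 expr0 mulr1.
  apply: cder_eq (cderD (cder_plog rp dline) (cder_cst _ t)) _.
  by rewrite addr0 expr0 mulr1.
have E s : plog (p - s%:C * h) - psum (log_coef p) (s%:C * h) n.+2 =
  plog (p - s%:C * h) - psum (log_coef p) (s%:C * h) n.+1 +
    (p ^+ n.+1 * n.+1%:R)^-1 * (s%:C * h) ^+ n.+1.
  rewrite {1}/psum big_ord_recr /= -/(psum (log_coef p) (s%:C * h) n.+1).
  by rewrite opprD mulNr opprK addrA.
under eq_fun do rewrite E.
have dterm := cderM (cder_cst ((p ^+ n.+1 * n.+1%:R)^-1) t) (cderX n (cder_line h t)).
apply: cder_eq (cderD IH dterm) _.
have alg (P N X u : C R) : P != 0 -> N != 0 -> p - u != 0 ->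
    - h * (X / P) / (p - u) + p^-1 / P / N * (N * h * X) = - h * (u / p * (X / P)) / (p - u).
  by move=> P0 N0 u0; field; rewrite N0 p0 u0 P0.
rewrite mul0r add0r !exprS invfM invfM !exprMn exprVn.
by apply: alg; rewrite ?expf_neq0 ?pnatr_eq0.
Qed.

(** On the segment from p to p - h the real part is at least e, so the derivative of the remainder
    is at most |h| q^n / e, and [cder_bound] makes the remainder tend to 0. *)
Lemma hasps_clog p : 0 < complex.Re p ->
  hasps (complex.Re p) (log_coef p) (fun h => clog (p - h)).
Proof.
move=> rp h hp.
have cp : cmod h < cmod p by rewrite (lt_le_trans hp)// (le_trans (ler_norm _))// normRe_le.
have p0 : p != 0 by rewrite -cmod_gt0 (le_lt_trans (cmod_ge0 _) cp).
have c0 : 0 < cmod p by rewrite cmod_gt0.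
pose e := complex.Re p - cmod h; have e0 : 0 < e by rewrite subr_gt0.
have rt t : 0 <= t <= 1 -> e <= complex.Re (p - t%:C * h).
  move=> /andP[t0 t1]; rewrite ReD ReN lerD2l lerN2 (le_trans (ler_norm _))// (le_trans (normRe_le _))//.
  by rewrite cmodM cmod_real ger0_norm// ler_piMl ?cmod_ge0.
pose q := cmod h / cmod p.
have q0 : 0 <= q by rewrite divr_ge0 ?cmod_ge0.
have q1 : q < 1 by rewrite ltr_pdivrMr// mul1r.
rewrite -(cvg_shiftS (psum (log_coef p) h)).
apply: (cvgC_squeeze (g := fun n => (2 * (cmod h / e)) * q ^+ n)); last first.
  by rewrite -[X in _ --> X](mulr0 (2 * (cmod h / e))); apply: cvgMl_tmp; exact: cvg_expr0.
apply: nearW => n /=.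
have := @cder_bound (fun t => plog (p - t%:C * h) - psum (log_coef p) (t%:C * h) n.+1)
  (fun t => - h * (t%:C * h / p) ^+ n / (p - t%:C * h)) (cmod h * q ^+ n / e).
rewrite !mul0r subr0 !mul1r -(clogE rp).
have -> : psum (log_coef p) 0 n.+1 = clog p.
  rewrite /psum big_ord_recl /= expr0 mulr1 big1 ?addr0// => i _.
  by rewrite /= expr0n /= mulr0.
rewrite subrr subr0 -clogE; last first.
  by have := rt 1; rewrite mul1r => /(_ _); rewrite lexx ler01 => /(_ isT); exact: lt_le_trans.
rewrite cmodBC => H; apply: le_trans (H _ _) _.
- by move=> t t01; apply: cder_log_rem => //; rewrite (lt_le_trans e0)// rt.
- move=> t t01; have re := rt t t01.
  have ce : e <= cmod (p - t%:C * h) by rewrite (le_trans re)// (le_trans (ler_norm _))// normRe_le.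
  rewrite cmodM cmodV [cmod (- h * _)]cmodM cmodN cmodX cmodM cmodV [cmod (t%:C * h)]cmodM cmod_real.
  have [t0 t1] : 0 <= t /\ t <= 1 by apply/andP.
  apply: ler_pM; rewrite ?(mulr_ge0, exprn_ge0, invr_ge0, cmod_ge0, normr_ge0)//.
    apply: ler_wpM2l; first exact: cmod_ge0.
    apply: lerXn2r; rewrite ?nnegrE ?divr_ge0 ?mulr_ge0 ?cmod_ge0//.
    by rewrite /q ler_wpM2r ?invr_ge0 ?cmod_ge0// ger0_norm// ler_piMl ?cmod_ge0.
  by rewrite lef_pV2 ?posrE// (lt_le_trans e0).
- by rewrite le_eqVlt; apply/orP; left; apply/eqP; ring.
Qed.

End PrincipalLog.

(** * R-transform *)

Section DiscIdentity.
Context {R : realType}.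
Implicit Types (f g D : C R -> C R) (z : C R).

Lemma analytic_onB (U : set (C R)) f g : analytic_on U f -> analytic_on U g ->
  analytic_on U (fun z => f z - g z).
Proof.
move=> fa ga; apply: hasps_analytic => z Uz.
have [r r0 [a ha]] := analytic_hasps fa Uz.
have [s s0 [b hb]] := analytic_hasps ga Uz.
exists (Num.min r s); first by rewrite lt_min r0.
exists (fun n => a n + - b n).
apply: hasps_add; first by apply: hasps_le ha; rewrite ge_min lexx.
by apply: hasps_opp; apply: hasps_le hb; rewrite ge_min lexx orbT.
Qed.

(** Continuation along the segment from 0 to z1. If tau is the supremum of the parameters up to
    which D vanishes, zeros accumulate at tau z1, so D vanishes on a disc around it and tau < 1 is
    impossible. *)
Lemma unit_disc_identity D (e : R) : analytic_on unit_disc D -> 0 < e ->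
  (forall z, cmod z < e -> D z = 0) -> forall z, cmod z < 1 -> D z = 0.
Proof.
move=> Da e0 De z1 z11; have [->|z10] := eqVneq z1 0; first by apply: De; rewrite cmod0.
have c1 : 0 < cmod z1 by rewrite cmod_gt0.
pose A := [set t : R | 0 <= t <= 1 /\ forall s, 0 <= s <= t -> D (s%:C * z1) = 0].
have disc s : 0 <= s <= 1 -> cmod (s%:C * z1) < 1.
  move=> /andP[s0 s1]; rewrite cmodM cmod_real ger0_norm// (le_lt_trans _ z11)//.
  by rewrite ler_piMl// ltW.
have A0 : A 0.
  split; first by rewrite lexx ler01.
  by move=> s /le_anti <-; apply: De; rewrite mul0r cmod0.
have hA : has_sup A.
  by split; [exists 0|exists 1 => t [/andP[]]].
pose tau := sup A.
have tau0 : 0 <= tau by apply: ub_le_sup => //; case: hA.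
have tau1 : tau <= 1 by apply: ge_sup; [exists 0|move=> t [/andP[]]].
have below s : 0 <= s -> s < tau -> D (s%:C * z1) = 0.
  move=> s0 st; have [t [_ At] t2] := sup_gt (proj1 hA) st.
  by apply: At; rewrite s0 ltW.
have tau01 : 0 <= tau <= 1 by rewrite tau0.
have [r r0 [a ha]] := analytic_hasps Da (disc tau tau01).
(* If tau = 0 the zeros come from the disc of radius e, otherwise from the part of the segment
   already covered. *)
have zeros : forall d : R, 0 < d -> exists u, [/\ u != 0, cmod u < d & D (tau%:C * z1 + u) = 0].
  move=> d d0; have [t0|t0] := eqVneq tau 0.
    pose x := Num.min d e / 2; have m0 : 0 < Num.min d e by rewrite lt_min d0.
    have x0 : 0 < x by rewrite divr_gt0.
    have xd : x < Num.min d e by rewrite /x; lra.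
    move: xd; rewrite lt_min => /andP[xd xe].
    exists (x%:C); rewrite cmod_real gtr0_norm//; split => //.
      by rewrite -cmod_gt0 cmod_real gtr0_norm.
    by apply: De; rewrite t0 mul0r add0r cmod_real gtr0_norm.
  have t0' : 0 < tau by rewrite lt_neqAle eq_sym t0.
  pose x := Num.min tau (d / cmod z1) / 2.
  have m0 : 0 < Num.min tau (d / cmod z1) by rewrite lt_min t0' divr_gt0.
  have x0 : 0 < x by rewrite divr_gt0.
  have : x < Num.min tau (d / cmod z1) by rewrite /x; lra.
  rewrite lt_min => /andP[xt]; rewrite ltr_pdivlMr// => xd.
  exists (- (x%:C * z1)); have cx : cmod (- (x%:C * z1)) = x * cmod z1.
    by rewrite cmodN cmodM cmod_real gtr0_norm.
  split; rewrite ?cx//; first by rewrite -cmod_gt0 cx mulr_gt0.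
  rewrite -mulrBl -rmorphB; apply: below; last by rewrite ltrBlDr ltrDl.
  by rewrite subr_ge0 ltW.
have idn := hasps_identity r0 ha zeros.
have upto s : 0 <= s -> (s - tau) * cmod z1 < r -> D (s%:C * z1) = 0.
  move=> s0 sr; have [st|st] := ltP s tau; first exact: below.
  have -> : s%:C * z1 = tau%:C * z1 + (s - tau)%:C * z1.
    by rewrite -mulrDl -rmorphD addrC subrK.
  by apply: idn; rewrite cmodM cmod_real ger0_norm// subr_ge0.
suff t1 : tau = 1 by rewrite -[z1]mul1r; apply: upto => //; rewrite t1 subrr mul0r.
apply/eqP; rewrite eq_le tau1 leNgt; apply/negP => t1.
pose y := Num.min (1 - tau) (r / cmod z1) / 2.
have m0 : 0 < Num.min (1 - tau) (r / cmod z1) by rewrite lt_min subr_gt0 t1 divr_gt0.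
have y0 : 0 < y by rewrite divr_gt0.
have : y < Num.min (1 - tau) (r / cmod z1) by rewrite /y; lra.
rewrite lt_min => /andP[yt]; rewrite ltr_pdivlMr// => yr.
have : tau + y <= tau.
  apply: ub_le_sup; first by case: hA.
  split; first by apply/andP; split; lra.
  move=> s /andP[s0 sy]; apply: upto => //.
  by rewrite (le_lt_trans _ yr)// ler_wpM2r ?cmod_ge0//; lra.
by rewrite gerDl leNgt y0.
Qed.

End DiscIdentity.

Section RFormula.
Context {R : realType}.
Implicit Types (z u w : C R).

(** Minus the reciprocal of the function K in the definition of the R-transform. *)
Definition log_inverse z : C R := (1 - z) * clog (1 - z).
Local Notation g := log_inverse.

Lemma Re_1B_gt0 z : cmod z < 1 -> 0 < complex.Re (1 - z).
Proof.
by move=> z1; rewrite ReD ReN /= subr_gt0 (le_lt_trans (ler_norm _))// (le_lt_trans (normRe_le _)).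
Qed.

Lemma clog1 : clog (1 : C R) = 0.
Proof.
rewrite -[in LHS]cexp0 clog_cexp//=; have := pi_gt0 R => pi0.
by apply/andP; split; lra.
Qed.

Lemma log_inverse_neq0 z : cmod z < 1 -> z != 0 -> g z != 0.
Proof.
move=> z1 z0; have E := cexp_clog (Re_1B_gt0 z1).
apply: mulf_neq0; first by rewrite -E cexp_neq0.
apply: contraNneq z0 => l0; move: E; rewrite l0 cexp0 => /esym/eqP.
by rewrite subr_eq addrC -subr_eq subrr eq_sym.
Qed.

Definition log_inverse_coef z : nat -> C R :=
  cauchy (fun n => (if n is 0 then 1 - z else 0) + - (n == 1)%:R) (log_coef (1 - z)).

Lemma hasps_log_inverse z : cmod z < 1 ->
  hasps (complex.Re (1 - z)) (log_inverse_coef z) (fun u => g (z + u)).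
Proof.
move=> z1; have := Re_1B_gt0 z1 => r0.
have h := hasps_mul (hasps_add (@hasps_cst R _ (1 - z)) (hasps_opp (@hasps_id R _)))
  (hasps_clog r0).
by apply: hasps_ext h => u _; rewrite /log_inverse opprD addrA.
Qed.

Lemma log_inverse_coef0 : log_inverse_coef 0 0 = 0.
Proof.
by rewrite /log_inverse_coef /cauchy big_ord1 /= !subr0 clog1 mulr0.
Qed.

Lemma log_inverse_coef1 : log_inverse_coef 0 1 = -1.
Proof.
rewrite /log_inverse_coef /cauchy big_ord_recl big_ord1 /= !subr0 clog1 mulr0 addr0.
by rewrite mul1r expr1n mul1r invr1.
Qed.

Lemma log_inverse_small (e : R) : 0 < e ->
  exists2 d : R, 0 < d & forall z, cmod z < d -> cmod (g z) < e.
Proof.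
move=> e0; have := hasps_log_inverse (z := 0); rewrite cmod0 => /(_ ltr01) h.
have r0 : 0 < complex.Re (1 - 0 : C R) by rewrite subr0.
have := hasps_cvg0 r0 h; rewrite log_inverse_coef0 => /cvg_epsdelta/(_ e0)[d d0 hd].
by exists d => // z zd; have := hd z; rewrite subr0 add0r subr0; apply.
Qed.

Lemma clog_small (e : R) : 0 < e ->
  exists2 d : R, 0 < d & forall z, cmod z < d -> cmod (clog (1 - z)) < e.
Proof.
move=> e0; have r1 : 0 < complex.Re (1 : C R) by [].
have := hasps_cvg0 r1 (hasps_clog r1); rewrite /= clog1 => /cvg_epsdelta/(_ e0)[d d0 hd].
by exists d => // z zd; have := hd z; rewrite !subr0; apply.
Qed.

Definition Rformula z : C R := - (g z)^-1 - z^-1.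

(** The poles of 1 / g and 1 / z at 0 cancel: with G = g / z, which is - 1 at 0, the formula becomes
    - (1 + G) / (z G) = - Q / G, and Q = (1 + G) / z is analytic because 1 + G vanishes at 0. *)
Lemma exists_Rformula : exists F : C R -> C R,
  analytic_on unit_disc F /\ forall z, z != 0 -> F z = Rformula z.
Proof.
have r0 : 0 < complex.Re (1 - 0 : C R) by rewrite subr0.
set r := complex.Re _ in r0.
have r1 : r = 1 by rewrite /r subr0.
set a := @log_inverse_coef 0.
have ha : hasps r a g.
  apply: hasps_ext (hasps_log_inverse _); last by rewrite cmod0.
  by move=> u _; rewrite add0r.
have hG := hasps_unshift r0 log_inverse_coef0 ha.
set G := (fun u => _) in hG.
have a1 : log_inverse_coef 0 1 != 0 by rewrite log_inverse_coef1 oppr_eq0 oner_eq0.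
have [s s0 [b hV]] := hasps_inv r0 a1 hG.
have hP := hasps_add (@hasps_cst R r 1) hG.
have P0 : 1 + a 1%N = 0 by rewrite /a log_inverse_coef1 subrr.
have hQ := hasps_unshift r0 P0 hP.
set Q := (fun u => _) in hQ.
exists (fun z => if z == 0 then - (Q 0 * (G 0)^-1) else Rformula z).
split; last by move=> z /negPf ->.
apply: hasps_analytic => z z1; have [->|z0] := eqVneq z 0.
  exists (Num.min r s); first by rewrite lt_min r0.
  eexists; apply: hasps_ext (hasps_opp (hasps_mul (hasps_le _ hQ) (hasps_le _ hV))).
  - move=> u; rewrite lt_min r1 => /andP[u1 _]; rewrite add0r.
    case: eqVneq => [->//|u0].
    have g0 := log_inverse_neq0 u1 u0.
    rewrite /Q /G /Rformula (negPf u0).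
    by field; rewrite u0 g0.
  - by rewrite ge_min lexx.
  - by rewrite ge_min lexx orbT.
have h := hasps_log_inverse z1.
have c0 : log_inverse_coef z 0 != 0.
  by rewrite -(hasps_value (Re_1B_gt0 z1) h) addr0 log_inverse_neq0.
have [s2 s20 [b2 h2]] := hasps_inv (Re_1B_gt0 z1) c0 h.
have hid : hasps 1 (fun n => (if n is 0 then z else 0) + (n == 1)%:R) (fun u => z + u).
  by apply: hasps_add; [exact: hasps_cst|exact: hasps_id].
have z0' : z + (0%N == 1%N)%:R != 0 by rewrite /= addr0.
have [s3 s30 [b3 h3]] := hasps_inv ltr01 z0' hid.
(* A radius of at most |z| keeps z + u away from 0, where F has its own clause. *)
pose m := Num.min (cmod z) (Num.min s2 s3).
have m0 : 0 < m by rewrite !lt_min cmod_gt0 z0 s20.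
exists m => //.
eexists; apply: hasps_ext (hasps_add (hasps_opp (hasps_le _ h2)) (hasps_opp (hasps_le _ h3))).
- move=> u; rewrite lt_min => /andP[uz _].
  case: eqVneq => // /eqP zu; exfalso.
  by move: zu uz; rewrite addr_eq0 => /eqP ->; rewrite cmodN ltxx.
- by rewrite !ge_min lexx orbT.
- by rewrite !ge_min lexx !orbT.
Qed.

(** Near 0 the derivative of w e^w - w is at most 1/4 in modulus, so this function is Lipschitz with
    constant 1/2 after the factor 2 of [cder_bound]; equal values of w e^w then give |w2 - w1| <=
    |w2 - w1| / 2. *)
Lemma wexp_inj_near0 : exists2 rho : R, 0 < rho &
  forall w1 w2, cmod w1 < rho -> cmod w2 < rho -> w1 * cexp w1 = w2 * cexp w2 -> w1 = w2.
Proof.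
(* |e^w - 1| < 1/12 and |w| |e^w| <= 2/12 add up to 1/4. *)
have q0 : 0 < 12^-1 :> R by rewrite invr_gt0.
have [d' d'0 hd'] := @cvg_epsdelta R cexp 0 (cexp 0) _ (@cexp_continuous R 0) q0.
pose d : R := Num.min d' 12^-1; have d0 : 0 < d by rewrite lt_min d'0.
have hd w : cmod w < d -> cmod ((1 + w) * cexp w - 1) <= 4^-1.
  rewrite lt_min => /andP[wd w12]; have := hd' w; rewrite subr0 cexp0 => /(_ wd) hc.
  have -> : (1 + w) * cexp w - 1 = (cexp w - 1) + w * cexp w by ring.
  have ce : cmod (cexp w) <= 2.
    by have := cmodB_ge (cexp w) 1; rewrite cmod1; lra.
  have : cmod w * cmod (cexp w) <= 12^-1 * 2.
    by apply: ler_pM; rewrite ?cmod_ge0// ltW.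
  by have := cmodD (cexp w - 1) (w * cexp w); rewrite cmodM; lra.
(* A point of the segment has modulus at most 2 |w1| + |w2| < d. *)
exists (d / 3); first by rewrite divr_gt0.
move=> w1 w2 h1 h2 E.
pose p (t : R) := w1 + t%:C * (w2 - w1).
have dp t : cder p t (w2 - w1).
  by rewrite -[w2 - w1]add0r; apply: cderD; [exact: cder_cst|exact: cder_line].
have psmall t : 0 <= t <= 1 -> cmod (p t) < d.
  move=> /andP[t0 t1]; rewrite (le_lt_trans (cmodD _ _))// cmodM cmod_real ger0_norm//.
  have h := cmodB w2 w1; have h' := cmod_ge0 (w2 - w1).
  have : t * cmod (w2 - w1) <= cmod (w2 - w1) by rewrite ler_piMl.
  lra.
have dpsi t : cder (fun s => p s * cexp (p s) + - 1 * p s) t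
    (((1 + p t) * cexp (p t) - 1) * (w2 - w1)).
  apply: cder_eq (cderD (cderM (dp t) (cder_exp (dp t))) (cderM (cder_cst (- 1) t) (dp t))) _.
  ring.
have := cder_bound (K := 4^-1 * cmod (w2 - w1)) (fun t _ => dpsi t).
have -> : p 1 = w2 by rewrite /p mul1r addrC subrK.
have -> : p 0 = w1 by rewrite /p mul0r addr0.
have -> : w2 * cexp w2 + - 1 * w2 - (w1 * cexp w1 + - 1 * w1) = - (w2 - w1) by rewrite E; ring.
rewrite cmodN => H.
have c2 : cmod (w2 - w1) <= 2 * (4^-1 * cmod (w2 - w1)).
  by apply: H => t t01; rewrite cmodM ler_wpM2r ?cmod_ge0// hd// psmall.
have := cmod_ge0 (w2 - w1) => c1.
have /eqP : cmod (w2 - w1) = 0 by lra.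
by rewrite cmod_eq0 subr_eq0 => /eqP.
Qed.

End RFormula.

Section RTransform.
Context {R : realType}.
Variables (mu : probability (measurableTypeR R) R) (L : R).
Hypothesis L0 : 0 < L.
Hypothesis mu_supp : mu [set x : R | (L < `|x|)%R] = 0%E.
Hypothesis mu_moments : has_moments mu (fun k => (k ^ k)%N%:R / (k.+1)`!%N%:R).
Implicit Types (z k : C R).

Lemma lambertT_large k : L + 4 <= cmod k ->
  [/\ admissible L k, stieltjes mu k = cauchyT mu L k & cmod (lambertT mu L k) <= 2 / cmod k].
Proof.
move=> kL; have ak : admissible L k by right; lra.
have ck : 0 < cmod k by have := L0; lra.
have os := admissible_off_supp ak.
split=> //; first exact: (stieltjesE mu_supp os).
have h : cmod (cauchyT mu L k) <= 2^-1.
  have Lk : L < cmod k by lra.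
  rewrite (le_trans (cauchyT_large mu Lk))// ler_pdivrMr; lra.
have T2 : 2^-1 <= cmod (1 + cauchyT mu L k).
  have := cmodB_ge 1 (- cauchyT mu L k); rewrite cmod1 cmodN opprK; lra.
rewrite /lambertT [cmod (- _)]cmodN cmodV cmodM invfM mulrC ler_wpM2r ?invr_ge0 ?cmod_ge0//.
by rewrite -[2]invrK lef_pV2 ?posrE ?invr_gt0// (lt_le_trans _ T2)// invr_gt0.
Qed.

(** |k| >= L + 4 makes |w| < 1 <= pi / 2, so the principal logarithm recovers w from e^w = T = 1 -
    z. *)
Lemma Rtransform_inverse_uniq k z : L + 4 <= cmod k -> stieltjes mu k = - z ->
  k = - (log_inverse z)^-1.
Proof.
move=> kL kz; have [ak sE wk] := lambertT_large kL.
have TE : 1 + cauchyT mu L k = 1 - z by rewrite -sE kz.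
have cE := cexp_lambertT L0 mu_supp mu_moments ak.
have wE := lambertT_eq L0 mu_supp mu_moments ak.
have ck : 0 < cmod k by have := L0; lra.
have w1 : cmod (lambertT mu L k) < 1.
  by rewrite (le_lt_trans wk)// ltr_pdivrMr// mul1r; have := L0; lra.
have lE : clog (1 - z) = lambertT mu L k.
  rewrite -TE -cE clog_cexp//; have := normIm_le (lambertT mu L k); have := pi_ge2 R.
  by rewrite ler_norml => ? /andP[? ?]; apply/andP; split; lra.
by rewrite /log_inverse lE -TE -cE mulrC wE invrN invrK opprK.
Qed.

(** Here e^w = 1 - z is the goal, so the logarithm cannot be taken first. But w and log (1 - z) are
    both close to 0 and solve the same equation w e^w = - 1 / k, hence coincide by
    [wexp_inj_near0]. *)
Lemma log_inverse_right_inverse : exists2 d : R, 0 < d &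
  forall z, z != 0 -> cmod z < d -> stieltjes mu (- (log_inverse z)^-1) = - z.
Proof.
have [rho rho0 inj] := @wexp_inj_near0 R.
pose M := L + 4 + 2 / rho.
have r2 : 0 < 2 / rho by rewrite divr_gt0.
have M0 : 0 < M by rewrite /M; have := L0; lra.
have iM : 0 < M^-1 by rewrite invr_gt0.
have [d1 d10 hd1] := log_inverse_small iM.
have [d2 d20 hd2] := @clog_small R _ rho0.
exists (Num.min 1 (Num.min d1 d2)); first by rewrite !lt_min ltr01 d10.
move=> z z0; rewrite !lt_min => /and3P[z1 zd1 zd2].
set k := - _; have g0 := log_inverse_neq0 z1 z0.
have kM : M < cmod k.
  by rewrite cmodN cmodV -[M]invrK ltf_pV2 ?posrE ?invr_gt0 ?cmod_gt0// hd1.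
have kL : L + 4 <= cmod k by rewrite /M in kM; lra.
have [ak sE wk] := lambertT_large kL.
have cE := cexp_lambertT L0 mu_supp mu_moments ak.
have wE := lambertT_eq L0 mu_supp mu_moments ak.
have ck : 0 < cmod k by rewrite (lt_trans M0).
have w1 : cmod (lambertT mu L k) < rho.
  rewrite (le_lt_trans wk)// ltr_pdivrMr// mulrC -ltr_pdivrMr//.
  by rewrite (le_lt_trans _ kM)// /M; have := L0; lra.
have lE : lambertT mu L k = clog (1 - z).
  apply: inj => //; first exact: hd2.
  by rewrite wE cexp_clog ?Re_1B_gt0// /k invrN invrK opprK mulrC.
have : 1 + cauchyT mu L k = 1 - z by rewrite -cE lE cexp_clog// Re_1B_gt0.
by rewrite sE => /addrI.
Qed.

Lemma log_inverse_inv_large (M : R) :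
  \forall z \near (0 : C R)^', M < cmod (- (log_inverse z)^-1).
Proof.
pose N := `|M| + 1; have N0 : 0 < N by rewrite ltr_wpDl.
have iN : 0 < N^-1 by rewrite invr_gt0.
have [d d0 hd] := log_inverse_small iN.
apply/dnearC; exists (Num.min 1 d); first by rewrite lt_min ltr01.
move=> z z0; rewrite subr0 lt_min => /andP[z1 zd].
rewrite cmodN cmodV (le_lt_trans (ler_norm M))// (@lt_trans _ _ N) ?ltrDl//.
by rewrite -[N]invrK ltf_pV2 ?posrE ?cmod_gt0 ?hd// log_inverse_neq0.
Qed.

(** Near 0 any K is forced: it is large and inverts the transform, so [Rtransform_inverse_uniq]
    applies. The identity theorem then spreads the formula over the disc, and continuity gives the
    limit at 0. *)
Lemma Rtransform_formula :
  (exists Rt, is_Rtransform mu unit_disc Rt)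
  /\ forall Rt, is_Rtransform mu unit_disc Rt ->
       (forall z, unit_disc z -> z != 0 ->
          Rt z = - ((1 - z) * clog (1 - z))^-1 - z^-1)
       /\ - ((1 - z) * clog (1 - z))^-1 - z^-1 @[z --> (0 : C R)^'] --> Rt 0.
Proof.
have [F [Fa FE]] := @exists_Rformula R.
split.
  exists F; split=> //; exists (fun z => - (log_inverse z)^-1).
  split; first exact: log_inverse_inv_large.
    have [d d0 hd] := log_inverse_right_inverse.
    by apply/dnearC; exists d => // z z0; rewrite subr0; exact: hd.
  by apply/dnearC; exists 1 => // z z0 _; exact: FE.
move=> Rt [Ra [K [Klarge KS KR]]].
have [e e0 he] : exists2 e : R, 0 < e & forall z, z != 0 -> cmod z < e -> Rt z = F z.
  move/dnearC: (Klarge (L + 4)) => [e1 e10 h1].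
  move/dnearC: KS => [e2 e20 h2]; move/dnearC: KR => [e3 e30 h3].
  exists (Num.min e1 (Num.min e2 e3)); first by rewrite !lt_min e10 e20.
  move=> z z0; rewrite !lt_min => /and3P[z1 z2 z3].
  rewrite h3 ?subr0// FE// /Rformula; congr (_ - _).
  by apply: Rtransform_inverse_uniq; [apply/ltW/h1; rewrite ?subr0|apply: h2; rewrite ?subr0].
have Da := analytic_onB Ra Fa.
have disc0 : @unit_disc R 0 by rewrite /unit_disc /= cmod0.
(* K constrains Rt only off 0; the value at 0 follows because the analytic difference vanishes at
   points accumulating there. *)
have D0 : forall z, cmod z < e -> Rt z - F z = 0.
  have [r r0 [a ha]] := analytic_hasps Da disc0.
  move=> z ze; have [->|z0] := eqVneq z 0; last by rewrite he// subrr.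
  have c00 : cmod (0 : C R) < r by rewrite cmod0.
  have := @hasps_identity R r a _ r0 ha _ 0 c00; rewrite addr0; apply=> b b0.
  pose x := Num.min b e / 2; have m0 : 0 < Num.min b e by rewrite lt_min b0.
  have x0 : 0 < x by rewrite divr_gt0.
  have : x < Num.min b e by rewrite /x; lra.
  rewrite lt_min => /andP[xb xe].
  have xn0 : x%:C != 0 :> C R by rewrite -cmod_gt0 cmod_real gtr0_norm.
  exists (x%:C); rewrite cmod_real gtr0_norm//; split=> //.
  by rewrite add0r he ?subrr// cmod_real gtr0_norm.
have RF z : cmod z < 1 -> Rt z = F z.
  by move=> z1; apply/eqP; rewrite -subr_eq0; apply/eqP; exact: (unit_disc_identity Da e0 D0).
split; first by move=> z z1 z0; rewrite RF// FE.
apply/cvgCP; apply/cvgrPdist_lt => b b0.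
have [d d0 hd] := analytic_continuous Ra disc0 b0.
apply/dnearC; exists (Num.min 1 d); first by rewrite lt_min ltr01.
move=> z z0; rewrite subr0 lt_min => /andP[z1 zd].
have := hd z; rewrite subr0 => /(_ zd).
by rewrite sub0r normrN ger0_norm ?cmod_ge0// (RF z z1) FE.
Qed.

End RTransform.

Local Close Scope complex_scope.

Theorem corollary1 (R : realType) (mu0 : probability (measurableTypeR R) R)
    (mu0_moments :
       has_moments mu0 (fun k => (k ^ k)%N%:R / (k.+1)`!%N%:R)) :
  [/\ (exists f0 : R -> R,
         is_density mu0 f0 /\ (forall x : R, x != 0 -> {for x, continuous f0}))
      /\ msupport mu0 = `[0, expR 1]%classic,
      forall W : C R -> C R, is_lambertW0 W ->
        forall z : C R, 0 < complex.Im z ->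
          stieltjes mu0 z = - 1 - (z * W (- z^-1))^-1
          /\ stieltjes mu0 z = - 1 + cexp (W (- z^-1))
    & (exists Rt, is_Rtransform mu0 unit_disc Rt)
      /\ forall Rt, is_Rtransform mu0 unit_disc Rt ->
           (forall z, unit_disc z -> z != 0 ->
              Rt z = - ((1 - z) * clog (1 - z))^-1 - z^-1)
           /\ - ((1 - z) * clog (1 - z))^-1 - z^-1 @[z --> (0 : C R)^'] --> Rt 0].
Proof.
(* Any L > e carries the whole mass by [measure_tail0]; the exact end point e comes out of the
   density. *)
have L0 : 0 < expR 1 + 1 :> R by rewrite addr_gt0 ?expR_gt0.
have eL : expR 1 < expR 1 + 1 :> R by rewrite ltrDl.
have mu_supp := measure_tail0 mu0_moments eL.
split.
- exact: (density_support L0 mu_supp mu0_moments).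
- by move=> W hW z z0; apply: (stieltjes_formula L0 mu_supp mu0_moments hW z0).
- exact: (Rtransform_formula L0 mu_supp mu0_moments).
Qed.
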